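(* There exist absolute constants $c_1,C,c'>0$ and $c_2\in(0,1)$ such that the following holds in the setup of the context. Assume $\|A_l^*\|_2\le\rho_{\max}<1$ for all $l\in[m]$, and put $\Delta=(1-\rho_{\max})^2$. Let $\delta\in(0,c_2)$, $v\ge1$, $\mathcal S\subseteq[|\mathcal E|d^2]$, and $$L_1=\log\Big(\frac{dT}{\delta\Delta}\Big),\quad L_2=\log\Big(\frac{d|\mathcal E|}{\delta}\Big),\quad \Phi_{\mathcal S}=1+\frac{\sqrt{|\mathcal S|}}{\kappa_{\mathcal S}}+\sqrt T\,\|(\widetilde Da^* )_{\mathcal S^c}\|_1 .$$ Choose $\lambda=\frac{c_1}{m}\sqrt{\frac T\Delta}\max\{d^{3/2}L_1,\ \mu L_2\}$ and suppose $$T\ge C\frac{v}{\Delta^2}\big(1+\mu'\Phi_{\mathcal S}\sqrt{L_2}\big)^2,\quad T\ge C\frac{(d+v)^2}{m\Delta^2},\quad T\ge C\frac{\mu^2\Phi_{\mathcal S}^2L_2^2d^2}{m\Delta^2},\quad T\ge C\frac{\mu}{\sqrt m}\Phi_{\mathcal S}\,d\,\Delta_G .$$ Then with probability at least $1-4\exp(-c'\sqrt v)-\delta$, $$\|\widehat a-a^*\|_2\le\frac{2m\lambda}{T}\Big(1+3\frac{\sqrt{|\mathcal S|}}{\kappa_{\mathcal S}}\Big)+\sqrt{8\frac{m\lambda}{T}\|(\widetilde Da^* )_{\mathcal S^c}\|_1}+\frac1{\sqrt T}.$$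
   Context: Setup. Let $d,T\ge1$, $m\ge2$ be integers and $G=([m],\mathcal E)$ an undirected connected graph. Let $A_1^*,\dots,A_m^*\in\mathbb R^{d\times d}$ be deterministic matrices. For each $l\in[m]$, $x_{l,0}=0$ and $x_{l,t+1}=A_l^*x_{l,t}+\eta_{l,t+1}$ for $t=0,\dots,T$, where the $\eta_{l,t}$ are i.i.d. $\mathcal N(0,I_d)$ over all $l,t$. Vectorized model. $\mathrm{vec}$ stacks columns. $X_l=[x_{l,1}\cdots x_{l,T}]$, $\widetilde X_l=[x_{l,2}\cdots x_{l,T+1}]$, both in $\mathbb R^{d\times T}$. $Q=\mathrm{blkdiag}(X_l^\top\otimes I_d)_{l=1}^m$; $a^*\in\mathbb R^{md^2}$ and $\widetilde x\in\mathbb R^{mdT}$ are obtained by stacking over $l$ the vectors $\mathrm{vec}(A_l^* )$ and $\mathrm{vec}(\widetilde X_l)$. Graph quantities. $D\in\{-1,0,1\}^{|\mathcal E|\times m}$ is the incidence matrix of an arbitrary orientation of $G$ (each row has one $+1$ and one $-1$, at the endpoints of the edge), $\widetilde D=D\otimes I_{d^2}$, and $D^\dagger$ is the Moore–Penrose pseudoinverse. $\mu$ is the maximum Euclidean norm of a column of $D^\dagger\in\mathbb R^{m\times|\mathcal E|}$, and $\mu'$ the maximum Euclidean norm of a row of $D^\dagger$. For $\mathcal T\subseteq[d^2|\mathcal E|]$ the compatibility factor is $\kappa_\emptyset=1$ and $\kappa_{\mathcal T}=\inf_{\theta\in\mathbb R^{md^2}}\frac{\sqrt{|\mathcal T|}\,\|\theta\|_2}{\|(\widetilde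 D\theta)_{\mathcal T}\|_1}$ for $\mathcal T\ne\emptyset$ (infimum over $\theta$ with nonzero denominator). $(x)_{\mathcal T}$ denotes restriction of $x$ to coordinates in $\mathcal T$; $\mathcal S^c$ is the complement in $[|\mathcal E|d^2]$. System quantities. $\Gamma_t(A)=\sum_{k=0}^tA^k(A^k)^\top$, $G_l=\sum_{t=1}^T\Gamma_{t-1}(A_l^* )$, $\overline G=\frac1m\sum_{l=1}^mG_l$, and $\Delta_G=\max_{a,b\in[d]}\big(\sum_{l=1}^m[(G_l)_{b,a}-(\overline G)_{b,a}]^2\big)^{1/2}$. $\|\cdot\|_2$ of a matrix is the spectral norm. Estimator. For $\lambda\ge0$, $\widehat a\in\arg\min_{a\in\mathbb R^{md^2}}\big\{\frac1{2m}\|\widetilde x-Qa\|_2^2+\lambda\|\widetilde Da\|_1\big\}$ (any minimizer). *)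

(* Defs.v *)
From HB Require Import structures.
From mathcomp Require Import all_boot all_order all_algebra.
From mathcomp Require Import mxtens.
From mathcomp Require Import all_classical all_reals all_analysis.

Set Implicit Arguments.
Unset Strict Implicit.
Unset Printing Implicit Defensive.

Import Order.TTheory GRing.Theory Num.Theory.
Import numFieldNormedType.Exports.

Local Open Scope ring_scope.

(* All stacked objects share the index convention of [tensmx] (Kronecker
   product): the pair (i, j) : 'I_p * 'I_q sits at position i * q + j of
   'I_(p * q), so the first component selects the block. *)

Section Norms.
Variable R : realType.

Definition norm2 n (u : 'cV[R]_n) : R := Num.sqrt (\sum_i u i 0 ^+ 2).

Definition norm1 n (u : 'cV[R]_n) : R := \sum_i `|u i 0|.

Definition norm1_on n (S : {set 'I_n}) (u : 'cV[R]_n) : R :=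
  \sum_(i in S) `|u i 0|.

Definition spectral_norm n (A : 'M[R]_n) : R :=
  sup [set norm2 (A *m u) | u in [set u : 'cV[R]_n | norm2 u <= 1]]%classic.

End Norms.

Section Vectorization.
Variable R : realType.

(* column stacking: entry (i, j) goes to position j * p + i; [mxvec] stacks
   rows instead *)
Definition vec p q (M : 'M[R]_(p, q)) : 'cV[R]_(q * p) :=
  \col_k M (mxtens_unindex k).2 (mxtens_unindex k).1.

Definition stack m n (u : 'I_m -> 'cV[R]_n) : 'cV[R]_(m * n) :=
  \col_k u (mxtens_unindex k).1 (mxtens_unindex k).2 0.

(* [\mxdiag] has dimensions of the form \sum_(l < m) p, which do not unify
   with the dimension m * p of a Kronecker product *)
Definition blkdiag m p q (B : 'I_m -> 'M[R]_(p, q)) : 'M[R]_(m * p, m * q) :=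
  \matrix_(i, j)
    if (mxtens_unindex i).1 == (mxtens_unindex j).1
    then B (mxtens_unindex i).1 (mxtens_unindex i).2 (mxtens_unindex j).2
    else 0.

End Vectorization.

Section Graph.
Variables (R : realType) (m : nat).

(* A simple graph on 'I_m is given by its edge set, a set of 2-subsets. *)
Definition simple_graph (E : {set {set 'I_m}}) : Prop :=
  forall e, e \in E -> #|e| = 2.

Definition connected_graph (E : {set {set 'I_m}}) : Prop :=
  forall i j, connect [rel a b | [set a; b]%SET \in E] i j.

(* The oriented edges src k -> tgt k list E; as there are #|E| of them, each
   edge is listed exactly once. *)
Definition orientation (E : {set {set 'I_m}}) (src tgt : 'I_#|E| -> 'I_m)
  : Prop :=
  [set [set src k; tgt k] | k : 'I_#|E|]%SET = E.

Definition incidence n (src tgt : 'I_n -> 'I_m) : 'M[R]_(n, m) :=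
  \matrix_(k, i) ((i == src k)%:R - (i == tgt k)%:R).

End Graph.

Section MoorePenrose.
Variable R : realType.

(* The Penrose equations, which determine B. MathComp's [pinvmx] is only some
   generalized inverse. *)
Definition is_moore_penrose p q (A : 'M[R]_(p, q)) (B : 'M[R]_(q, p)) : Prop :=
  [/\ A *m B *m A = A, B *m A *m B = B,
      (A *m B)^T = A *m B & (B *m A)^T = B *m A].

Definition max_col_norm p q (A : 'M[R]_(p, q)) : R :=
  \big[Num.max/0]_(j < q) norm2 (col j A).

Definition max_row_norm p q (A : 'M[R]_(p, q)) : R :=
  \big[Num.max/0]_(i < p) norm2 (row i A)^T.

End MoorePenrose.

Definition compatibility (R : realType) p n (W : 'M[R]_(p, n))
    (S : {set 'I_p}) : R :=
  if S == finset.set0 then 1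
  else inf [set Num.sqrt #|S|%:R * norm2 u / norm1_on S (W *m u)
             | u in [set u : 'cV[R]_n | norm1_on S (W *m u) != 0]]%classic.

Section System.
Variables (R : realType) (d T m : nat).

Definition Gamma (A : 'M[R]_d) (t : nat) : 'M[R]_d :=
  \sum_(0 <= k < t.+1) (A ^+ k) *m (A ^+ k)^T.

Definition gramian (A : 'M[R]_d) : 'M[R]_d :=
  \sum_(1 <= t < T.+1) Gamma A t.-1.

Definition mean_gramian (A : 'I_m -> 'M[R]_d) : 'M[R]_d :=
  m%:R^-1 *: \sum_(l < m) gramian (A l).

Definition gramian_spread (A : 'I_m -> 'M[R]_d) : R :=
  \big[Num.max/0]_(a < d) \big[Num.max/0]_(b < d)
    Num.sqrt (\sum_(l < m) (gramian (A l) b a - mean_gramian A b a) ^+ 2).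

Fixpoint traj (A : 'M[R]_d) (eta : nat -> 'cV[R]_d) (t : nat) : 'cV[R]_d :=
  if t is s.+1 then A *m traj A eta s + eta s.+1 else 0.

(* Column t : 'I_T of the two data matrices holds the states at times t + 1
   and t + 2. *)
Definition Xmx (x : nat -> 'cV[R]_d) : 'M[R]_(d, T) :=
  \matrix_(i, t) x t.+1 i 0.

Definition Xtmx (x : nat -> 'cV[R]_d) : 'M[R]_(d, T) :=
  \matrix_(i, t) x t.+2 i 0.

Definition design (x : 'I_m -> nat -> 'cV[R]_d)
    : 'M[R]_(m * (T * d), m * (d * d)) :=
  blkdiag (fun l => tensmx (Xmx (x l))^T (1%:M : 'M[R]_d)).

Definition response (x : 'I_m -> nat -> 'cV[R]_d) : 'cV[R]_(m * (T * d)) :=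
  stack (fun l => vec (Xtmx (x l))).

Definition objective p (W : 'M[R]_(p, m * (d * d))) (lambda : R)
    (x : 'I_m -> nat -> 'cV[R]_d) (a : 'cV[R]_(m * (d * d))) : R :=
  (2 * m%:R)^-1 * norm2 (response x - design x *m a) ^+ 2
  + lambda * norm1 (W *m a).

Definition is_estimator p (W : 'M[R]_(p, m * (d * d))) (lambda : R)
    (x : 'I_m -> nat -> 'cV[R]_d) (a : 'cV[R]_(m * (d * d))) : Prop :=
  forall b, objective W lambda x a <= objective W lambda x b.

End System.

Section Noise.
Variables (R : realType) (disp : measure_display) (Omega : measurableType disp).
Variable P : probability Omega R.

Definition mutual_indep (I : finType) (F : I -> set (set Omega)) : Prop :=
  forall (J : {set I}) (B : I -> set Omega),
    (forall i, i \in J -> F i (B i)) ->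
    fine (P (\bigcap_(i in [set` J]) B i)%classic)
    = \prod_(i in J) fine (P (B i)).

(* A random vector of R^d is the family of its coordinates; [g_sigma_preimage]
   is then the sigma-algebra it generates. The law N(0, I_d) is that of d
   independent standard normal coordinates. Measures are total functions on
   sets, hence laws are compared on measurable sets only. *)
Definition std_gaussian_vector d (X : 'I_d -> {RV P >-> R}) : Prop :=
  mutual_indep (fun i => preimage_set_system setT (X i) measurable)
  /\ forall i (B : set R), measurable B ->
       distribution P (X i) B = normal_prob 0 1 B.

Definition iid_std_gaussian d (I : finType) (X : I -> 'I_d -> {RV P >-> R})
  : Prop :=
  mutual_indep (fun i => g_sigma_preimage (fun j => X i j : Omega -> R))
  /\ forall i, std_gaussian_vector (X i).

End Noise.

(* Main.v *)
Require Import Defs.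
From HB Require Import structures.
From mathcomp Require Import all_boot all_order all_algebra.
From mathcomp Require Import mxtens.
From mathcomp Require Import all_classical all_reals all_analysis.
From mathcomp Require Import measurable_realfun.
From mathcomp Require Import ring lra zify.

Set Implicit Arguments.
Unset Strict Implicit.
Unset Printing Implicit Defensive.

Import Order.TTheory GRing.Theory Num.Theory.
Import numFieldNormedType.Exports.

Local Open Scope ring_scope.

(* Let h be the estimation error and split its blocks as h_l = M + U_l, where M is
   the average block and U = D^+ D h is carried by the edges. The optimality of
   the estimator yields the cone condition ||D h||_1 <= 4 Phi ||h||_2 once
   ||h||_2 >= 1 / sqrt T, and the usual Lasso argument then reduces the claim to
   bounds on the noise and to the restricted eigenvalue inequality
   ||Q h||^2 >= (T / 2) ||h||^2 on that cone.

   All states are linear in the Gaussian noise, so every random quantity is a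
   quadratic form in independent standard normals. The Hanson-Wright tail comes
   from a bound on the exponential moment obtained by integrating out one
   coordinate at a time: each step replaces the matrix by a Schur complement.
   The restricted eigenvalue inequality is uniform over an l1 ball; the deviation
   of ||Q u||^2 from its mean is chained along sparse vectors with coordinates on
   a grid, 4^k nonzero coordinates at level k, whose distances to u sum up, with
   weights 2^k, to a multiple of the l1 radius without loss of a logarithm. The
   common part M is handled by the same chaining over one row of M at a time. The
   cross term between M and U needs only Hanson-Wright, its mean being governed by
   the spread of the Gramians because the columns of D^+ sum to zero. *)

(** * Gaussian families and quadratic forms *)

(** The obstacle is that Hanson-Wright has a term linear in the level [y], while chaining uses
    levels that grow like 4^k, eventually far above T; bounding the links by Hanson-Wright alone
    would demand more samples than are assumed. Two devices remove the excess. Each link is split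
    according to which systems carry a large block, the large ones being so few that Cauchy-Schwarz
    suffices there; the price is a factor ||Q s||. The chaining bound therefore contains the
    supremum of ||Q u|| over the very set being controlled, and it is closed as a quadratic
    inequality in that supremum. This needs nets inside the set, so grid vectors are replaced by
    nearby members of it. A fixed fraction of T is all that has to be reached: the mean of ||Q h||^2
    is at least T ||h||^2, and the errors of the common part, of the edge part and of the cross term
    take T/6 each, which leaves T/2. *)

Section GaussianFamily.
Local Open Scope classical_set_scope.
Variables (R : realType) (disp : measure_display) (Omega : measurableType disp).
Variable P : probability Omega R.

Definition gaussian_family (I : finType) (X : I -> {RV P >-> R}) : Prop :=
  mutual_indep P (fun i => preimage_set_system setT (X i) measurable)
  /\ forall i (B : set R), measurable B -> P (X i @^-1` B) = normal_prob 0 1 B.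

(** The intersection over pairs is regrouped by the first index: each group of events lies in the
    sigma-algebra of one vector, so independence between vectors and then between coordinates gives
    the double product. *)
Lemma iid_std_gaussian_family (I : finType) d (X : I -> 'I_d -> {RV P >-> R}) :
  iid_std_gaussian X -> gaussian_family (fun p : I * 'I_d => X p.1 p.2).
Proof.
move=> [indI indX]; split; last by move=> [i j] B mB /=; exact: (indX i).2.
move=> J B hB.
pose J1 (i : I) : {set 'I_d} := [set j | (i, j) \in J]%SET.
pose B1 i := \bigcap_(j in [set` J1 i]) B (i, j).
have hB1 i : g_sigma_preimage (fun j => X i j : Omega -> R) (B1 i).
  rewrite /B1.
  apply: (@fin_bigcap_measurable _ (g_sigma_algebraType
    (\big[setU/set0]_(j < d) preimage_set_system setT (X i j : Omega -> R) measurable))).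
    exact: finite_finset.
  move=> j; rewrite /= inE => hj; apply: sub_sigma_algebra.
  rewrite (bigD1 j)//=; left; apply: (hB (i, j) hj).
have cap_eq : \bigcap_(p in [set` J]) B p = \bigcap_(i in [set` [set: I]%SET]) B1 i.
  apply/seteqP; split=> w hw.
    by move=> i _ j /=; rewrite inE => hj; exact: hw.
  by move=> [i j] hp; apply: (hw i); rewrite /= inE.
rewrite cap_eq (indI [set: I]%SET B1); last by move=> i _; exact: hB1.
under eq_bigr => i _.
  rewrite /B1 ((indX i).1 (J1 i) (fun j => B (i, j))); last first.
    by move=> j; rewrite inE => hj; exact: (hB (i, j)).
  over.
rewrite (eq_bigl xpredT); last by move=> i; rewrite inE.
rewrite pair_big_dep /=; apply: eq_big; last by move=> [].
by move=> [i j] /=; rewrite inE.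
Qed.

Variables (I : finType) (X : I -> {RV P >-> R}).
Hypothesis gX : gaussian_family X.

(** The pi-system of events about the coordinates other than [k]. The intersection runs over all of
    [I] with [B k = setT], so that adding an event about [X k] gives an intersection of the same
    shape. *)
Definition cylinders (k : I) : set (set Omega) :=
  [set A | exists B : I -> set R, [/\ forall i, measurable (B i), B k = setT
     & A = \bigcap_(i in [set: I]) X i @^-1` B i]].

Lemma cylinders_setI k : setI_closed (cylinders k).
Proof.
move=> _ _ [B [mB Bk ->]] [C [mC Ck ->]].
exists (fun i => B i `&` C i); split.
- by move=> i; exact: measurableI.
- by rewrite Bk Ck setIT.
- by rewrite -bigcapI; apply: eq_bigcap.
Qed.

Lemma gaussian_family_cap (B : I -> set R) : (forall i, measurable (B i)) ->
  P (\bigcap_(i in [set: I]) X i @^-1` B i) = (\prod_i fine (P (X i @^-1` B i)))%:E.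
Proof.
move=> mB.
have := gX.1 [set: I]%SET (fun i => X i @^-1` B i).
have -> : [set` [set: I]%SET] = [set: I] by apply/seteqP; split=> // x _ /=; rewrite inE.
move=> H; rewrite -(eq_bigl _ _ (fun i => finset.in_setT i)) -H; last first.
  by move=> i _; exists (B i) => //; rewrite setTI.
rewrite fineK// fin_num_measure//.
apply: fin_bigcap_measurable; first exact: finite_finset.
by move=> i _; exact: measurable_funPTI.
Qed.

Lemma cylinders_measurable k : cylinders k `<=` measurable.
Proof.
move=> _ [B [mB _ ->]].
apply: fin_bigcap_measurable; first exact: finite_finset.
by move=> i _; exact: measurable_funPTI.
Qed.

(** As functions of [A] both sides are finite measures, the restriction of P to an event about [X k]
    and a multiple of P. They agree on a pi-system containing the whole space, hence on the
    sigma-algebra it generates. *)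
Lemma cylinders_indep k (A : set Omega) (C : set R) : <<s cylinders k >> A ->
  measurable C -> P (A `&` X k @^-1` C) = (P A * P (X k @^-1` C))%E.
Proof.
move=> sA mC.
have mXC : measurable (X k @^-1` C) by exact: measurable_funPTI.
have c0 : (0 <= fine (P (X k @^-1` C)))%R by apply: fine_ge0.
have PXC : P (X k @^-1` C) = (fine (P (X k @^-1` C)))%:E.
  by rewrite fineK// fin_num_measure.
rewrite -[LHS]/(mrestr P mXC A).
have msE A' : mscale (NngNum c0) P A' = (P A' * P (X k @^-1` C))%E.
  by rewrite muleC [X in (X * _)%E]PXC.
rewrite -msE.
apply: (@g_sigma_algebra_measure_unique _ _ _ (cylinders k)
  (@cylinders_measurable k) (fun=> setT)) => //.
- move=> _; exists (fun=> setT); split=> //.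
  by apply/esym/seteqP; split=> // x _ i _.
- by rewrite bigcup_const.
- exact: cylinders_setI.
- move=> _ [B [mB Bk ->]]; rewrite [RHS]msE.
  change (P (\bigcap_(i in [set: I]) X i @^-1` B i `&` X k @^-1` C) =
    (P (\bigcap_(i in [set: I]) X i @^-1` B i) * P (X k @^-1` C))%E).
  pose B' i := if i == k then C else B i.
  have -> : \bigcap_(i in [set: I]) X i @^-1` B i `&` X k @^-1` C =
      \bigcap_(i in [set: I]) X i @^-1` B' i.
    apply/seteqP; split=> w.
      by move=> [h1 h2] i _ /=; rewrite /B'; case: eqP => [->|_]; [exact: h2|exact: h1].
    move=> h; split; last by have := h k Logic.I; rewrite /B' /= eqxx.
    move=> i _; have := h i Logic.I; rewrite /B' /=; case: eqP => [->|//].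
    by rewrite Bk.
  rewrite !gaussian_family_cap//; last by move=> i; rewrite /B'; case: eqP.
  rewrite PXC -EFinM (bigD1 k)//= [in RHS](bigD1 k)//= /B' eqxx Bk.
  rewrite preimage_setT probability_setT /= mul1r mulrC; congr ((_ * _)%:E).
 by apply: eq_bigr => i /negbTE ->.
- move=> _; apply: (@le_lt_trans _ _ 1%E); last exact: ltry.
  by apply: probability_le1; apply: measurableI.
Qed.

End GaussianFamily.

(** * Integration of one Gaussian coordinate *)

Section NormalQuadraticMgf.
Local Open Scope classical_set_scope.
Variable R : realType.

(** The change of variables yields an abstract Radon-Nikodym derivative; it equals [normal_pdf]
    almost everywhere because both have the same integral over every measurable set. *)
Lemma integral_normal_prob (f : R -> \bar R) : measurable_fun [set: R] f ->
  (forall x, 0 <= f x)%E ->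
  (\int[normal_prob 0 1]_x f x
   = \int[lebesgue_measure]_x (f x * (normal_pdf 0 1 x)%:E))%E.
Proof.
move=> mf f0; pose N := normal_prob (R := R) 0 1.
have dom : N `<< lebesgue_measure := normal_prob_dominates 0 1.
rewrite -(Radon_Nikodym_SigmaFinite.change_of_variables dom)//.
have irn := Radon_Nikodym_SigmaFinite.f_integrable dom.
apply: ae_eq_integral => //.
- by apply: emeasurable_funM => //; exact: (measurable_int _ irn).
- apply: emeasurable_funM => //; apply/measurable_EFinP.
  exact: measurable_normal_pdf.
- apply: ae_eqe_mul2l; apply: integral_ae_eq => //.
    by apply/measurable_EFinP; exact: measurable_normal_pdf.
  by move=> E _ mE; rewrite -Radon_Nikodym_SigmaFinite.f_integral.
Qed.

Lemma complete_square (x a b : R) : 1 - 2 * a != 0 ->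
  2 * b * x + a * x ^+ 2 + - (x - 0) ^+ 2 / (1 *+ 2)
  = 2 * b ^+ 2 / (1 - 2 * a)
    + - (x - 2 * b / (1 - 2 * a)) ^+ 2 / ((1 - 2 * a)^-1 *+ 2).
Proof. by move=> c0; rewrite -(mulr_natr _^-1 2); field. Qed.

Lemma normal_quadratic_mgf (a b : R) : a < 2^-1 ->
  (\int[normal_prob 0 1]_x (expR (2 * b * x + a * x ^+ 2))%:E
   = ((Num.sqrt (1 - 2 * a))^-1 * expR (2 * b ^+ 2 / (1 - 2 * a)))%:E)%E.
Proof.
move=> a2; set c := 1 - 2 * a.
have c0 : 0 < c by rewrite /c; lra.
pose s := (Num.sqrt c)^-1.
have s0 : s != 0 by rewrite invr_neq0// gt_eqF// sqrtr_gt0.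
have s2 : s ^+ 2 = c^-1 by rewrite exprVn sqr_sqrtr// ltW.
rewrite integral_normal_prob; last 2 first.
- apply/measurable_EFinP; apply: measurableT_comp => //.
  by apply: measurable_funD; apply: measurable_funM.
- by move=> x; rewrite lee_fin expR_ge0.
(* Completing the square turns the integrand into a constant times the normal density of mean
   [2 * b / c] and standard deviation [s]. *)
transitivity (\int[lebesgue_measure]_x
  ((s * expR (2 * b ^+ 2 / c))%:E * (normal_pdf (2 * b / c) s x)%:E))%E.
  apply: eq_integral => x _; rewrite -!EFinM; congr (_%:E).
  rewrite !normal_pdfE ?oner_neq0// /normal_peak /normal_fun s2.
  have -> : Num.sqrt (1 ^+ 2 * pi *+ 2) = Num.sqrt (pi *+ 2) :> R by rewrite expr1n mul1r.
  have -> : Num.sqrt (c^-1 * pi *+ 2) = s * Num.sqrt (pi *+ 2) :> R.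
    by rewrite -mulrnAr sqrtrM ?invr_ge0 ?ltW// sqrtrV ?ltW.
  set K := Num.sqrt (pi *+ 2); set e1 := expR _; set e2 := expR _; set e3 := expR _.
  set e4 := expR _.
  have -> : s * e3 * ((s * K)^-1 * e4) = K^-1 * (e3 * e4).
    by rewrite invfM mulrACA [X in X * _]mulrA divff// mul1r.
  rewrite mulrCA /e1 /e2 /e3 /e4 -!expRD; congr (_ * expR _).
  by rewrite expr1n; apply: complete_square; rewrite gt_eqF.
rewrite integralZl//; last exact: integrable_normal_pdf.
by rewrite integral_normal_pdf mule1.
Qed.

End NormalQuadraticMgf.

Section PeelCoordinate.
Local Open Scope classical_set_scope.
Variables (R : realType) (disp : measure_display) (Omega : measurableType disp).
Variable P : probability Omega R.
Variables (I : finType) (X : I -> {RV P >-> R}).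
Hypothesis gX : gaussian_family X.

Lemma cylinders_measurable_fun k j : j != k ->
  measurable_fun [set: g_sigma_algebraType (cylinders X k)] (X j : Omega -> R).
Proof.
move=> jk _ B mB; rewrite setTI; apply: sub_sigma_algebra.
exists (fun i => if i == j then B else setT); split.
- by move=> i; case: eqP.
- by rewrite eq_sym (negbTE jk).
- apply/seteqP; split=> w.
    by move=> h i _ /=; case: eqP => [->|].
  by move=> /(_ j Logic.I) /=; rewrite eqxx.
Qed.

(** [q] and [l] depend on the other coordinates only, so the law of [((q, l), X k)] is a product
    measure. By Tonelli the inner integral over [X k] is [normal_quadratic_mgf] with [b = l w]. *)
Lemma integral_peel k (q l : Omega -> R) (a : R) : a < 2^-1 ->
  measurable_fun [set: g_sigma_algebraType (cylinders X k)] q ->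
  measurable_fun [set: g_sigma_algebraType (cylinders X k)] l ->
  (\int[P]_w (expR (q w + 2 * l w * X k w + a * X k w ^+ 2))%:E
   = \int[P]_w ((Num.sqrt (1 - 2 * a))^-1
        * expR (q w + 2 * l w ^+ 2 / (1 - 2 * a)))%:E)%E.
Proof.
move=> a2 mq ml.
have sub : <<s cylinders X k >> `<=` measurable.
  by apply: smallest_sub; [exact: sigma_algebra_measurable|exact: cylinders_measurable].
pose V w : R * R := (q w, l w).
have mV : measurable_fun [set: g_sigma_algebraType (cylinders X k)] V.
  exact: measurable_fun_pair.
have mV' : measurable_fun [set: Omega] V.
  by move=> _ B mB; rewrite setTI; apply: sub; rewrite -[X in _ X]setTI; exact: mV.
pose Z w : (R * R) * R := (V w, X k w).
have mX : measurable_fun [set: Omega] (X k : Omega -> R) by [].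
have mZ : measurable_fun [set: Omega] Z by exact: measurable_fun_pair.
pose f (z : (R * R) * R) : \bar R :=
  (expR (z.1.1 + 2 * z.1.2 * z.2 + a * z.2 ^+ 2))%:E.
have f0 z : (0 <= f z)%E by rewrite lee_fin expR_ge0.
have mf : measurable_fun [set: (R * R) * R] f.
  apply/measurable_EFinP; apply: measurableT_comp => //.
  apply: measurable_funD; [apply: measurable_funD|].
  - exact: measurableT_comp.
  - apply: measurable_funM => //; apply: measurable_funM => //.
    exact: measurableT_comp.
  - apply: measurable_funM => //; apply: measurable_funX => //.
pose mVm : {mfun Omega >-> (R * R)%type} := HB.pack V (isMeasurableFun.Build _ _ _ _ V mV').
pose mZm : {mfun Omega >-> ((R * R) * R)%type} := HB.pack Z (isMeasurableFun.Build _ _ _ _ Z mZ).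
transitivity (\int[distribution P mZm]_z f z)%E.
  by rewrite ge0_integral_distribution.
pose N : probability _ R := normal_prob (R := R) 0 1.
(* The normal law is transported along the identity, to become a measure on the type of the second
   coordinate of [Z]. *)
have mid : measurable_fun [set: measurableTypeR R] (id : measurableTypeR R -> R).
  by move=> _ B mB; rewrite setTI.
pose idm : {mfun (measurableTypeR R) >-> R} :=
  HB.pack (id : measurableTypeR R -> R) (isMeasurableFun.Build _ _ _ _ _ mid).
transitivity (\int[(distribution P mVm \x distribution N idm)%E]_z f z)%E.
  pose m2 : {measure set ((R * R) * R) -> \bar R} :=
    (distribution P mVm \x distribution N idm)%E.
  apply: (eq_measure_integral m2) => A mA _; apply/esym.
  apply: product_measure_unique => // B C mB mC.
  change (P (V @^-1` B `&` X k @^-1` C) = (P (V @^-1` B) * normal_prob 0 1 C)%E).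
  rewrite (cylinders_indep gX)//; last first.
    by rewrite -[X in _ X]setTI; exact: mV.
  by rewrite gX.2.
rewrite fubini_tonelli1// ge0_integral_distribution//; last 2 first.
- exact: measurable_fun_fubini_tonelli_F.
- by move=> y; exact: integral_ge0.
apply: eq_integral => w _ /=; rewrite /fubini_F /f /=.
rewrite ge0_integral_distribution//; last first.
  apply/measurable_EFinP; apply: measurableT_comp => //.
  by apply: measurable_funD; [apply: measurable_funD => //|];
    apply: measurable_funM.
rewrite /comp /=.
under eq_integral => y _ do rewrite -addrA expRD EFinM.
rewrite ge0_integralZl//; last first.
  apply/measurable_EFinP; apply: measurableT_comp => //.
  by apply: measurable_funD; apply: measurable_funM.
by rewrite normal_quadratic_mgf// -EFinM expRD mulrCA.
Qed.

End PeelCoordinate.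

(** * Schur complements of bounded quadratic forms *)

Section QuadraticForms.
Variables (R : realType) (I : finType).
Implicit Types (J : {set I}) (M : I -> I -> R) (x : I -> R).

(** [J] holds the coordinates not yet integrated out. The matrix stays indexed by all of [I], so its
    type does not change when a coordinate is eliminated. *)
Definition quad J M x : R := \sum_(i in J) \sum_(j in J) M i j * (x i * x j).

Lemma quad_setD1 J M x k : k \in J -> (forall i j, M i j = M j i) ->
  quad J M x = quad (J :\ k)%SET M x
    + 2 * (\sum_(i in (J :\ k)%SET) M k i * x i) * x k + M k k * x k ^+ 2.
Proof.
move=> kJ symM; rewrite /quad (finset.big_setD1 k)//= (finset.big_setD1 k kJ)/=.
under [X in _ + X = _]eq_bigr => i _ do rewrite (finset.big_setD1 k kJ)/=.
rewrite big_split /=.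
have -> : \sum_(j in (J :\ k)%SET) M k j * (x k * x j)
    = (\sum_(i in (J :\ k)%SET) M k i * x i) * x k.
  by rewrite mulr_suml; apply: eq_bigr => i _; ring.
have -> : \sum_(j in (J :\ k)%SET) M j k * (x j * x k)
    = (\sum_(i in (J :\ k)%SET) M k i * x i) * x k.
  by rewrite mulr_suml; apply: eq_bigr => i _; rewrite symM; ring.
ring.
Qed.

Lemma quad_rank1 J M (b : I -> R) (s : R) x :
  quad J (fun i j => M i j + s * (b i * b j)) x
  = quad J M x + s * (\sum_(i in J) b i * x i) ^+ 2.
Proof.
rewrite expr2 mulr_suml mulr_sumr -big_split /=; apply: eq_bigr => i _.
rewrite mulr_sumr mulr_sumr -big_split /=; apply: eq_bigr => j _.
ring.
Qed.

Definition frob2 J M : R := \sum_(i in J) \sum_(j in J) M i j ^+ 2.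

Lemma frob2_setD1 J M k : k \in J -> (forall i j, M i j = M j i) ->
  frob2 J M = frob2 (J :\ k)%SET M + 2 * \sum_(i in (J :\ k)%SET) M k i ^+ 2
    + M k k ^+ 2.
Proof.
move=> kJ symM; rewrite /frob2 (finset.big_setD1 k)//= (finset.big_setD1 k kJ)/=.
under [X in _ + X = _]eq_bigr => i _ do rewrite (finset.big_setD1 k kJ)/=.
rewrite big_split /=.
under [X in _ + (X + _) = _]eq_bigr => i _ do rewrite symM.
ring.
Qed.

Lemma frob2_rank1 J M (b : I -> R) (s : R) :
  frob2 J (fun i j => M i j + s * (b i * b j))
  = frob2 J M + 2 * s * quad J M b + s ^+ 2 * (\sum_(i in J) b i ^+ 2) ^+ 2.
Proof.
have -> : (\sum_(i in J) b i ^+ 2) ^+ 2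
    = \sum_(i in J) \sum_(j in J) b i ^+ 2 * b j ^+ 2.
  by rewrite expr2 mulr_suml; apply: eq_bigr => i _; rewrite mulr_sumr.
rewrite /frob2 /quad !mulr_sumr -!big_split /=; apply: eq_bigr => i _.
rewrite !mulr_sumr -!big_split /=; apply: eq_bigr => j _; ring.
Qed.

Lemma quad_bounded_split J M k (kappa : R) : k \in J ->
  (forall i j, M i j = M j i) ->
  (forall x, `|quad J M x| <= kappa * \sum_(i in J) x i ^+ 2) ->
  forall x y, `|quad (J :\ k)%SET M x
      + 2 * (\sum_(i in (J :\ k)%SET) M k i * x i) * y + M k k * y ^+ 2|
    <= kappa * (y ^+ 2 + \sum_(i in (J :\ k)%SET) x i ^+ 2).
Proof.
move=> kJ symM bM x y.
pose ext i := if i == k then y else x i.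
have := bM ext; rewrite (quad_setD1 _ kJ symM) (finset.big_setD1 k kJ)/=.
have sw (F G : I -> R) : (forall i, i != k -> F i = G i) ->
    \sum_(i in (J :\ k)%SET) F i = \sum_(i in (J :\ k)%SET) G i.
  by move=> FG; apply: eq_bigr => i; rewrite in_setD1 => /andP[ik _]; exact: FG.
have extk : ext k = y by rewrite /ext eqxx.
have extN i : i != k -> ext i = x i by rewrite /ext => /negbTE ->.
rewrite extk (sw (fun i => M k i * ext i) (fun i => M k i * x i)); last first.
  by move=> i ik; rewrite extN.
rewrite (sw (fun i => ext i ^+ 2) (fun i => x i ^+ 2)); last first.
  by move=> i ik; rewrite extN.
suff -> : quad (J :\ k)%SET M ext = quad (J :\ k)%SET M x by [].
apply: eq_bigr => i; rewrite in_setD1 => /andP[ik _]; rewrite extN//.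
by apply: sw => j jk; rewrite extN.
Qed.

Lemma quad_column_bounded J M k (kappa : R) : 0 < kappa -> k \in J ->
  (forall i j, M i j = M j i) ->
  (forall x, `|quad J M x| <= kappa * \sum_(i in J) x i ^+ 2) ->
  `|M k k| <= kappa /\ \sum_(i in (J :\ k)%SET) M k i ^+ 2 <= kappa ^+ 2.
Proof.
move=> k0 kJ symM bM; split.
  have := quad_bounded_split kJ symM bM (fun=> 0) 1.
  rewrite /quad big1 ?add0r; last by move=> i _; apply: big1 => j _; rewrite !mulr0.
  rewrite big1 ?mulr0 ?mul0r ?add0r; last by move=> i _; rewrite mulr0.
  by rewrite expr1n mulr1 big1 ?addr0 ?mulr1// => i _; rewrite expr0n.
(* The column itself is the test vector, with k-th coordinate [kappa] and then [- kappa]. Combining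
   the two bounds gives [4 * kappa * B <= 2 * kappa * (kappa ^+ 2 + B)]. *)
have := quad_bounded_split kJ symM bM (M k) kappa.
have := quad_bounded_split kJ symM bM (M k) (- kappa).
set q := quad _ M _; set a := M k k.
under eq_bigr do rewrite -expr2.
set B := \sum_(i in _) _; rewrite sqrrN => /ler_normlP[h1 _] /ler_normlP[_ h2].
rewrite -subr_ge0 -(pmulr_rge0 _ k0).
by rewrite expr2 in h1 h2 *; lra.
Qed.

(* The bounded form survives the elimination of a coordinate: the Schur
   complement is the value of the form at an optimal k-th coordinate. *)
Lemma quad_schur_bounded J M k (kappa : R) : 0 < kappa -> kappa < 2^-1 -> k \in J ->
  (forall i j, M i j = M j i) ->
  (forall x, `|quad J M x| <= kappa * \sum_(i in J) x i ^+ 2) ->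
  forall x, `|quad (J :\ k)%SET
      (fun i j => M i j + 2 / (1 - 2 * M k k) * (M k i * M k j)) x|
    <= kappa * \sum_(i in (J :\ k)%SET) x i ^+ 2.
Proof.
move=> k0 k2 kJ symM bM x; rewrite quad_rank1.
have [/ler_normlP[a1 a2] _] := quad_column_bounded k0 kJ symM bM.
have bound := quad_bounded_split kJ symM bM x.
move: a1 a2 bound; set a := M k k; set b := \sum_(i in _) M k i * x i.
set S := \sum_(i in _) x i ^+ 2; set q := quad _ M x => a1 a2 bound.
have d0 : 0 < 1 - 2 * a by lra.
set t := b / (1 - 2 * a); have bt : b = t * (1 - 2 * a).
  by rewrite /t mulfVK// gt_eqF.
have -> : 2 / (1 - 2 * a) * b ^+ 2 = 2 * t ^+ 2 * (1 - 2 * a).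
  by rewrite bt; field; rewrite gt_eqF.
have := bound 0; rewrite mulr0 expr0n mulr0 !addr0 add0r => /ler_normlP[low _].
(* [2 * t] maximizes [2 * b * y + a * y ^+ 2 - y ^+ 2 / 2] over [y], the exponent together with the
   Gaussian weight. *)
have := bound (2 * t); rewrite bt => /ler_normlP[_ up].
have t0 : 0 <= t ^+ 2 by exact: sqr_ge0.
apply/ler_normlP; split; first by have := mulr_ge0 t0 (ltW d0); lra.
have : 0 <= t ^+ 2 * (1 - 2 * kappa) by apply: mulr_ge0 => //; lra.
move: up; rewrite exprMn; lra.
Qed.

End QuadraticForms.

(** * Exponential moment of a Gaussian quadratic form *)

Section QuadraticMgf.
Local Open Scope classical_set_scope.
Variables (R : realType) (disp : measure_display) (Omega : measurableType disp).
Variable P : probability Omega R.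
Variables (I : finType) (X : I -> {RV P >-> R}).
Hypothesis gX : gaussian_family X.

Lemma measurable_quad d (S : measurableType d) (J : {set I}) (M : I -> I -> R)
    (Y : I -> S -> R) :
  (forall i, i \in J -> measurable_fun [set: S] (Y i)) ->
  measurable_fun [set: S] (fun w => quad J M (fun i => Y i w)).
Proof.
move=> mY; rewrite /quad; under eq_fun do rewrite big_mkcond /=.
apply: measurable_sum => i; case: (boolP (i \in J)) => iJ //.
under eq_fun do rewrite big_mkcond /=.
apply: measurable_sum => j; case: (boolP (j \in J)) => jJ //.
by apply: measurable_funM => //; apply: measurable_funM; exact: mY.
Qed.

(** Since [1 + 2 * z <= expR (2 * z)], it suffices that [1 <= (1 - 2 * a) * (1 + 2 * z)]; the excess
    is [2 * a ^+ 2 * (1 - 6 * a)]. *)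
Lemma invsqrt_le_expR (a : R) : `|a| <= 8^-1 ->
  (Num.sqrt (1 - 2 * a))^-1 <= expR (a + 3 * a ^+ 2).
Proof.
move=> /ler_normlP[a1 a2]; have c0 : 0 < 1 - 2 * a by lra.
set z := a + 3 * a ^+ 2.
have aa := sqr_ge0 a.
have z0 : 0 < 1 + 2 * z by rewrite /z; lra.
have ez : expR (- z) ^+ 2 <= 1 - 2 * a.
  rewrite -expRM_natl mulrN expRN.
  apply: (@le_trans _ _ (1 + 2 * z)^-1).
    by rewrite lef_pV2 ?posrE ?expR_gt0// expR_ge1Dx.
  rewrite -[leLHS]mul1r ler_pdivrMr// /z.
  have : 0 <= a ^+ 2 * (1 - 6 * a) by apply: mulr_ge0 => //; lra.
  lra.
rewrite -[leRHS]invrK lef_pV2 ?posrE ?invr_gt0 ?expR_gt0 ?sqrtr_gt0//.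
rewrite -expRN -[leLHS]ger0_norm ?expR_ge0// -sqrtr_sqr.
by rewrite ler_sqrt// ltW.
Qed.

(** Induction on the size of [J]: the operator bound 1/8 passes to the Schur complement and so is
    available at every step. Trace plus three times the squared Frobenius norm is an exponent that
    pays both for the normalizing factor and for the change of matrix at each elimination. *)
Lemma expR_quad_le (kappa := 8^-1 : R) (J : {set I}) (M : I -> I -> R) :
  (forall i j, M i j = M j i) ->
  (forall x, `|quad J M x| <= kappa * \sum_(i in J) x i ^+ 2) ->
  (\int[P]_w (expR (quad J M (fun i => X i w)))%:E
   <= (expR (\sum_(i in J) M i i + 3 * frob2 J M))%:E)%E.
Proof.
move: {2}#|J| (erefl #|J|) => n; elim: n J M => [|n IH] J M Jn symM bM.
  move/eqP: Jn; rewrite cards_eq0 => /eqP ->.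
  rewrite /quad /frob2 !big_set0 mulr0 addr0.
  under eq_integral => w _ do rewrite big_set0.
  by rewrite expR0 integral_cst// mul1e probability_le1.
have [k kJ] : exists k, k \in J by apply/card_gt0P; rewrite Jn.
have k8 : (0 < kappa) by rewrite /kappa; lra.
have [a8 b8] := quad_column_bounded k8 kJ symM bM.
have k2 : kappa < 2^-1 by rewrite /kappa; lra.
set a := M k k in a8 *; set B := \sum_(i in _) _ in b8.
have a2 : a < 2^-1 by move: a8 => /ler_normlP[]; rewrite /kappa; lra.
have c0 : 0 < 1 - 2 * a by lra.
pose M' i j := M i j + 2 / (1 - 2 * a) * (M k i * M k j).
pose q w := quad (J :\ k)%SET M (fun i => X i w).
pose l w := \sum_(i in (J :\ k)%SET) M k i * X i w.
have mX i : i \in (J :\ k)%SET ->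
    measurable_fun [set: g_sigma_algebraType (cylinders X k)] (X i : Omega -> R).
  by rewrite in_setD1 => /andP[ik _]; exact: cylinders_measurable_fun.
have ml : measurable_fun [set: g_sigma_algebraType (cylinders X k)] l.
  rewrite /l; under eq_fun do rewrite big_mkcond /=.
  apply: measurable_sum => i; case: (boolP (i \in (J :\ k)%SET)) => iJ //.
  by apply: measurable_funM => //; exact: mX.
have mq : measurable_fun [set: g_sigma_algebraType (cylinders X k)] q.
  exact: measurable_quad.
under eq_integral => w _.
  rewrite (quad_setD1 _ kJ symM) -/(q w) -/(l w) -/a; over.
rewrite (integral_peel gX a2 mq ml).
under eq_integral => w _.
  have -> : q w + 2 * l w ^+ 2 / (1 - 2 * a) = quad (J :\ k)%SET M' (fun i => X i w).
    by rewrite quad_rank1 mulrAC.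
  rewrite EFinM; over.
have c1 : 0 <= (Num.sqrt (1 - 2 * a))^-1 by rewrite invr_ge0 sqrtr_ge0.
rewrite ge0_integralZl//; last first.
  apply/measurable_EFinP; apply: measurableT_comp => //.
  exact: measurable_quad.
have sM' i j : M' i j = M' j i by rewrite /M' symM (mulrC (M k i)).
have Jn' : #|(J :\ k)%SET| = n.
  by apply/eqP; rewrite -eqSS -Jn (cardsD1 k J) kJ.
have bM' := quad_schur_bounded k8 k2 kJ symM bM.
apply: (le_trans (lee_wpmul2l _ (IH _ M' Jn' sM' bM'))); first by rewrite lee_fin.
rewrite -EFinM lee_fin.
apply: (le_trans (ler_wpM2r (expR_ge0 _) (invsqrt_le_expR a8))).
rewrite -expRD ler_expR.
rewrite (big_setD1 k kJ)/= (frob2_setD1 kJ symM) /M' big_split /= frob2_rank1.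
rewrite -/a -/B.
have -> : \sum_(i in (J :\ k)%SET) 2 / (1 - 2 * a) * (M k i * M k i)
    = 2 / (1 - 2 * a) * B.
  by rewrite -mulr_sumr; congr (_ * _); apply: eq_bigr => i _; rewrite expr2.
have qB : quad (J :\ k)%SET M (M k) <= kappa * B.
  have := quad_bounded_split kJ symM bM (M k) 0.
  rewrite mulr0 expr0n mulr0 !addr0 add0r => /ler_normlP[_].
  by apply.
have B0 : 0 <= B by apply: sumr_ge0 => i _; exact: sqr_ge0.
have s0 : 0 < 2 / (1 - 2 * a) by rewrite divr_gt0.
have s1 : 2 / (1 - 2 * a) <= 8 / 3.
  by rewrite ler_pdivrMr//; move: a8 => /ler_normlP[]; rewrite /kappa; lra.
set s := 2 / _ in s0 s1 *; set q' := quad _ _ _ in qB *.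
(* The Schur complement raises the exponent by [s * B + 3 * (2 * s * q' + s ^+ 2 * B ^+ 2)], at most
   (8/3 + 2 + 1/3) B = 5 B; removing row and column [k] frees 6 B. *)
have h1 : s * q' <= s * (kappa * B) by rewrite ler_pM2l.
have h2 : s * B <= 8 / 3 * B by rewrite ler_wpM2r.
have h3 : s ^+ 2 * B ^+ 2 <= (8 / 3) ^+ 2 * (B * kappa ^+ 2).
  rewrite ler_pM// ?sqr_ge0//; first by rewrite lerXn2r// nnegrE ltW.
  by rewrite [leLHS]expr2 ler_wpM2l.
move: h1 h2 h3; rewrite /kappa; set S := \sum_(i in _) _; lra.
Qed.

End QuadraticMgf.

Section CauchySchwarz.
Variable R : realType.

Lemma cauchy_schwarz_sum (I : finType) (x y : I -> R) :
  (\sum_i x i * y i) ^+ 2 <= (\sum_i x i ^+ 2) * (\sum_i y i ^+ 2).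
Proof.
set A := \sum_i x i ^+ 2; set B := \sum_i y i ^+ 2; set C := \sum_i _.
have pol t : 0 <= A * t ^+ 2 + 2 * C * t + B.
  have -> : A * t ^+ 2 + 2 * C * t + B = \sum_i (x i * t + y i) ^+ 2.
    rewrite /A /B /C mulr_sumr !mulr_suml -!big_split /=.
    by apply: eq_bigr => i _; ring.
  by apply: sumr_ge0 => i _; exact: sqr_ge0.
have A0 : 0 <= A by apply: sumr_ge0 => i _; exact: sqr_ge0.
have [A_0|An0] := eqVneq A 0.
  have -> : C = 0; last by rewrite expr0n /= A_0 mul0r.
  apply: big1 => i _; have /eqP := A_0.
  rewrite psumr_eq0; last by move=> j _; exact: sqr_ge0.
  by move=> /allP /(_ i (mem_index_enum _)) /=; rewrite sqrf_eq0 => /eqP ->; rewrite mul0r.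
have Ap : 0 < A by rewrite lt_neqAle eq_sym An0.
have := pol (- C / A).
have -> : A * (- C / A) ^+ 2 + 2 * C * (- C / A) + B = B - C ^+ 2 / A by field.
by rewrite subr_ge0 ler_pdivrMr// mulrC.
Qed.

End CauchySchwarz.

(** * The Hanson-Wright inequality *)

Section HighProbability.
Local Open Scope classical_set_scope.
Variables (R : realType) (disp : measure_display) (Omega : measurableType disp).
Variable P : probability Omega R.

(** Stated through a measurable exceptional set: [Q] will quantify over uncountably many vectors and
    need not be measurable. *)
Definition whp (eps : R) (Q : Omega -> Prop) : Prop :=
  exists B : set Omega, [/\ measurable B, (P B <= eps%:E)%E & forall w, ~ B w -> Q w].

Lemma whp_sub (e1 e2 : R) (Q1 Q2 : Omega -> Prop) : e1 <= e2 ->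
  (forall w, Q1 w -> Q2 w) -> whp e1 Q1 -> whp e2 Q2.
Proof.
move=> e12 Q12 [B [mB PB BQ]]; exists B; split=> //.
- by rewrite (le_trans PB)// lee_fin.
- by move=> w /BQ; exact: Q12.
Qed.

Lemma whpT (Q : Omega -> Prop) : (forall w, Q w) -> whp 0 Q.
Proof. by move=> hQ; exists set0; split=> //; rewrite measure0. Qed.

Lemma whp_and (e1 e2 : R) (Q1 Q2 : Omega -> Prop) :
  whp e1 Q1 -> whp e2 Q2 -> whp (e1 + e2) (fun w => Q1 w /\ Q2 w).
Proof.
move=> [B1 [m1 P1 h1]] [B2 [m2 P2 h2]]; exists (B1 `|` B2); split.
- exact: measurableU.
- by rewrite (le_trans (measureU2 _ m1 m2))// EFinD leeD.
- by move=> w /not_orP[] /h1 ? /h2 ?.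
Qed.

Lemma whp_forall (I : finType) (e : R) (Q : I -> Omega -> Prop) :
  (forall i, whp e (Q i)) -> whp (#|I|%:R * e) (fun w => forall i, Q i w).
Proof.
move=> hQ.
have : forall s : seq I, whp ((size s)%:R * e) (fun w => forall i, i \in s -> Q i w).
  elim=> [|i s IH]; first by rewrite mul0r; apply: whpT.
  apply: whp_sub (whp_and (hQ i) IH).
    by rewrite /= -natr1 mulrDl mul1r addrC.
  by move=> w [Qi Qs] j; rewrite in_cons => /orP[/eqP ->//|/Qs].
move=> /(_ (enum I)); rewrite -cardT; apply: whp_sub => // w h i.
by apply: h; rewrite mem_enum.
Qed.

Lemma whp_nat (e : R) (Q : nat -> Omega -> Prop) : 0 <= e ->
  (forall k, whp (e / 2 ^+ k.+1) (Q k)) -> whp e (fun w => forall k, Q k w).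
Proof.
move=> e0 /choice[B hB].
have mB k : measurable (B k) by case: (hB k).
exists (\bigcup_k B k); split.
- exact: bigcupT_measurable.
- apply: (le_trans (measure_sigma_subadditive _ mB _ (@subset_refl _ _))).
    exact: bigcupT_measurable.
  rewrite -[leRHS]/(e%:E); apply: lime_le.
    by apply: is_cvg_nneseries => *; exact: measure_ge0.
  apply: nearW => n.
  apply: (@le_trans _ _ (\sum_(0 <= i < n) (e / 2 ^+ i.+1)%:E)%E).
    by apply: lee_sum => i _; case: (hB i).
  rewrite sumEFin lee_fin.
  have -> : \sum_(0 <= i < n) e / 2 ^+ i.+1 = e * (1 - (2 ^+ n)^-1).
    elim: n => [|n IH]; first by rewrite big_nil expr0 invr1 subrr mulr0.
    rewrite big_nat_recr//= IH exprS; field.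
    by rewrite expf_neq0.
  by rewrite ler_piMr// lerBlDr lerDl invr_ge0 exprn_ge0.
- move=> w hw k; case: (hB k) => _ _; apply; apply: contra_not hw.
  by move=> Bk; exists k.
Qed.

End HighProbability.

Section HansonWright.
Local Open Scope classical_set_scope.
Variables (R : realType) (disp : measure_display) (Omega : measurableType disp).
Variable P : probability Omega R.
Variables (I : finType) (X : I -> {RV P >-> R}).
Hypothesis gX : gaussian_family X.
Let TI := [set: I]%SET.

Lemma sum_setT (F : I -> R) : \sum_(i in TI) F i = \sum_i F i.
Proof. by apply: eq_bigl => i; rewrite finset.in_setT. Qed.

Lemma quad_scale (M : I -> I -> R) (t : R) (x : I -> R) :
  quad TI (fun i j => t * M i j) x = t * quad TI M x.
Proof.
rewrite /quad mulr_sumr; apply: eq_bigr => i _; rewrite mulr_sumr.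
by apply: eq_bigr => j _; rewrite -mulrA.
Qed.

Lemma frob2_scale (M : I -> I -> R) (t : R) :
  frob2 TI (fun i j => t * M i j) = t ^+ 2 * frob2 TI M.
Proof.
rewrite /frob2 mulr_sumr; apply: eq_bigr => i _; rewrite mulr_sumr.
by apply: eq_bigr => j _; rewrite exprMn.
Qed.

Let Xv w i : R := X i w.

Lemma measurable_quadX (M : I -> I -> R) :
  measurable_fun [set: Omega] (fun w => quad TI M (Xv w)).
Proof. by apply: measurable_quad. Qed.

Lemma quad_upper_tail (M : I -> I -> R) (op V y : R) :
  (forall i j, M i j = M j i) -> 0 <= op -> 0 <= V -> 0 < y ->
  0 < V * Num.sqrt y + 8 * op * y ->
  (forall x, `|quad TI M x| <= op * \sum_i x i ^+ 2) ->
  frob2 TI M <= V ^+ 2 ->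
  (P [set w | 4 * (V * Num.sqrt y + 8 * op * y)
                <= quad TI M (Xv w) - \sum_i M i i]%R <= (expR (- y))%:E)%E.
Proof.
move=> symM op0 V0 y0 D0 bM fM; set D := V * _ + _ in D0 *.
(* This Chernoff parameter satisfies [8 * op * th <= 1], as the exponential moment requires, and
   [V * th <= Num.sqrt y]; the exponent becomes at most [3 * y - 4 * y]. *)
pose th := y / D; have th0 : 0 < th by rewrite divr_gt0.
have mS : measurable_fun [set: Omega] (fun w => quad TI M (Xv w) - \sum_i M i i).
  by apply: measurable_funB => //; exact: measurable_quadX.
pose S0 w := quad TI M (Xv w) - \sum_i M i i.
pose S : {RV P >-> R} := HB.pack S0 (isMeasurableFun.Build _ _ _ _ S0 mS).
apply: (le_trans (chernoff S (4 * D) th0)).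
have mgf : (mmt_gen_fun P S th <= (expR (3 * y))%:E)%E.
  rewrite /mmt_gen_fun unlock.
  have -> : (\int[P]_w ((expR \o th \o* S) w)%:E =
    \int[P]_w ((expR (- (th * \sum_i M i i)))%:E * (expR (quad TI (fun i j => th * M i j) (Xv w)))%:E))%E.
    apply: eq_integral => w _; rewrite -EFinM -expRD quad_scale /=; congr (expR _)%:E.
    change ((quad TI M (Xv w) - \sum_i M i i) * th
      = - (th * \sum_i M i i) + th * quad TI M (Xv w)).
    by ring.
  rewrite ge0_integralZl//; last first.
    apply/measurable_EFinP; apply: measurableT_comp => //; exact: measurable_quadX.
  have hx := @expR_quad_le _ _ _ P _ X gX TI (fun i j => th * M i j).
  apply: (le_trans (lee_wpmul2l _ (hx _ _))).
  - by rewrite lee_fin expR_ge0.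
  - by move=> i j; rewrite symM.
  - move=> x; rewrite quad_scale sum_setT normrM gtr0_norm//.
    apply: (le_trans (ler_wpM2l (ltW th0) (bM x))).
    rewrite mulrA ler_wpM2r//; first by apply: sumr_ge0 => i _; exact: sqr_ge0.
    rewrite /th mulrAC ler_pdivrMr// /D.
    have : 0 <= V * Num.sqrt y by rewrite mulr_ge0// sqrtr_ge0.
    lra.
  rewrite -EFinM -expRD lee_fin ler_expR sum_setT -mulr_sumr addrA addNr add0r.
  rewrite frob2_scale ler_pM2l//.
  apply: (le_trans (ler_wpM2l (sqr_ge0 _) fM)).
  have sy : y = Num.sqrt y ^+ 2 by rewrite sqr_sqrtr// ltW.
  apply: (@le_trans _ _ (Num.sqrt y ^+ 2)); last by rewrite -sy.
  rewrite -exprMn lerXn2r ?nnegrE ?sqrtr_ge0 ?(mulr_ge0 (ltW th0) V0)//.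
  rewrite /th mulrAC ler_pdivrMr// /D.
  rewrite [X in X * V]sy expr2 mulrDr.
  have : 0 <= Num.sqrt y * (8 * op * y) by rewrite !mulr_ge0 ?sqrtr_ge0 ?(ltW y0).
  lra.
apply: (le_trans (lee_wpmul2r _ mgf)); first by rewrite lee_fin expR_ge0.
rewrite -EFinM -expRD lee_fin ler_expR /th.
have -> : y / D * (4 * D) = 4 * y by field; rewrite gt_eqF.
lra.
Qed.

End HansonWright.

Section BilinearConcentration.
Local Open Scope classical_set_scope.
Variables (R : realType) (I : finType).

Definition lin (c x : I -> R) : R := \sum_i c i * x i.

Definition op_bound (O : finType) (a : O -> I -> R) (alpha : R) : Prop :=
  forall x : I -> R, \sum_o lin (a o) x ^+ 2 <= alpha ^+ 2 * \sum_i x i ^+ 2.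

Definition hsdot (O : finType) (a b : O -> I -> R) : R :=
  \sum_o \sum_i a o i * b o i.

(** For z = a^T y one has |z|^2 = <y, a z> <= |y| |a z| <= alpha |y| |z|. *)
Lemma op_bound_transpose (O : finType) (a : O -> I -> R) alpha (y : O -> R) :
  op_bound a alpha ->
  \sum_i (\sum_o a o i * y o) ^+ 2 <= alpha ^+ 2 * \sum_o y o ^+ 2.
Proof.
move=> ha; pose z i := \sum_o a o i * y o.
set Z := \sum_i _; set Y := \sum_o _.
have Z0 : 0 <= Z by apply: sumr_ge0 => i _; exact: sqr_ge0.
have Y0 : 0 <= Y by apply: sumr_ge0 => i _; exact: sqr_ge0.
have ZE : Z = \sum_o y o * lin (a o) z.
  rewrite /Z; under eq_bigr => i _ do rewrite expr2 {1}mulr_suml.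
  rewrite exchange_big /=; apply: eq_bigr => o _; rewrite mulr_sumr.
  by apply: eq_bigr => i _; rewrite /z; ring.
have h : Z ^+ 2 <= Y * (alpha ^+ 2 * Z).
  rewrite [X in X ^+ 2]ZE; apply: (le_trans (cauchy_schwarz_sum _ _)).
  by rewrite ler_wpM2l//; exact: ha.
have [->|Zn0] := eqVneq Z 0; first by rewrite mulr_ge0// sqr_ge0.
have Zp : 0 < Z by rewrite lt_neqAle eq_sym Zn0.
by rewrite -(ler_pM2r Zp) -expr2 (le_trans h)// mulrCA mulrA.
Qed.

Lemma op_bound0 (O : finType) (a : O -> I -> R) : op_bound a 0 -> forall o i, a o i = 0.
Proof.
move=> ha o i; have := ha (fun j => (j == i)%:R); rewrite expr0n mul0r => h.
have l0 : lin (a o) (fun j => (j == i)%:R) = a o i.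
  rewrite /lin (bigD1 i)//= eqxx mulr1 big1 ?addr0// => j /negbTE ->.
  by rewrite mulr0.
have : \sum_o lin (a o) (fun j => (j == i)%:R) ^+ 2 == 0.
  by rewrite eq_le h sumr_ge0// => ? _; exact: sqr_ge0.
rewrite psumr_eq0; last by move=> ? _; exact: sqr_ge0.
move=> /allP /(_ o (mem_index_enum _)) /=.
by rewrite l0 sqrf_eq0 => /eqP.
Qed.

(** The symmetric part of a^T b, that is, the symmetric matrix of the quadratic form <a x, b x>. *)
Definition sym_gram (O : finType) (a b : O -> I -> R) (i j : I) : R :=
  2^-1 * (\sum_o (a o i * b o j + a o j * b o i)).

Lemma quad_sym_gram (O : finType) (a b : O -> I -> R) x :
  quad [set: I]%SET (sym_gram a b) x = \sum_o lin (a o) x * lin (b o) x.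
Proof.
rewrite /quad sum_setT; under eq_bigr do rewrite sum_setT.
have E : \sum_o lin (a o) x * lin (b o) x
    = \sum_i \sum_j (\sum_o a o i * b o j) * (x i * x j).
  rewrite /lin; under eq_bigr => o _.
    rewrite mulr_suml; under eq_bigr => i _ do rewrite mulr_sumr.
    over.
  rewrite exchange_big /=; apply: eq_bigr => i _.
  rewrite exchange_big /=; apply: eq_bigr => j _.
  by rewrite mulr_suml; apply: eq_bigr => o _; ring.
have E' : \sum_o lin (a o) x * lin (b o) x
    = \sum_i \sum_j (\sum_o a o j * b o i) * (x i * x j).
  rewrite E exchange_big /=; apply: eq_bigr => i _; apply: eq_bigr => j _.
  by rewrite [x j * x i]mulrC.
have -> : \sum_o lin (a o) x * lin (b o) x = 2^-1 *
    (\sum_o lin (a o) x * lin (b o) x + \sum_o lin (a o) x * lin (b o) x).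
  by field.
rewrite {1}E E' -big_split /= mulr_sumr; apply: eq_bigr => i _.
rewrite -big_split /= mulr_sumr; apply: eq_bigr => j _.
by rewrite /sym_gram big_split /=; ring.
Qed.

Lemma trace_sym_gram (O : finType) (a b : O -> I -> R) :
  \sum_i sym_gram a b i i = hsdot a b.
Proof.
rewrite /sym_gram /hsdot exchange_big /=; apply: eq_bigr => i _.
by rewrite mulr_sumr; apply: eq_bigr => o _; field.
Qed.

(** Symmetrizing does not increase the Frobenius norm, and that of a^T b is at most the operator
    norm of a times the Frobenius norm of b, column by column. *)
Lemma frob2_sym_gram (O : finType) (a b : O -> I -> R) alpha F :
  op_bound a alpha -> \sum_o \sum_i b o i ^+ 2 <= F ^+ 2 ->
  frob2 [set: I]%SET (sym_gram a b) <= (alpha * F) ^+ 2.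
Proof.
move=> ha hb; rewrite /frob2 sum_setT; under eq_bigr do rewrite sum_setT.
pose N i j := \sum_o a o i * b o j.
apply: (@le_trans _ _ (\sum_j \sum_i N i j ^+ 2)).
  have sN : \sum_j \sum_i N i j ^+ 2 = \sum_i \sum_j 2^-1 * (N i j ^+ 2 + N j i ^+ 2).
    under [RHS]eq_bigr do rewrite -mulr_sumr big_split /=.
    rewrite -mulr_sumr big_split /= [X in _ = _ * (X + _)]exchange_big /=.
    by field.
  rewrite sN; apply: ler_sum => i _; apply: ler_sum => j _.
  rewrite /sym_gram big_split /= -/(N i j) -/(N j i) -subr_ge0.
  have -> : 2^-1 * (N i j ^+ 2 + N j i ^+ 2) - (2^-1 * (N i j + N j i)) ^+ 2
     = (2^-1 * (N i j - N j i)) ^+ 2 by field.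
  exact: sqr_ge0.
apply: (@le_trans _ _ (\sum_j alpha ^+ 2 * \sum_o b o j ^+ 2)).
  by apply: ler_sum => j _; exact: op_bound_transpose.
rewrite -mulr_sumr exchange_big /= exprMn.
by rewrite ler_wpM2l ?sqr_ge0.
Qed.

Lemma quad_sym_gram_bounded (O : finType) (a b : O -> I -> R) alpha beta x :
  0 <= alpha -> 0 <= beta -> op_bound a alpha -> op_bound b beta ->
  `|quad [set: I]%SET (sym_gram a b) x| <= alpha * beta * \sum_i x i ^+ 2.
Proof.
move=> a0 b0 ha hb; rewrite quad_sym_gram; set S := \sum_i x i ^+ 2.
have S0 : 0 <= S by apply: sumr_ge0 => i _; exact: sqr_ge0.
have := cauchy_schwarz_sum (fun o => lin (a o) x) (fun o => lin (b o) x).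
set C := \sum_o _ => h.
rewrite -(@ler_pXn2r _ 2)// ?nnegrE ?mulr_ge0// real_normK ?num_real//.
apply: (le_trans h).
apply: (le_trans (ler_pM _ _ (ha x) (hb x))).
- by apply: sumr_ge0 => i _; exact: sqr_ge0.
- by apply: sumr_ge0 => i _; exact: sqr_ge0.
- by rewrite -/S !exprMn mulrACA -expr2.
Qed.

Variables (disp : measure_display) (Omega : measurableType disp).
Variable P : probability Omega R.
Variable X : I -> {RV P >-> R}.
Hypothesis gX : gaussian_family X.

Lemma hanson_wright (O : finType) (a b : O -> I -> R) (alpha beta F y : R) :
  0 <= alpha -> 0 <= beta -> 0 <= F -> 0 < y ->
  op_bound a alpha -> op_bound b beta -> \sum_o \sum_i b o i ^+ 2 <= F ^+ 2 ->
  whp P (2 * expR (- y)) (fun w =>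
    `|\sum_o lin (a o) (fun i => X i w) * lin (b o) (fun i => X i w) - hsdot a b|
    <= 32 * (alpha * F * Num.sqrt y + alpha * beta * y)).
Proof.
move=> a0 b0 F0 y0 ha hb hF.
have sy : 0 < Num.sqrt y by rewrite sqrtr_gt0.
have triv : (forall o i, a o i * b o i = 0) ->
    (forall w, \sum_o lin (a o) (fun i => X i w) * lin (b o) (fun i => X i w) = 0) ->
    forall w, `|\sum_o lin (a o) (fun i => X i w) * lin (b o) (fun i => X i w) - hsdot a b|
    <= 32 * (alpha * F * Num.sqrt y + alpha * beta * y).
  move=> ab0 S0 w; rewrite S0 /hsdot big1; last by move=> o _; apply: big1.
  by rewrite subrr normr0 mulr_ge0// addr_ge0// !mulr_ge0// ltW.
have lin0 (c x : I -> R) : (forall i, c i = 0) -> lin c x = 0.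
  by move=> c0; rewrite /lin big1// => i _; rewrite c0 mul0r.
have e0 : 0 <= 2 * expR (- y) by rewrite mulr_ge0// expR_ge0.
(* If [alpha] or [F] vanishes, so does the form. These cases are set apart because the Chernoff
   parameter divides by [alpha * F * Num.sqrt y + 8 * (alpha * beta) * y]. *)
have [a_0|an0] := eqVneq alpha 0.
  have a00 := op_bound0 (eq_ind _ (op_bound a) ha _ a_0).
  apply: whp_sub e0 _ (whpT P (triv _ _)) => //.
    by move=> o i; rewrite a00 mul0r.
  by move=> w; rewrite big1// => o _; rewrite lin0 ?mul0r.
have [F_0|Fn0] := eqVneq F 0.
  have b00 o i : b o i = 0.
    have : \sum_o \sum_i b o i ^+ 2 == 0.
      rewrite eq_le (le_trans hF) ?F_0 ?expr0n//=.
      by apply: sumr_ge0 => ? _; apply: sumr_ge0 => ? _; exact: sqr_ge0.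
    rewrite psumr_eq0; last by move=> ? _; apply: sumr_ge0 => ? _; exact: sqr_ge0.
    move=> /allP /(_ o (mem_index_enum _)) /=.
    rewrite psumr_eq0; last by move=> ? _; exact: sqr_ge0.
    by move=> /allP /(_ i (mem_index_enum _)) /=; rewrite sqrf_eq0 => /eqP.
  apply: whp_sub e0 _ (whpT P (triv _ _)) => //.
    by move=> o i; rewrite b00 mulr0.
  by move=> w; rewrite big1// => o _; rewrite [X in _ * X]lin0 ?mulr0.
have ap : 0 < alpha by rewrite lt_neqAle eq_sym an0.
have Fp : 0 < F by rewrite lt_neqAle eq_sym Fn0.
pose M := sym_gram a b.
have symM i j : M i j = M j i.
  by rewrite /M /sym_gram; congr (_ * _); apply: eq_bigr => o _; rewrite addrC.
have aF0 : 0 <= alpha * F by rewrite mulr_ge0.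
have ab0 : 0 <= alpha * beta by rewrite mulr_ge0.
have D0 : 0 < alpha * F * Num.sqrt y + 8 * (alpha * beta) * y.
  by rewrite ltr_pwDl ?mulr_gt0// !mulr_ge0// ltW.
have bM x := quad_sym_gram_bounded x a0 b0 ha hb.
have fM := frob2_sym_gram ha hF.
have up := quad_upper_tail gX symM ab0 aF0 y0 D0 bM fM.
pose M' i j := -1 * M i j.
have symM' i j : M' i j = M' j i by rewrite /M' symM.
have bM' x : `|quad [set: I]%SET M' x| <= alpha * beta * \sum_i x i ^+ 2.
  by rewrite quad_scale mulN1r normrN.
have fM' : frob2 [set: I]%SET M' <= (alpha * F) ^+ 2.
  by rewrite frob2_scale sqrrN expr1n mul1r.
have dn := quad_upper_tail gX symM' ab0 aF0 y0 D0 bM' fM'.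
set D := 4 * _ in up dn.
exists ([set w | D <= quad [set: I]%SET M (fun i => X i w) - \sum_i M i i]
  `|` [set w | D <= quad [set: I]%SET M' (fun i => X i w) - \sum_i M' i i]).
have mge (M0 : I -> I -> R) :
    measurable [set w | D <= quad [set: I]%SET M0 (fun i => X i w) - \sum_i M0 i i].
  rewrite -[X in measurable X]setTI; apply: measurable_fun_le => //.
  by apply: measurable_funB => //; exact: measurable_quadX.
split; first by apply: measurableU; exact: mge.
- rewrite (le_trans (measureU2 _ (mge _) (mge _)))//.
  by rewrite mulr_natl mulr2n EFinD leeD.
- move=> w /not_orP[/negP h1 /negP h2].
  move: h1 h2; rewrite -!ltNge (quad_scale M (-1)) -(mulr_sumr _ _ _ (-1)) -mulrBr mulN1r.
  rewrite /M quad_sym_gram trace_sym_gram => h1 h2.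
  have le1 : D <= 32 * (alpha * F * Num.sqrt y + alpha * beta * y).
    have h3 : 0 <= alpha * F * Num.sqrt y by rewrite mulr_ge0// ltW.
    by rewrite /D; lra.
  apply/ler_normlP; split; [apply: (le_trans (ltW h2) le1)|exact: (le_trans (ltW h1) le1)].
Qed.

End BilinearConcentration.

(** * States as linear functions of the noise *)

Section StateSpace.
Variable R : realType.

Definition vsq n (u : 'cV[R]_n) : R := \sum_i u i 0 ^+ 2.

Definition fsq p q (M : 'M[R]_(p, q)) : R := \sum_i \sum_j M i j ^+ 2.

Lemma vsq_ge0 n (u : 'cV[R]_n) : 0 <= vsq u.
Proof. by apply: sumr_ge0 => i _; exact: sqr_ge0. Qed.

Lemma fsq_ge0 p q (M : 'M[R]_(p, q)) : 0 <= fsq M.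
Proof. by apply: sumr_ge0 => i _; apply: sumr_ge0 => j _; exact: sqr_ge0. Qed.

Lemma vsq_mulmx_le p q (M : 'M[R]_(p, q)) u : vsq (M *m u) <= fsq M * vsq u.
Proof.
rewrite /vsq /fsq mulr_suml; apply: ler_sum => i _.
by rewrite mxE; exact: cauchy_schwarz_sum.
Qed.

Lemma traj_sum d (A : 'M[R]_d) (eta : nat -> 'cV[R]_d) t :
  traj A eta t.+1 = \sum_(s < t.+1) A ^+ (t - s) *m eta s.+1.
Proof.
elim: t => [|t IH].
  by rewrite big_ord_recl big_ord0 addr0 /= mulmx0 add0r expr0 mul1mx.
rewrite -[LHS]/(A *m traj A eta t.+1 + eta t.+2) IH mulmx_sumr.
rewrite [RHS]big_ord_recr /= subnn expr0 mul1mx; congr (_ + _).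
apply: eq_bigr => s _; rewrite subSn ?exprS ?mulmxA//.
by rewrite -ltnS.
Qed.

Definition mx_op_le d (A : 'M[R]_d) (rho : R) : Prop :=
  forall u, vsq (A *m u) <= rho ^+ 2 * vsq u.

Lemma mx_op_le_fsq d (A : 'M[R]_d) rho q (H : 'M[R]_(q, d)) :
  mx_op_le A rho -> fsq (H *m A) <= rho ^+ 2 * fsq H.
Proof.
move=> hA; rewrite /fsq mulr_sumr; apply: ler_sum => b _.
have hop : op_bound (fun o i => A o i) rho.
  move=> x; have := hA (\col_i x i); rewrite /vsq.
  under eq_bigr => i _ do rewrite mxE.
  under [X in _ <= _ * X]eq_bigr => i _ do rewrite mxE.
  apply: le_trans; rewrite le_eqVlt; apply/orP; left; apply/eqP.
  by apply: eq_bigr => i _; congr (_ ^+ 2); apply: eq_bigr => j _; rewrite mxE.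
apply: le_trans (op_bound_transpose (fun o => H b o) hop).
rewrite le_eqVlt; apply/orP; left; apply/eqP.
by apply: eq_bigr => j _; rewrite mxE; congr (_ ^+ 2); apply: eq_bigr => i _; rewrite mulrC.
Qed.

(** Of the factor [rho ^+ 2] gained per step only [rho] is kept, enough for a geometric series in
    [rho]. *)
Lemma mx_op_le_fsq_exp d (A : 'M[R]_d) rho q (H : 'M[R]_(q, d)) k :
  0 <= rho -> rho <= 1 -> mx_op_le A rho -> fsq (H *m A ^+ k) <= rho ^+ k * fsq H.
Proof.
move=> r0 r1 hA; elim: k => [|k IH]; first by rewrite !expr0 mulmx1 mul1r.
rewrite exprSr mulmxA; apply: le_trans (mx_op_le_fsq _ hA) _.
rewrite [rho ^+ k.+1]exprS -mulrA expr2 -mulrA ler_wpM2l//.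
by apply: le_trans IH; rewrite ler_piMl// fsq_ge0.
Qed.

(** The l2 gain of a stable system. Young's inequality (p + q)^2 <= p^2 / rho + q^2 / (1 - rho)
    makes the squared state contract by [rho] at each step; summing over time costs a second factor
    1 / (1 - rho). The weight 1 / rho forces the separate case [rho = 0]. *)
Lemma traj_stable d (A : 'M[R]_d) rho (z : nat -> 'cV[R]_d) n :
  0 <= rho -> rho < 1 -> mx_op_le A rho ->
  \sum_(t < n) vsq (traj A z t.+1) <= ((1 - rho) ^+ 2)^-1 * \sum_(t < n) vsq (z t.+1).
Proof.
move=> r0 r1 hA; set r := 1 - rho; have rp : 0 < r by rewrite subr_gt0.
have step t : vsq (traj A z t.+1) <= rho * vsq (traj A z t) + r^-1 * vsq (z t.+1).
  rewrite /=; set x := traj A z t; set y := z t.+1.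
  have [rho0|rhon0] := eqVneq rho 0.
    have Ax0 : vsq (A *m x) = 0.
      apply/eqP; rewrite eq_le vsq_ge0 andbT; apply: (le_trans (hA x)).
      by rewrite rho0 expr0n mul0r.
    have z0 i : (A *m x) i 0 = 0.
      have /eqP := Ax0; rewrite psumr_eq0; last by move=> ? _; exact: sqr_ge0.
      move=> /allP /(_ i (mem_index_enum _)) /=.
      by rewrite sqrf_eq0 => /eqP.
    rewrite /r rho0 subr0 invr1 mul0r add0r mul1r le_eqVlt; apply/orP; left.
    by apply/eqP; apply: eq_bigr => i _; rewrite mxE z0 add0r.
  have rhop : 0 < rho by rewrite lt_neqAle eq_sym rhon0.
  apply: (@le_trans _ _ (rho^-1 * vsq (A *m x) + r^-1 * vsq y)).
    rewrite /vsq !mulr_sumr -big_split /=; apply: ler_sum => i _; rewrite mxE.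
    set p := (A *m x) i 0; set q := y i 0; rewrite -subr_ge0.
    have -> : rho^-1 * p ^+ 2 + r^-1 * q ^+ 2 - (p + q) ^+ 2
       = (rho * r)^-1 * (r * p - rho * q) ^+ 2.
      rewrite /r; field; rewrite rhon0 /=; by rewrite gt_eqF.
    by rewrite mulr_ge0 ?sqr_ge0// invr_ge0 mulr_ge0// ltW.
  rewrite lerD2r ler_pdivrMl// mulrA -expr2.
  exact: hA.
(* The term in [traj A z n] is the part of the recursion not yet absorbed; carrying it along closes
   the induction. *)
have inv : (\sum_(t < n) vsq (traj A z t.+1)) * r + rho * vsq (traj A z n)
    <= r^-1 * \sum_(t < n) vsq (z t.+1).
  elim: n => [|n IH].
    by rewrite !big_ord0 mul0r add0r /vsq big1 ?mulr0// => i _; rewrite mxE expr0n.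
  rewrite [\sum_(t < n.+1) vsq (traj _ _ _)]big_ord_recr.
  rewrite [\sum_(t < n.+1) vsq (z _)]big_ord_recr.
  move: (step n) IH; set S := \sum_(t < n) _; set Zs := \sum_(t < n) _.
  set X := vsq (traj A z n.+1); set Y := vsq (traj A z n).
  have e : X * r + rho * X = X by rewrite /r; ring.
  move: e; clearbody r => e; rewrite /= => h IH.
  by rewrite (mulrDr r^-1) (mulrDl S); lra.
rewrite expr2 invfM -mulrA ler_pdivlMl// mulrC.
by apply: le_trans inv; rewrite lerDl mulr_ge0 ?vsq_ge0.
Qed.

End StateSpace.

Section StateCoefficients.
Variables (R : realType) (d T m : nat) (A : 'I_m -> 'M[R]_d).
Notation J := ('I_m * 'I_T.+1 * 'I_d)%type.

(** Row [(l, t, b)] expresses coordinate [b] of H_l x_{l,t+1} through the noise. The noise index [s]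
    stands for time s + 1, so causality reads [s <= t]. *)
Definition coef q (H : 'I_m -> 'M[R]_(q, d)) (o : 'I_m * 'I_T * 'I_q) (i : J) : R :=
  if (o.1.1 == i.1.1) && (i.1.2 <= o.1.2)%N
  then (H o.1.1 *m A o.1.1 ^+ (o.1.2 - i.1.2)) o.2 i.2 else 0.

(** [s.-1] undoes the shift of the noise index. Past time T + 1 [inord] falls back to index 0, so
    only states up to T + 1 are meaningful. *)
Definition state (z : J -> R) (l : 'I_m) : nat -> 'cV[R]_d :=
  traj (A l) (fun s => \col_j z (l, inord s.-1, j)).

Lemma sum_triple (I1 I2 I3 : finType) (F : I1 * I2 * I3 -> R) :
  \sum_i F i = \sum_i1 \sum_i2 \sum_i3 F (i1, i2, i3).
Proof.
transitivity (\sum_p \sum_i3 F (p, i3)).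
  by rewrite pair_bigA; apply: eq_bigr => -[].
by rewrite [RHS]pair_bigA; apply: eq_bigr => -[].
Qed.

Lemma sum_causal (l : 'I_m) (t : 'I_T) (F : 'I_T.+1 -> 'I_d -> R) :
  \sum_(i : J) (if (l == i.1.1) && (i.1.2 <= t)%N then F i.1.2 i.2 else 0)
  = \sum_(s < t.+1) \sum_j F (inord s) j.
Proof.
rewrite sum_triple (bigD1 l)//= [X in _ + X]big1 ?addr0; last first.
  move=> l' l'l; apply: big1 => s _; apply: big1 => j _.
  by rewrite eq_sym (negbTE l'l).
rewrite eqxx /=.
have tT : (t.+1 <= T.+1)%N by rewrite ltnW// ltnS.
rewrite (big_ord_widen _ (fun s => \sum_j F (inord s) j) tT) [RHS]big_mkcond /=.
apply: eq_bigr => s _; rewrite ltnS inord_val; case: ifP => // _.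
by rewrite big1.
Qed.

Lemma lin_coef q (H : 'I_m -> 'M[R]_(q, d)) l t b z :
  lin (coef H (l, t, b)) z = (H l *m state z l t.+1) b 0.
Proof.
rewrite /state traj_sum mulmx_sumr summxE /lin.
rewrite (eq_bigr (fun i : J => if (l == i.1.1) && (i.1.2 <= t)%N
    then (H l *m A l ^+ (t - i.1.2)) b i.2 * z (l, i.1.2, i.2) else 0)); last first.
  move=> [[l' s] j] _; rewrite /coef /=; case: eqP => [<-|_] /=; last by rewrite mul0r.
  by case: ifP => // _; rewrite mul0r.
rewrite (sum_causal l t (fun s j => (H l *m A l ^+ (t - s)) b j * z (l, s, j))).
apply: eq_bigr => s _; rewrite mulmxA mxE; apply: eq_bigr => j _.
have sT : (s < T.+1)%N by apply: leq_trans (ltn_ord s) _; rewrite ltnS ltnW.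
by rewrite inordK//; congr (_ * _); rewrite mxE.
Qed.

Definition fdot p q (M N : 'M[R]_(p, q)) : R := \sum_i \sum_j M i j * N i j.

Lemma fdotxx p q (M : 'M[R]_(p, q)) : fdot M M = fsq M.
Proof. by apply: eq_bigr => i _; apply: eq_bigr => j _; rewrite expr2. Qed.

(** Under standard normal noise this product is the expected inner product of the two images of the
    states; [k] is the age of the noise. *)
Lemma hsdot_coef q (H H' : 'I_m -> 'M[R]_(q, d)) :
  hsdot (coef H) (coef H') = \sum_l \sum_(t < T) \sum_(k < t.+1)
    fdot (H l *m A l ^+ k) (H' l *m A l ^+ k).
Proof.
rewrite /hsdot sum_triple; apply: eq_bigr => l _; apply: eq_bigr => t _.
transitivity (\sum_b \sum_(s < t.+1) \sum_j
    (H l *m A l ^+ (t - s)) b j * (H' l *m A l ^+ (t - s)) b j).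
  apply: eq_bigr => b _.
  rewrite (eq_bigr (fun i : J => if (l == i.1.1) && (i.1.2 <= t)%N
    then (H l *m A l ^+ (t - i.1.2)) b i.2 * (H' l *m A l ^+ (t - i.1.2)) b i.2
    else 0)); last first.
    by move=> [[l' s] j] _; rewrite /coef /=; case: ifP => // _; rewrite mul0r.
  rewrite (sum_causal l t (fun s j => (H l *m A l ^+ (t - s)) b j
    * (H' l *m A l ^+ (t - s)) b j)).
  apply: eq_bigr => s _; apply: eq_bigr => j _.
  have sT : (s < T.+1)%N by apply: leq_trans (ltn_ord s) _; rewrite ltnS ltnW.
  by rewrite inordK.
rewrite exchange_big /= (reindex_inj rev_ord_inj) /=.
apply: eq_bigr => s _; rewrite /fdot; apply: eq_bigr => b _; apply: eq_bigr => j _.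
by rewrite subSS subKn// -ltnS.
Qed.

Variable rho : R.
Hypotheses (r0 : 0 <= rho) (r1 : rho < 1).
Hypothesis hA : forall l, mx_op_le (A l) rho.

(** Systems do not interact, so the worst block governs the operator norm, and [traj_stable] bounds
    the map from noise to states. *)
Lemma coef_op_bound q (H : 'I_m -> 'M[R]_(q, d)) h :
  (forall l, fsq (H l) <= h ^+ 2) -> op_bound (coef H) (h / (1 - rho)).
Proof.
move=> hH z; rewrite sum_triple.
apply: (@le_trans _ _ (\sum_l h ^+ 2 * \sum_(t < T) vsq (state z l t.+1))).
  apply: ler_sum => l _; rewrite mulr_sumr; apply: ler_sum => t _.
  under eq_bigr => b _ do rewrite lin_coef.
  apply: (le_trans (vsq_mulmx_le _ _)).
  by rewrite ler_wpM2r ?vsq_ge0.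
rewrite -(mulr_sumr _ _ _ (h ^+ 2)) exprMn -[leRHS]mulrA ler_wpM2l ?sqr_ge0//.
rewrite sum_triple mulr_sumr; apply: ler_sum => l _.
apply: (le_trans (traj_stable _ _ r0 r1 (hA l))).
rewrite exprVn ler_wpM2l ?invr_ge0 ?sqr_ge0// big_ord_recr /= ler_wpDr//.
  by apply: sumr_ge0 => j _; exact: sqr_ge0.
apply: ler_sum => t _; rewrite /vsq; apply: ler_sum => j _; rewrite mxE /=.
suff -> : inord t = widen_ord (leqnSn T) t by [].
by apply: val_inj; rewrite /= inordK// ltnS ltnW.
Qed.

Lemma geometric_le n : \sum_(k < n) rho ^+ k <= (1 - rho)^-1.
Proof.
have rp : 0 < 1 - rho by rewrite subr_gt0.
rewrite -[leRHS]mul1r ler_pdivlMr//.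
have -> : (\sum_(k < n) rho ^+ k) * (1 - rho) = 1 - rho ^+ n.
  elim: n => [|n IH]; first by rewrite big_ord0 expr0 mul0r subrr.
  by rewrite big_ord_recr /= mulrDl IH exprS; ring.
by rewrite lerBlDr lerDl exprn_ge0.
Qed.

Lemma coef_frob q (H : 'I_m -> 'M[R]_(q, d)) :
  \sum_o \sum_i coef H o i ^+ 2 <= T%:R / (1 - rho) ^+ 2 * \sum_l fsq (H l).
Proof.
have rp : 0 < 1 - rho by rewrite subr_gt0.
have -> : \sum_o \sum_i coef H o i ^+ 2 = hsdot (coef H) (coef H).
  by apply: eq_bigr => o _; apply: eq_bigr => i _; rewrite expr2.
rewrite hsdot_coef mulr_sumr; apply: ler_sum => l _.
apply: (@le_trans _ _ (\sum_(t < T) fsq (H l) / (1 - rho) ^+ 2)).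
  apply: ler_sum => t _.
  apply: (@le_trans _ _ (\sum_(k < t.+1) rho ^+ k * fsq (H l))).
    apply: ler_sum => k _; rewrite fdotxx.
    by apply: mx_op_le_fsq_exp => //; exact: ltW.
  rewrite -mulr_suml mulrC ler_wpM2l ?fsq_ge0//.
  apply: (le_trans (geometric_le _)).
  rewrite lef_pV2 ?posrE ?exprn_gt0// expr2 ler_piMl//; first exact: ltW.
  by rewrite lerBlDr lerDl.
by rewrite sumr_const card_ord -[leLHS]mulr_natl -[leRHS]mulrA [_^-1 * _]mulrC.
Qed.

(** Only the term [k = 0] is kept: the freshest noise contributes the identity to each Gramian. *)
Lemma coef_mean_ge q (H : 'I_m -> 'M[R]_(q, d)) :
  T%:R * \sum_l fsq (H l) <= hsdot (coef H) (coef H).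
Proof.
rewrite hsdot_coef mulr_sumr; apply: ler_sum => l _.
rewrite -[T in T%:R]card_ord mulr_natl -sumr_const; apply: ler_sum => t _.
rewrite big_ord_recl /= expr0 mulmx1 fdotxx lerDl.
by apply: sumr_ge0 => k _; rewrite fdotxx fsq_ge0.
Qed.

End StateCoefficients.

(** * Chaining over an l1 ball *)

Section EuclideanNorm.
Variables (R : realType) (V : finType).
Implicit Types u w : V -> R.

Definition n2 u : R := Num.sqrt (\sum_i u i ^+ 2).

Lemma n2_ge0 u : 0 <= n2 u. Proof. exact: sqrtr_ge0. Qed.

Lemma n2_sqr u : n2 u ^+ 2 = \sum_i u i ^+ 2.
Proof. by rewrite sqr_sqrtr// sumr_ge0// => i _; exact: sqr_ge0. Qed.

Lemma n2_le u c : 0 <= c -> \sum_i u i ^+ 2 <= c ^+ 2 -> n2 u <= c.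
Proof.
move=> c0 h; rewrite -(@ler_pXn2r _ 2)// ?nnegrE ?n2_ge0//.
by rewrite n2_sqr.
Qed.

Lemma n2_triangle u w : n2 (fun i => u i + w i) <= n2 u + n2 w.
Proof.
apply: n2_le; first by rewrite addr_ge0// n2_ge0.
rewrite sqrrD !n2_sqr.
have -> : \sum_i (u i + w i) ^+ 2
    = \sum_i u i ^+ 2 + (\sum_i u i * w i) *+ 2 + \sum_i w i ^+ 2.
  rewrite -sumrMnl -!big_split /=; apply: eq_bigr => i _; by rewrite sqrrD.
rewrite lerD2r lerD2l lerMn2r /=.
apply: le_trans (ler_norm _) _.
rewrite -(@ler_pXn2r _ 2)// ?nnegrE ?mulr_ge0 ?n2_ge0//.
by rewrite real_normK ?num_real// exprMn !n2_sqr cauchy_schwarz_sum.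
Qed.

Lemma n2_distC u w : n2 (fun i => u i - w i) = n2 (fun i => w i - u i).
Proof.
by rewrite /n2; congr Num.sqrt; apply: eq_bigr => i _; rewrite -sqrrN opprB.
Qed.

Lemma n2_dist_triangle u w z :
  n2 (fun i => u i - z i) <= n2 (fun i => u i - w i) + n2 (fun i => w i - z i).
Proof.
apply: le_trans (n2_triangle _ _); rewrite le_eqVlt; apply/orP; left.
by apply/eqP; congr n2; apply/funext => i; rewrite addrA subrK.
Qed.

End EuclideanNorm.

(** * Dyadic tails of a nonincreasing sequence *)

Section DyadicTails.
Variables (R : realType) (f : nat -> R) (p : nat).
Hypotheses (f0 : forall n, 0 <= f n) (fdec : forall n n', (n <= n')%N -> f n' <= f n).
Hypothesis fp : forall n, (p <= n)%N -> f n = 0.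

(** The l2 norm left after the [4 ^ k - 1] largest entries. The shift by one makes level 0 keep
    nothing, so that chains start at the zero vector. *)
Definition tail k : R := Num.sqrt (\sum_((4 ^ k).-1 <= n < p) f n ^+ 2).

(** Cauchy condensation with ratio 4: the block from [4 ^ M] to [4 ^ M.+1] has [3 * 4 ^ M] terms,
    each at least the value at its right end. *)
Lemma sum_dyadic_le M :
  \sum_(k < M.+1) 4 ^+ k * f (4 ^ k).-1 <= 2 * \sum_(0 <= n < 4 ^ M) f n.
Proof.
elim: M => [|M IH].
  by rewrite big_ord_recl big_ord0 addr0 expn0 big_nat1 expr0 mul1r ler_peMl// ler1n.
rewrite big_ord_recr /= (@big_cat_nat _ _ _ (4 ^ M))//=; last first.
  by rewrite leq_exp2l.
rewrite mulrDr; apply: lerD => //.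
apply: (@le_trans _ _ (2 * \sum_(4 ^ M <= n < 4 ^ M.+1) f (4 ^ M.+1).-1)); last first.
  rewrite ler_pM2l//; apply: ler_sum_nat => n /andP[_ h]; apply: fdec; rewrite -ltnS prednK//.
  by rewrite expn_gt0.
rewrite sumr_const_nat -[_ *+ (_ - _)]mulr_natl mulrA ler_wpM2r//.
have -> : (4 ^ M.+1 - 4 ^ M = 3 * 4 ^ M)%N by rewrite expnS -{2}(mul1n (4 ^ M)%N) -mulnBl.
rewrite natrM natrX exprS mulrA ler_wpM2r ?exprn_ge0//; lra.
Qed.

Lemma tail_step k : tail k <= 2 * (2 ^+ k * f (4 ^ k).-1) + tail k.+1.
Proof.
set a := 2 * _; set b := tail k.+1.
have a0 : 0 <= a by rewrite /a !mulr_ge0// exprn_ge0.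
have b0 : 0 <= b by exact: sqrtr_ge0.
rewrite -(@ler_pXn2r _ 2)// ?nnegrE ?addr_ge0 ?sqrtr_ge0//.
have sq n : 0 <= \sum_(n <= i < p) f i ^+ 2 by apply: sumr_ge0 => i _; exact: sqr_ge0.
rewrite sqr_sqrtr//.
apply: (@le_trans _ _ (a ^+ 2 + b ^+ 2)); last first.
  by rewrite sqrrD -addrA [_ *+ 2 + _]addrC addrA lerDl mulrn_wge0// mulr_ge0.
rewrite /b sqr_sqrtr//.
have le4 : ((4 ^ k).-1 <= (4 ^ k.+1).-1)%N by rewrite -!subn1 leq_sub2r// leq_exp2l.
have blk (n1 n2 : nat) : (n1 <= n2)%N ->
   \sum_(n1 <= i < p) f i ^+ 2 <= \sum_(n1 <= i < n2) f i ^+ 2 + \sum_(n2 <= i < p) f i ^+ 2.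
  move=> n12; have [pn2|n2p] := leqP p n2; last by rewrite -(@big_cat_nat _ _ _ n2)//= ltnW.
  rewrite [X in _ <= _ + X]big_geq// addr0.
  have [pn1|n1p] := leqP p n1; first by rewrite big_geq// sumr_ge0// => i _; exact: sqr_ge0.
  rewrite (@big_cat_nat _ _ _ p n1 n2) ?(ltnW n1p)//= lerDl.
  by apply: sumr_ge0 => i _; exact: sqr_ge0.
apply: le_trans (blk _ _ le4) _; rewrite lerD2r.
apply: (@le_trans _ _ (\sum_((4 ^ k).-1 <= i < (4 ^ k.+1).-1) f (4 ^ k).-1 ^+ 2)).
  by apply: ler_sum_nat => n /andP[h _]; rewrite lerXn2r ?nnegrE// fdec.
rewrite sumr_const_nat -[_ *+ (_ - _)]mulr_natl /a !exprMn mulrA ler_wpM2r ?sqr_ge0//.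
have -> : ((4 ^ k.+1).-1 - (4 ^ k).-1 = 3 * 4 ^ k)%N.
  have : (0 < 4 ^ k)%N by rewrite expn_gt0.
  by rewrite expnS; case: (4 ^ k)%N => // n _; rewrite mulnS /=; lia.
rewrite natrM natrX -exprM mulnC exprM.
have -> : (2 ^+ 2 : R) = 4 by rewrite -natrX.
by rewrite ler_wpM2r ?exprn_ge0//; lra.
Qed.

Lemma sum_tail_le K : \sum_(k < K) 2 ^+ k * tail k <= 8 * \sum_(n < p) f n.
Proof.
have tail0 k : (p <= (4 ^ k).-1)%N -> tail k = 0.
  by move=> pk; rewrite /tail big_geq// sqrtr0.
pose M := (K + p)%N.
have pM : (p <= (4 ^ M).-1)%N.
  rewrite -ltnS prednK ?expn_gt0//; apply: (@leq_trans (4 ^ p)); first exact: ltn_expl.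
  by rewrite leq_exp2l// leq_addl.
have t0 k : 0 <= tail k by exact: sqrtr_ge0.
apply: (@le_trans _ _ (\sum_(k < M) 2 ^+ k * tail k)).
  rewrite -(big_mkord xpredT (fun k => 2 ^+ k * tail k)).
  rewrite -(big_mkord xpredT (fun k => 2 ^+ k * tail k)).
  rewrite [leRHS](@big_cat_nat _ _ _ K)//= ?leq_addr// lerDl.
  by apply: sumr_ge0 => k _; rewrite mulr_ge0// exprn_ge0.
set S := \sum_(k < M) _.
(* [tail_step] bounds [S] by a condensed sum plus half of the shifted sum. The tail at [M] vanishes,
   so the shifted sum is at most [S] and is absorbed on the left. *)
have S1 : S <= 2 * \sum_(k < M) 4 ^+ k * f (4 ^ k).-1 + 2^-1 * S.
  have shift : \sum_(k < M) 2 ^+ k.+1 * tail k.+1 <= S.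
    have : \sum_(k < M.+1) 2 ^+ k * tail k = S.
      by rewrite big_ord_recr /= (tail0 _ pM) mulr0 addr0.
    rewrite big_ord_recl /= => <-; rewrite lerDr.
    by rewrite mulr_ge0// exprn_ge0.
  apply: (@le_trans _ _ (\sum_(k < M)
     (2 * (4 ^+ k * f (4 ^ k).-1) + 2^-1 * (2 ^+ k.+1 * tail k.+1)))).
    apply: ler_sum => k _.
    apply: le_trans (ler_wpM2l _ (tail_step k)) _; first by rewrite exprn_ge0.
    rewrite mulrDr; apply: lerD; last by rewrite exprS mulrA; lra.
    have -> : (4 : R) ^+ k = 2 ^+ k * 2 ^+ k by rewrite -exprMn -natrM.
    lra.
  rewrite big_split /= -!mulr_sumr lerD2l ler_pM2l ?invr_gt0//.
have S2 : \sum_(k < M) 4 ^+ k * f (4 ^ k).-1 <= 2 * \sum_(n < p) f n.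
  apply: (@le_trans _ _ (\sum_(k < M.+1) 4 ^+ k * f (4 ^ k).-1)).
    by rewrite [leRHS]big_ord_recr /= lerDl mulr_ge0// exprn_ge0.
  apply: (le_trans (sum_dyadic_le M)); rewrite ler_pM2l//.
  rewrite -(big_mkord xpredT f).
  have pM' : (p <= 4 ^ M)%N by rewrite (leq_trans pM)// leq_pred.
  have e : \sum_(p <= n < 4 ^ M) f n = 0.
    by rewrite big_nat_cond big1// => n; rewrite andbT => /andP[pn _]; exact: fp.
  by rewrite (@big_cat_nat _ _ _ p)//= e addr0.
lra.
Qed.

End DyadicTails.

(** * Approximation by sparse vectors on a grid *)

Section SparseGrid.
Variables (R : realType) (V : finType) (v0 : V) (Rr : R).
Hypothesis Rr0 : 0 < Rr.

Lemma grid_round (N : nat) (x : R) : (0 < N)%N -> `|x| <= Rr ->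
  exists z : 'I_(2 * N).+1, `|x - Rr / N%:R * (z%:R - N%:R)| <= Rr / N%:R.
Proof.
move=> N0 /ler_normlP[x1 x2]; have Np : 0 < N%:R :> R by rewrite ltr0n.
pose t := x * N%:R / Rr + N%:R.
have t0 : 0 <= t.
  have -> : t = (x + Rr) * (N%:R / Rr) by rewrite /t; field; rewrite gt_eqF.
  by apply: mulr_ge0; [lra|rewrite divr_ge0// ltW].
have /andP[z1 z2] := truncn_itv t0.
have zN : (Num.truncn t < (2 * N).+1)%N.
  rewrite ltnS -(ler_nat R); apply: (le_trans z1).
  have -> : t = (x - Rr) * (N%:R / Rr) + 2 * N%:R by rewrite /t; field; rewrite gt_eqF.
  rewrite natrM -lerBrDr subrr mulr_le0_ge0 ?(divr_ge0 (ltW Np) (ltW Rr0))//; lra.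
exists (Ordinal zN) => /=.
have -> : x - Rr / N%:R * ((Num.truncn t)%:R - N%:R) = Rr / N%:R * (t - (Num.truncn t)%:R).
  by rewrite /t; field; rewrite !gt_eqF.
have dN : 0 <= Rr / N%:R by rewrite divr_ge0// ltW.
rewrite ger0_norm; last by rewrite mulr_ge0// subr_ge0.
rewrite ler_piMr// lerBlDl; move: z2; rewrite -natr1; lra.
Qed.

(** A sparse vector is coded by [4 ^ k - 1] slots, each a position with a multiple of Rr / 16^k
    between -Rr and Rr. Positions may repeat, their values being added; a function type makes the
    count immediate. *)
Definition grid_index k : finType := {ffun 'I_(4 ^ k).-1 -> V * 'I_(2 * 16 ^ k).+1}.

Definition grid k (phi : grid_index k) (x : V) : R :=
  \sum_j ((phi j).1 == x)%:R * (Rr / (16 ^ k)%:R * ((phi j).2%:R - (16 ^ k)%:R)).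

Definition by_size (u : V -> R) : seq V := sort (fun i j => `|u j| <= `|u i|) (enum V).

Definition rearrangement (u : V -> R) (n : nat) : R :=
  if (n < #|V|)%N then `|u (nth v0 (by_size u) n)| else 0.

Lemma size_by_size u : size (by_size u) = #|V|.
Proof. by rewrite size_sort -cardE. Qed.

Lemma by_size_uniq u : uniq (by_size u).
Proof. by rewrite sort_uniq enum_uniq. Qed.

Lemma sum_by_size u (F : V -> R) : \sum_x F x = \sum_(n < #|V|) F (nth v0 (by_size u) n).
Proof.
transitivity (\sum_(x <- by_size u) F x).
  by rewrite -big_enum; apply: perm_big; rewrite perm_sym perm_sort.
by rewrite (big_nth v0) size_by_size big_mkord.
Qed.

Lemma rearrangement_ge0 u n : 0 <= rearrangement u n.
Proof. by rewrite /rearrangement; case: ifP. Qed.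

Lemma rearrangement_noninc u n n' : (n <= n')%N -> rearrangement u n' <= rearrangement u n.
Proof.
move=> nn; rewrite /rearrangement; case: ifP => n'p; last by case: ifP.
rewrite (leq_ltn_trans nn n'p).
have tr : transitive (fun i j : V => `|u j| <= `|u i|) by move=> a b c h1 h2; exact: le_trans h2 h1.
have so : sorted (fun i j : V => `|u j| <= `|u i|) (by_size u).
  by apply: sort_sorted => a b; exact: le_total.
have := sorted_leq_nth tr (fun a => lexx _) v0 so.
by apply; rewrite ?inE ?size_by_size// (leq_ltn_trans nn n'p).
Qed.

Lemma rearrangement_out u n : (#|V| <= n)%N -> rearrangement u n = 0.
Proof. by rewrite /rearrangement ltnNge => ->. Qed.

Lemma sum_rearrangement u : \sum_(n < #|V|) rearrangement u n = \sum_x `|u x|.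
Proof.
by rewrite (sum_by_size u); apply: eq_bigr => n _; rewrite /rearrangement ltn_ord.
Qed.

Definition sparse_tail u k : R := tail (rearrangement u) #|V| k.

(** The [4 ^ k - 1] largest entries are rounded: fewer than 4^k errors of size at most Rr / 16^k
    give the first term in l2, and the dropped entries give the second. *)
Lemma grid_approx k (u : V -> R) : \sum_x `|u x| <= Rr ->
  exists phi : grid_index k,
    n2 (fun x => u x - grid phi x) <= 2 ^+ k * (Rr / 16 ^+ k) + sparse_tail u k.
Proof.
move=> hu; set N := (16 ^ k)%N; have N0 : (0 < N)%N by rewrite expn_gt0.
have ux x : `|u x| <= Rr.
  by apply: le_trans hu; rewrite (bigD1 x)//= lerDl sumr_ge0.
have hz x : {z : 'I_(2 * N).+1 | `|u x - Rr / N%:R * (z%:R - N%:R)| <= Rr / N%:R}.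
  by apply: cid; exact: grid_round.
pose z x := sval (hz x).
pose nx (j : nat) := nth v0 (by_size u) j.
(* Grid level [N] codes the value 0; it pads [phi] when [V] has fewer than [4 ^ k - 1] elements. *)
pose zero : 'I_(2 * N).+1 := inord N.
have zeroE : nat_of_ord zero = N by rewrite inordK// ltnS mul2n -addnn leq_addr.
pose phi : grid_index k :=
  [ffun j : 'I_(4 ^ k).-1 => if (j < #|V|)%N then (nx j, z (nx j)) else (v0, zero)].
exists phi.
have nxinj (i j : nat) : (i < #|V|)%N -> (j < #|V|)%N -> (nx i == nx j) = (i == j).
  by move=> iV jV; rewrite nth_uniq ?size_by_size ?by_size_uniq.
have gridE (n : nat) : (n < #|V|)%N -> grid phi (nx n)
    = if (n < (4 ^ k).-1)%N then Rr / N%:R * ((z (nx n))%:R - N%:R) else 0.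
  move=> nV; rewrite /grid.
  have other (j : 'I_(4 ^ k).-1) : nat_of_ord j != n ->
    ((phi j).1 == nx n)%:R * (Rr / N%:R * ((phi j).2%:R - N%:R)) = 0.
    move=> jn; rewrite ffunE; case: ifP => jV /=; last by rewrite zeroE subrr !mulr0.
    by rewrite nxinj// (negbTE jn) mul0r.
  case: ifP => nk; last first.
    apply: big1 => j _; apply: other; apply/eqP => jn.
    by move: (ltn_ord j); rewrite jn nk.
  rewrite (bigD1 (Ordinal nk))//= big1 ?addr0.
    by rewrite ffunE /= nV /= eqxx mul1r.
  move=> j jn; apply: other; apply: contra jn => /eqP jn.
  by apply/eqP; apply: val_inj.
have a0 : 0 <= 2 ^+ k * (Rr / 16 ^+ k).
  by rewrite mulr_ge0 ?exprn_ge0// divr_ge0 ?exprn_ge0// ltW.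
have t0 : 0 <= sparse_tail u k by exact: sqrtr_ge0.
apply: n2_le; first by rewrite addr_ge0.
apply: (@le_trans _ _ ((2 ^+ k * (Rr / 16 ^+ k)) ^+ 2 + sparse_tail u k ^+ 2)); last first.
  by rewrite sqrrD -addrA [_ *+ 2 + _]addrC addrA lerDl mulrn_wge0// mulr_ge0.
rewrite /sparse_tail /tail sqr_sqrtr; last by apply: sumr_ge0 => i _; exact: sqr_ge0.
rewrite (sum_by_size u).
rewrite -(big_mkord xpredT (fun n => (u (nx n) - grid phi (nx n)) ^+ 2)).
set G := fun n => (u (nx n) - grid phi (nx n)) ^+ 2.
have G0 n : 0 <= G n by exact: sqr_ge0.
have head n : (n < #|V|)%N -> (n < (4 ^ k).-1)%N -> G n <= (Rr / 16 ^+ k) ^+ 2.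
  move=> nV nk; rewrite /G gridE// nk -[leLHS]real_normK ?num_real//.
  have dN : 0 <= Rr / N%:R by rewrite divr_ge0// ltW.
  rewrite -natrX -/N lerXn2r ?nnegrE//.
  exact: (svalP (hz (nx n))).
have rest n : (n < #|V|)%N -> ((4 ^ k).-1 <= n)%N -> G n = rearrangement u n ^+ 2.
  move=> nV nk; rewrite /G gridE// ltnNge nk /= subr0 /rearrangement nV.
  by rewrite real_normK ?num_real.
have headsum n : (n <= (4 ^ k).-1)%N -> (n <= #|V|)%N ->
    \sum_(0 <= i < n) G i <= (2 ^+ k * (Rr / 16 ^+ k)) ^+ 2.
  move=> nk nV; apply: (@le_trans _ _ (\sum_(0 <= i < n) (Rr / 16 ^+ k) ^+ 2)).
    apply: ler_sum_nat => i /andP[_ h].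
    by apply: head; [exact: leq_trans h nV|exact: leq_trans h nk].
  rewrite sumr_const_nat subn0 -[_ *+ n]mulr_natl [leRHS]exprMn ler_wpM2r ?sqr_ge0//.
  rewrite -exprM mulnC exprM -natrX -natrX ler_nat.
  by rewrite (leq_trans nk)// leq_pred.
have [Vk|kV] := leqP #|V| (4 ^ k).-1.
  by rewrite [X in _ <= _ + X]big_geq// addr0; exact: headsum.
rewrite (@big_cat_nat _ _ _ (4 ^ k).-1)//= ?(ltnW kV)//; apply: lerD.
  by apply: headsum => //; exact: ltnW.
apply: ler_sum_nat => n /andP[h1 h2].
by rewrite -[leLHS]/(G n) (rest n h2 h1).
Qed.

End SparseGrid.

Lemma expRX2_ge (R : realType) (k : nat) : 2 ^+ k <= expR k%:R :> R.
Proof.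
rewrite -[k%:R]mulr1 expRM_natl lerXn2r ?nnegrE ?expR_ge0//.
by apply: le_trans (expR_ge1Dx 1); lra.
Qed.

Lemma expRX4_ge (R : realType) (k : nat) : expR k%:R <= 4 ^+ k :> R.
Proof.
rewrite -[k%:R]mulr1 expRM_natl lerXn2r ?nnegrE ?expR_ge0//.
have h : 2^-1 <= expR (- 2^-1) :> R.
  by apply: le_trans (expR_ge1Dx _); lra.
have -> : expR 1 = (expR (- 2^-1))^-1 ^+ 2 :> R.
  by rewrite expRN invrK -expRM_natl; congr expR; field.
have -> : 4 = 2^-1^-1 ^+ 2 :> R by rewrite invrK -natrX.
rewrite lerXn2r ?nnegrE ?invr_ge0 ?expR_ge0//.
by rewrite lef_pV2 ?posrE ?expR_gt0// invr_gt0.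
Qed.

Lemma card_grid_index (R : realType) (V : finType) (L : R) k : 1 <= L ->
  #|V|%:R <= expR L -> #|grid_index V k|%:R <= expR (5 * 4 ^+ k * (L + k%:R)) :> R.
Proof.
move=> L1 VL.
rewrite card_ffun card_ord card_prod card_ord natrX natrM.
have h1 : (2 * 16 ^ k).+1%:R <= expR (4 * k.+1%:R) :> R.
  rewrite -natrM; apply: le_trans (expRX2_ge _ _).
  rewrite mulnC -natrX ler_nat mulnC expnM (_ : 2 ^ 4 = 16)%N// expnS.
  have : (0 < 16 ^ k)%N by rewrite expn_gt0.
  lia.
have L0 : 0 <= L := le_trans ler01 L1.
have kk : 0 <= k%:R :> R by [].
have e0 : 0 <= 4 * k.+1%:R :> R by rewrite mulr_ge0.
apply: (@le_trans _ _ (expR (L + 4 * k.+1%:R) ^+ (4 ^ k).-1)).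
  by rewrite lerXn2r ?nnegrE ?mulr_ge0 ?expR_ge0// expRD ler_pM.
rewrite -expRM_natl ler_expR.
apply: (@le_trans _ _ ((4 ^ k)%:R * (L + 4 * k.+1%:R))).
  by rewrite ler_wpM2r ?addr_ge0// ler_nat leq_pred.
rewrite natrX [5 * _]mulrC -mulrA ler_wpM2l ?exprn_ge0//.
have -> : k.+1%:R = k%:R + 1 :> R by rewrite natr1.
lra.
Qed.

Section NetsInSet.
Variables (R : realType) (V : finType) (v0 : V) (Rr L v : R) (K : (V -> R) -> Prop).
Hypotheses (Rr0 : 0 < Rr) (L1 : 1 <= L) (v_ge0 : 0 <= v) (VL : #|V|%:R <= expR L).
Hypotheses (K0 : K (fun=> 0)) (KR : forall u, K u -> \sum_x `|u x| <= Rr).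

(** [K] need not be closed, so the distance to it may not be attained; [eta] is the slack. *)
Lemma near_point (a : V -> R) (eta : R) : 0 < eta ->
  exists s, K s /\ forall u, K u ->
    n2 (fun x => a x - s x) <= n2 (fun x => a x - u x) + eta.
Proof.
move=> eta0.
pose D := [set n2 (fun x => a x - u x) | u in [set u | K u]]%classic.
have hD : has_inf D.
  split; first by exists (n2 (fun x => a x - 0)), (fun=> 0).
  by exists 0 => _ [u _ <-]; exact: n2_ge0.
have [_ [s Ks <-] hs] := inf_adherent eta0 hD.
exists s; split=> // u Ku; apply: le_trans (ltW hs) _; rewrite lerD2r.
by apply: ge_inf; [exact: hD.2|exists u].
Qed.

Lemma nets_in_set : exists s : forall k, grid_index V k -> V -> R,
  [/\ forall phi, s 0 phi = fun=> 0, forall k phi, K (s k phi) &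
    forall u, K u -> exists pi : forall k, grid_index V k, forall n,
      \sum_(k < n) 2 ^+ k * Num.sqrt (L + v + k%:R)
        * n2 (fun x => u x - s k (pi k) x) <= 38 * Rr * Num.sqrt (L + v)].
Proof.
(* The slack Rr / 8^k equals the rounding error 2^k Rr / 16^k of the grid, so moving a net point
   introduces no new scale. *)
have eta0 k : 0 < Rr / 8 ^+ k by rewrite divr_gt0// exprn_gt0.
pose near k (phi : grid_index V k) := cid (near_point (grid Rr phi) (eta0 k)).
pose s k : grid_index V k -> V -> R :=
  if k is k'.+1 then fun phi => sval (near k'.+1 phi) else fun=> fun=> 0.
exists s; split=> //.
  by move=> [|k] phi //=; case: (near _ phi) => ? [].
move=> u Ku.
have gk k := cid (grid_approx v0 Rr0 k (KR Ku)).
pose pi k := sval (gk k); exists pi => n.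
pose t k := sparse_tail v0 u k.
have t0 k : 0 <= t k by exact: sqrtr_ge0.
have dist k : n2 (fun x => u x - s k (pi k) x) <= 2 * t k + 3 * (Rr / 8 ^+ k).
  case: k => [|k] /=.
    rewrite expr0 divr1; apply: (@le_trans _ _ (t 0%N)); last first.
      by have := t0 0%N; have := Rr0; lra.
    rewrite /t /sparse_tail /tail expn0 /= /n2 ler_wsqrtr// (sum_by_size v0 u).
    rewrite big_mkord; apply: ler_sum => i _; rewrite subr0 /rearrangement ltn_ord.
    by rewrite real_normK ?num_real.
  have h1 : n2 (fun x => u x - grid Rr (pi k.+1) x)
      <= 2 ^+ k.+1 * (Rr / 16 ^+ k.+1) + t k.+1 := svalP (gk k.+1).
  have [_ h2] := svalP (near k.+1 (pi k.+1)); have {h2} := h2 _ Ku.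
  set a := grid _ _ in h1 *; set sp := sval _ => h2.
  have e8 (j : nat) : Rr / 8 ^+ j = 2 ^+ j * (Rr / 16 ^+ j).
    have -> : 16 = 8 * 2 :> R by rewrite -natrM.
    by rewrite exprMn; field; rewrite !expf_neq0.
  have h3 := n2_dist_triangle u a sp.
  have h4 := n2_distC u a.
  by move: h2; rewrite e8; lra.
set q := Num.sqrt (L + v).
have q0 : 0 <= q by exact: sqrtr_ge0.
have Lv1 : 1 <= L + v by have := L1; have := v_ge0; lra.
have [L1' v0'] := (L1, v_ge0).
have q1 (k : nat) : Num.sqrt (L + v + k%:R) <= q * 2 ^+ k.
  rewrite -[2 ^+ k]ger0_norm ?exprn_ge0// -sqrtr_sqr -sqrtrM; last by lra.
  rewrite ler_wsqrtr// -exprM mulnC exprM -natrX.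
  have k4 : k%:R + 1 <= 4 ^+ k :> R.
    rewrite natr1 -natrX ler_nat; exact: ltn_expl.
  have : (L + v) * (k%:R + 1) <= (L + v) * 4 ^+ k by rewrite ler_wpM2l//; lra.
  have : k%:R <= (L + v) * k%:R by rewrite ler_peMl.
  by rewrite (_ : (2 ^ 2)%N = 4%N)//; lra.
(* A nonempty tail means 4^k <= #|V| <= e^L, hence k <= L, and [L + v + k] stays within a factor 4
   of [L + v]. *)
have q2 (k : nat) : Num.sqrt (L + v + k%:R) * t k <= 2 * q * t k.
  have [Vk|kV] := leqP #|V| (4 ^ k).-1.
    by rewrite /t /sparse_tail /tail big_geq// sqrtr0 !mulr0.
  rewrite ler_wpM2r//.
  have kL : k%:R <= L.
    rewrite -ler_expR; apply: le_trans (expRX4_ge R k) _; apply: le_trans VL.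
    rewrite -natrX ler_nat; move: kV; have : (0 < 4 ^ k)%N by rewrite expn_gt0.
    lia.
  have -> : 2 = Num.sqrt (2 ^+ 2) :> R by rewrite sqrtr_sqr ger0_norm.
  rewrite -sqrtrM ?sqr_ge0// ler_wsqrtr//; lra.
(* The final 38 is 4 * 8 + 3 * 2, with 8 from [sum_tail_le] and 2 from the geometric series of the
   slacks. *)
apply: (@le_trans _ _ (\sum_(k < n)
   (4 * q * (2 ^+ k * t k) + 3 * Rr * q * (2^-1 ^+ k)))).
  apply: ler_sum => k _.
  have c0 : 0 <= 2 ^+ k * Num.sqrt (L + v + k%:R) by rewrite mulr_ge0 ?exprn_ge0 ?sqrtr_ge0.
  apply: (le_trans (ler_wpM2l c0 (dist k))); rewrite mulrDr; apply: lerD.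
    have := ler_wpM2l (exprn_ge0 k (@ler0n R 2)) (q2 k); lra.
  have h := ler_wpM2l (exprn_ge0 k (@ler0n R 2)) (q1 k).
  apply: (le_trans (ler_wpM2r _ h)); first by rewrite mulr_ge0// ltW.
  have -> : 8 ^+ k = 2 ^+ k * 2 ^+ k * 2 ^+ k :> R.
    by rewrite -!exprMn; congr (_ ^+ _); lra.
  rewrite exprVn le_eqVlt; apply/orP; left; apply/eqP; field.
  by rewrite expf_neq0.
rewrite big_split /= -!mulr_sumr.
have h1 : \sum_(k < n) 2 ^+ k * t k <= 8 * Rr.
  apply: le_trans (sum_tail_le (rearrangement_ge0 v0 u) (@rearrangement_noninc _ _ v0 u)
     (@rearrangement_out _ _ v0 u) n) _.
  by rewrite ler_pM2l// sum_rearrangement KR.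
have h2 : \sum_(k < n) 2^-1 ^+ k <= 2 :> R.
  have := @geometric_le R 2^-1 _ _ n; have -> : (1 - 2^-1)^-1 = 2 :> R by field.
  by apply; lra.
have qR0 : 0 <= Rr * q by rewrite mulr_ge0// ltW.
have := ler_wpM2l q0 h1; have := ler_wpM2l qR0 h2; lra.
Qed.

End NetsInSet.

(** * Deviation of a single link of the chain *)

Section LinkEvent.
Variables (R : realType) (d T m : nat) (A : 'I_m -> 'M[R]_d) (q : nat).
Notation J := ('I_m * 'I_T.+1 * 'I_d)%type.
Implicit Types (H : 'I_m -> 'M[R]_(q, d)) (g : J -> R) (W : {set 'I_m}).

(** The inner product <Q H, Q H'>: the sum over [l] and [t] of <H_l x_{l,t+1}, H'_l x_{l,t+1}>. *)
Definition ip H H' g : R := \sum_o lin (coef A H o) g * lin (coef A H' o) g.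

(* [ip] minus its expectation under standard Gaussian noise *)
Definition dv H H' g : R :=
  ip H H' g - hsdot (coef (T := T) A H) (coef A H').

Definition restr W H l : 'M[R]_(q, d) := if l \in W then H l else 0.

Lemma coefD H H' o (i : J) : coef A (fun l => H l + H' l) o i = coef A H o i + coef A H' o i.
Proof. by rewrite /coef; case: ifP => _; rewrite ?addr0// mulmxDl mxE. Qed.

Lemma coefZ H c o (i : J) : coef A (fun l => c *: H l) o i = c * coef A H o i.
Proof. by rewrite /coef; case: ifP => _; rewrite ?mulr0// -scalemxAl mxE. Qed.

Lemma coef_restr W H o (i : J) :
  coef A (restr W H) o i = if o.1.1 \in W then coef A H o i else 0.
Proof.
rewrite /coef /restr; case: (o.1.1 \in W) => //.
by rewrite mul0mx mxE; case: ifP.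
Qed.

Lemma ipD H1 H2 H g : ip (fun l => H1 l + H2 l) H g = ip H1 H g + ip H2 H g.
Proof.
rewrite /ip -big_split /=; apply: eq_bigr => o _; rewrite -mulrDl; congr (_ * _).
by rewrite /lin -big_split /=; apply: eq_bigr => i _; rewrite coefD mulrDl.
Qed.

Lemma ipZ c H H' g : ip (fun l => c *: H l) H' g = c * ip H H' g.
Proof.
rewrite /ip mulr_sumr; apply: eq_bigr => o _; rewrite mulrA; congr (_ * _).
by rewrite /lin mulr_sumr; apply: eq_bigr => i _; rewrite coefZ mulrA.
Qed.

Lemma ipC H H' g : ip H H' g = ip H' H g.
Proof. by apply: eq_bigr => o _; rewrite mulrC. Qed.

Lemma ip_ge0 H g : 0 <= ip H H g.
Proof. by apply: sumr_ge0 => o _; rewrite -expr2 sqr_ge0. Qed.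

Lemma ip_cauchy_schwarz H H' g : `|ip H H' g| <= Num.sqrt (ip H H g) * Num.sqrt (ip H' H' g).
Proof.
rewrite -sqrtrM ?ip_ge0// -[X in X <= _]ger0_norm// -sqrtr_sqr ler_wsqrtr//.
rewrite real_normK ?num_real//; apply: le_trans (cauchy_schwarz_sum _ _) _.
by rewrite le_eqVlt; apply/orP; left; apply/eqP; congr (_ * _);
  apply: eq_bigr => o _; rewrite expr2.
Qed.

Notation mean H H' := (hsdot (coef (T := T) A H) (coef A H')).

Lemma meanD H1 H2 H : mean (fun l => H1 l + H2 l) H = mean H1 H + mean H2 H.
Proof.
rewrite /hsdot -big_split /=; apply: eq_bigr => o _; rewrite -big_split /=.
by apply: eq_bigr => i _; rewrite coefD mulrDl.
Qed.

Lemma meanZ c H H' : mean (fun l => c *: H l) H' = c * mean H H'.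
Proof.
rewrite /hsdot mulr_sumr; apply: eq_bigr => o _; rewrite mulr_sumr.
by apply: eq_bigr => i _; rewrite coefZ mulrA.
Qed.

Lemma meanC H H' : mean H H' = mean H' H.
Proof. by apply: eq_bigr => o _; apply: eq_bigr => i _; rewrite mulrC. Qed.

Lemma mean_frob H : mean H H = \sum_o \sum_i coef (T := T) A H o i ^+ 2.
Proof. by apply: eq_bigr => o _; apply: eq_bigr => i _; rewrite expr2. Qed.

Lemma mean_ge0 H : 0 <= mean H H.
Proof. by rewrite mean_frob; apply: sumr_ge0 => o _; apply: sumr_ge0 => i _; exact: sqr_ge0. Qed.

Lemma mean_cauchy_schwarz H H' :
  `|mean H H'| <= Num.sqrt (mean H H) * Num.sqrt (mean H' H').
Proof.
have hs H1 H2 : mean H1 H2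
    = \sum_p coef (T := T) A H1 p.1 p.2 * coef A H2 p.1 p.2 by rewrite /hsdot pair_bigA.
rewrite -sqrtrM ?mean_ge0// -[X in X <= _]ger0_norm// -sqrtr_sqr ler_wsqrtr//.
rewrite real_normK ?num_real// !hs; apply: le_trans (cauchy_schwarz_sum _ _) _.
by rewrite le_eqVlt; apply/orP; left; apply/eqP; congr (_ * _);
  apply: eq_bigr => o _; rewrite expr2.
Qed.

Lemma dvD H1 H2 H g : dv (fun l => H1 l + H2 l) H g = dv H1 H g + dv H2 H g.
Proof. by rewrite /dv ipD meanD; ring. Qed.

Lemma dvZ c H H' g : dv (fun l => c *: H l) H' g = c * dv H H' g.
Proof. by rewrite /dv ipZ meanZ mulrBr. Qed.

Lemma dvC H H' g : dv H H' g = dv H' H g.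
Proof. by rewrite /dv ipC meanC. Qed.

Lemma lin0 (c x : J -> R) : (forall i, c i = 0) -> lin c x = 0.
Proof. by move=> c0; rewrite /lin big1// => i _; rewrite c0 mul0r. Qed.

Lemma lin_restr W H o g :
  lin (coef A (restr W H) o) g = if o.1.1 \in W then lin (coef A H o) g else 0.
Proof.
case: ifP => oW; first by apply: eq_bigr => i _; rewrite coef_restr oW.
by apply: lin0 => i; rewrite coef_restr oW.
Qed.

Lemma ip_restr W H H' g : ip H H' g
  = ip (restr W H) (restr W H') g + ip (restr (~: W)%SET H) (restr (~: W)%SET H') g.
Proof.
rewrite /ip -big_split /=; apply: eq_bigr => o _; rewrite !lin_restr inE.
by case: (o.1.1 \in W); rewrite ?mul0r ?addr0 ?add0r.
Qed.

Lemma mean_restr W H H' : mean H H'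
  = mean (restr W H) (restr W H') + mean (restr (~: W)%SET H) (restr (~: W)%SET H').
Proof.
rewrite /hsdot -big_split /=; apply: eq_bigr => o _; rewrite -big_split /=.
apply: eq_bigr => i _; rewrite !coef_restr inE.
by case: (o.1.1 \in W); rewrite ?mul0r ?addr0 ?add0r.
Qed.

Lemma ip_restr_le W H g : ip (restr W H) (restr W H) g <= ip H H g.
Proof. by rewrite (ip_restr W H) lerDl ip_ge0. Qed.

Lemma fsq0 p1 p2 : fsq (0 : 'M[R]_(p1, p2)) = 0.
Proof. by rewrite /fsq big1// => i _; rewrite big1// => j _; rewrite mxE expr0n. Qed.

Lemma fsq_restr_le W H l : fsq (restr W H l) <= fsq (H l).
Proof. by rewrite /restr; case: ifP => // _; rewrite fsq0 fsq_ge0. Qed.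

Variable rho : R.
Hypotheses (r0 : 0 <= rho) (r1 : rho < 1).
Hypothesis hA : forall l, mx_op_le (A l) rho.
Let r := 1 - rho.

Local Open Scope classical_set_scope.
Variables (disp : measure_display) (Omega : measurableType disp).
Variable P : probability Omega R.
Variable X : J -> {RV P >-> R}.
Hypothesis gX : gaussian_family X.
Let Xw w (i : J) : R := X i w.

(* On the few systems where [Hs] is large, Hanson-Wright is too weak at scale
   [y] beyond [T]; there Cauchy-Schwarz is used, the set [W] being so small
   that [Hb] alone is controlled at the cost of [y]. *)
Lemma link_event (Hb Hs : 'I_m -> 'M[R]_(q, d)) (beta y : R) :
  0 <= beta -> 0 < y -> (0 < T)%N ->
  (forall l, fsq (Hb l) <= beta ^+ 2) -> \sum_l fsq (Hs l) <= 1 ->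
  whp P (4 * expR (- y)) (fun w => `|dv Hb Hs (Xw w)|
    <= 65 * (beta * Num.sqrt y * Num.sqrt T%:R / r ^+ 2)
       + 9 * (beta * Num.sqrt y / r * Num.sqrt (ip Hs Hs (Xw w)))).
Proof.
move=> b0 y0 T0 hb hs; have rp : 0 < r by rewrite subr_gt0.
have Tp : 0 < T%:R :> R by rewrite ltr0n.
set sy := Num.sqrt y; set sT := Num.sqrt T%:R.
have sy0 : 0 < sy by rewrite sqrtr_gt0.
have sT0 : 0 < sT by rewrite sqrtr_gt0.
have yE : y = sy ^+ 2 by rewrite sqr_sqrtr// ltW.
have TE : T%:R = sT ^+ 2 by rewrite sqr_sqrtr// ltW.
(* Outside [W] the operator norm belonging to [Hs] is at most sqrt(T / y) / r, so the term of
   Hanson-Wright linear in [y] equals its square-root term. The size of [W] is limited by the total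
   Frobenius norm of [Hs]. *)
pose W := [set l | T%:R / y < fsq (Hs l)]%SET.
have cardW : #|W|%:R * T%:R <= y.
  rewrite -[leRHS]mul1r -ler_pdivrMr// -mulrA; apply: le_trans hs.
  apply: (@le_trans _ _ (\sum_(l in W) fsq (Hs l))).
    rewrite mulr_natl -sumr_const; apply: ler_sum => l; rewrite inE => h.
    exact: ltW.
  rewrite [leRHS](bigID (mem W)) /= lerDl.
  by apply: sumr_ge0 => l _; exact: fsq_ge0.
pose Hb1 := restr W Hb; pose Hb2 := restr (~: W)%SET Hb.
pose Hs1 := restr W Hs; pose Hs2 := restr (~: W)%SET Hs.
have frob_s : mean Hs Hs <= (sT / r) ^+ 2.
  rewrite mean_frob; apply: (le_trans (coef_frob _ r0 r1 hA _)).
  by rewrite expr_div_n -TE ler_piMr// divr_ge0 ?sqr_ge0.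
have mean_mono (W' : {set 'I_m}) H : mean (restr W' H) (restr W' H) <= mean H H.
  by rewrite (mean_restr W' H) lerDl mean_ge0.
have frob_b1 : mean Hb1 Hb1 <= (beta * sy / r) ^+ 2.
  rewrite mean_frob; apply: (le_trans (coef_frob _ r0 r1 hA _)).
  apply: (@le_trans _ _ (T%:R / r ^+ 2 * (#|W|%:R * beta ^+ 2))).
    rewrite ler_wpM2l ?divr_ge0 ?sqr_ge0//.
    rewrite mulr_natl -sumr_const (bigID (mem W)) /= [X in _ + X]big1 ?addr0.
      by apply: ler_sum => l lW; rewrite /Hb1 /restr lW.
    by move=> l lW; rewrite /Hb1 /restr (negbTE lW) fsq0.
  rewrite expr_div_n exprMn -yE.
  have -> : T%:R / r ^+ 2 * (#|W|%:R * beta ^+ 2)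
    = beta ^+ 2 * (#|W|%:R * T%:R) / r ^+ 2 by ring.
  by rewrite ler_pM2r ?invr_gt0 ?exprn_gt0// ler_wpM2l ?sqr_ge0.
have br0 : 0 <= beta / r by rewrite divr_ge0// ltW.
have opb (W' : {set 'I_m}) : op_bound (coef (T := T) A (restr W' Hb)) (beta / r).
  apply: coef_op_bound => // l.
  by apply: le_trans (fsq_restr_le _ _ _) (hb l).
have sTy0 : 0 <= sT / sy / r by rewrite !divr_ge0// ltW.
have ops2 : op_bound (coef (T := T) A Hs2) (sT / sy / r).
  apply: coef_op_bound => // l; rewrite /Hs2 /restr inE; case: ifP => lW.
    by move: lW; rewrite inE -leNgt expr_div_n -TE -yE.
  by rewrite fsq0 sqr_ge0.
have frob_s2 : \sum_o \sum_i coef (T := T) A Hs2 o i ^+ 2 <= (sT / r) ^+ 2.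
  by rewrite -mean_frob; apply: le_trans frob_s; exact: mean_mono.
have sTr0 : 0 <= sT / r by rewrite divr_ge0// ltW.
have bsr0 : 0 <= beta * sy / r by rewrite mulr_ge0 ?invr_ge0 ?mulr_ge0// ltW.
have E1 := hanson_wright gX br0 sTy0 sTr0 y0 (opb (~: W)%SET) ops2 frob_s2.
have frob_b1' : \sum_o \sum_i coef (T := T) A Hb1 o i ^+ 2 <= (beta * sy / r) ^+ 2.
  by rewrite -mean_frob.
have E2 := hanson_wright gX br0 br0 bsr0 y0 (opb W) (opb W) frob_b1'.
apply: whp_sub (whp_and E1 E2); first by lra.
move=> w [h1 h2].
have {}h1 : `|dv Hb2 Hs2 (Xw w)| <= 64 * (beta * sy * sT / r ^+ 2).
  apply: (le_trans h1); rewrite -/sy yE le_eqVlt; apply/orP; left; apply/eqP.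
  by field; rewrite !gt_eqF.
(* 32 + 32 from Hanson-Wright and 1 from the mean make 65, below 9^2. *)
have {}h2 : ip Hb1 Hb1 (Xw w) <= (9 * (beta * sy / r)) ^+ 2.
  move: h2 => /ler_normlP[_ h2].
  have : ip Hb1 Hb1 (Xw w) - mean Hb1 Hb1 <= 64 * (beta * sy / r) ^+ 2.
    apply: (le_trans h2); rewrite -/sy yE le_eqVlt; apply/orP; left; apply/eqP.
    by field; rewrite gt_eqF.
  rewrite exprMn; have := sqr_ge0 (beta * sy / r); move: frob_b1; rewrite -/Hb1; lra.
have h3 : `|ip Hb1 Hs1 (Xw w)| <= 9 * (beta * sy / r) * Num.sqrt (ip Hs Hs (Xw w)).
  apply: (le_trans (ip_cauchy_schwarz _ _ _)); apply: ler_pM; rewrite ?sqrtr_ge0//.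
    have c9 : 0 <= 9 * (beta * sy / r) by rewrite mulr_ge0.
    by rewrite -[leRHS](ger0_norm c9) -sqrtr_sqr; exact: ler_wsqrtr.
  by apply: ler_wsqrtr; exact: ip_restr_le.
have h4 : `|mean Hb1 Hs1| <= beta * sy / r * (sT / r).
  apply: (le_trans (mean_cauchy_schwarz _ _)); apply: ler_pM; rewrite ?sqrtr_ge0//.
    by rewrite -[leRHS](ger0_norm bsr0) -sqrtr_sqr; exact: ler_wsqrtr.
  rewrite -[leRHS](ger0_norm sTr0) -sqrtr_sqr; apply: ler_wsqrtr.
  by apply: le_trans frob_s; exact: mean_mono.
have -> : dv Hb Hs (Xw w) = dv Hb2 Hs2 (Xw w) + (ip Hb1 Hs1 (Xw w) - mean Hb1 Hs1).
  by rewrite /dv (ip_restr W) (mean_restr W) -/Hb1 -/Hb2 -/Hs1 -/Hs2; ring.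
apply: (le_trans (ler_normD _ _)).
apply: (le_trans (lerD h1 (ler_normB _ _))).
have e : beta * sy / r * (sT / r) = beta * sy * sT / r ^+ 2.
  by field; rewrite gt_eqF.
by move: h3 h4; rewrite e; lra.
Qed.

End LinkEvent.

(** * Chaining with a self-bounded supremum *)

Section ChainDeterministic.
Variables (R : realType) (d T m : nat) (A : 'I_m -> 'M[R]_d) (q : nat).
Notation J := ('I_m * 'I_T.+1 * 'I_d)%type.
Variables (V : finType) (B : V -> 'I_m -> 'M[R]_(q, d)).

Definition lcomb (u : V -> R) (l : 'I_m) : 'M[R]_(q, d) := \sum_x u x *: B x l.

Lemma lcombD u w : lcomb (fun x => u x + w x) = fun l => lcomb u l + lcomb w l.
Proof.
apply/funext => l; rewrite /lcomb -big_split /=.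
by apply: eq_bigr => x _; rewrite scalerDl.
Qed.

Lemma lcomb0 : lcomb (fun=> 0) = fun=> 0.
Proof. by apply/funext => l; rewrite /lcomb big1// => x _; rewrite scale0r. Qed.

(** A difference of squares factors through [u - w], so every increment of the chain has one small
    factor. *)
Lemma dv_lcomb_sub u w g : dv (T := T) A (lcomb u) (lcomb u) g - dv A (lcomb w) (lcomb w) g
  = dv A (lcomb (fun x => u x - w x)) (lcomb w) g
    + dv A (lcomb (fun x => u x - w x)) (lcomb u) g.
Proof.
have uE : lcomb u = fun l => lcomb (fun x => u x - w x) l + lcomb w l.
  by rewrite -lcombD; congr lcomb; apply/funext => x; rewrite subrK.
have split h : dv A (lcomb u) (lcomb h) g
    = dv A (lcomb (fun x => u x - w x)) (lcomb h) g + dv A (lcomb w) (lcomb h) g.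
  by rewrite {1}uE dvD.
by rewrite split (dvC _ (lcomb w) (lcomb u)) split; ring.
Qed.

End ChainDeterministic.

Section Chain.
Variables (R : realType) (d T m : nat) (A : 'I_m -> 'M[R]_d) (q : nat).
Notation J := ('I_m * 'I_T.+1 * 'I_d)%type.
Variable rho : R.
Hypotheses (r0 : 0 <= rho) (r1 : rho < 1) (T0 : (0 < T)%N).
Hypothesis hA : forall l, mx_op_le (A l) rho.
Let r := 1 - rho.
Variables (V : finType) (v0 : V) (B : V -> 'I_m -> 'M[R]_(q, d)).
Variables (nu Rr L v : R).
Hypotheses (nu0 : 0 <= nu) (Rr0 : 0 < Rr) (L1 : 1 <= L) (v_ge0 : 0 <= v).
Hypothesis VL : #|V|%:R <= expR L.
Hypothesis hB : forall u l, fsq (lcomb B u l) <= nu ^+ 2 * \sum_x u x ^+ 2.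

Let K (u : V -> R) := \sum_x `|u x| <= Rr /\ \sum_l fsq (lcomb B u l) <= 1.

Let q0 := Num.sqrt (L + v).
Let sT : R := Num.sqrt T%:R.

Hypothesis small : 2000 * (500 * (nu * Rr * q0)) <= sT * r ^+ 2.

Let dvu u g : R := dv (T := T) A (lcomb B u) (lcomb B u) g.
Let ipu u g : R := ip (T := T) A (lcomb B u) (lcomb B u) g.
Let yk (k : nat) : R := 50 * 4 ^+ k * (L + v + k%:R).

Definition chain_link (b s : V -> R) (y : R) (g : J -> R) : Prop :=
  `|dv A (lcomb B b) (lcomb B s) g|
    <= 65 * (nu * n2 b * Num.sqrt y * sT / r ^+ 2)
       + 9 * (nu * n2 b * Num.sqrt y / r * Num.sqrt (ipu s g)).

(** Deterministic half of the chaining: on the link events the increments telescope. [N] stays a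
    parameter, to be eliminated in [chain_whp]. Since [u] is only a limit of net points, a passage
    to the limit ends the proof. *)
Lemma chain_bound (g : J -> R) (s : nat -> V -> R) (u : V -> R) (N : R) :
  K u -> (forall k, K (s k)) -> s 0%N = (fun=> 0) ->
  (forall h, K h -> Num.sqrt (ipu h g) <= N) ->
  (forall k, chain_link (fun x => s k.+1 x - s k x) (s k) (yk k) g) ->
  (forall k, chain_link (fun x => s k.+1 x - s k x) (s k.+1) (yk k) g) ->
  (forall n, \sum_(k < n) 2 ^+ k * Num.sqrt (L + v + k%:R)
        * n2 (fun x => u x - s k x) <= 38 * Rr * q0) ->
  `|dvu u g| <= 130 * (500 * (nu * Rr * q0) * sT / r ^+ 2)
               + 18 * (500 * (nu * Rr * q0) / r * N).
Proof.
move=> Ku Ks s0 hN link1 link2 hsum.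
have rp : 0 < r by rewrite subr_gt0.
have [L1' v0'] := (L1, v_ge0).
have sT0 : 0 <= sT by exact: sqrtr_ge0.
have N0 : 0 <= N by apply: le_trans (hN u Ku); exact: sqrtr_ge0.
pose e k := n2 (fun x => u x - s k x).
have e0 k : 0 <= e k by exact: n2_ge0.
pose sy k := Num.sqrt (yk k).
pose c := 130 * (sT / r ^+ 2) + 18 * (N / r).
have c0 : 0 <= c.
  rewrite /c addr_ge0// mulr_ge0// divr_ge0//; [exact: sqr_ge0|exact: ltW].
have step k : `|dvu (s k.+1) g - dvu (s k) g| <= nu * (sy k * (e k + e k.+1)) * c.
  rewrite /dvu dv_lcomb_sub; set b := fun x => _.
  have nb : n2 b <= e k + e k.+1.
    rewrite /e (n2_distC u (s k.+1)) addrC; exact: n2_dist_triangle.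
  have nb0 := n2_ge0 b; have sy0 : 0 <= sy k by exact: sqrtr_ge0.
  apply: (le_trans (ler_normD _ _)).
  have := link1 k; have := link2 k; rewrite /chain_link -/b -/(sy k) => h2 h1.
  have p0 : 0 <= nu * n2 b * sy k / r by rewrite divr_ge0 ?(ltW rp)// !mulr_ge0.
  have g1 := ler_wpM2l p0 (hN _ (Ks k)); have g2 := ler_wpM2l p0 (hN _ (Ks k.+1)).
  apply: (@le_trans _ _ (nu * (sy k * n2 b) * c)).
    apply: (@le_trans _ _ (130 * (nu * n2 b * sy k * sT / r ^+ 2)
       + 18 * (nu * n2 b * sy k / r * N))); first by lra.
    by rewrite /c le_eqVlt; apply/orP; left; apply/eqP; ring.
  by rewrite ler_wpM2r// ler_wpM2l// ler_wpM2l.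
have syE k : sy k <= 8 * (2 ^+ k * Num.sqrt (L + v + k%:R)).
  have Lk0 : 0 <= L + v + k%:R by rewrite addr_ge0//; lra.
  have -> : 8 * (2 ^+ k * Num.sqrt (L + v + k%:R))
      = Num.sqrt ((8 * 2 ^+ k) ^+ 2 * (L + v + k%:R)).
    by rewrite sqrtrM ?sqr_ge0// sqrtr_sqr ger0_norm ?mulr_ge0 ?exprn_ge0// mulrA.
  rewrite ler_wsqrtr// /yk ler_wpM2r// exprMn -exprM mulnC exprM.
  have -> : (2 ^+ 2 : R) = 4 by rewrite -natrX.
  by rewrite ler_wpM2r ?exprn_ge0//; lra.
have telescope n : `|dvu (s n) g| <= nu * (\sum_(k < n) sy k * (e k + e k.+1)) * c.
  elim: n => [|n IH].
    rewrite big_ord0 mulr0 mul0r /dvu s0 lcomb0.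
    have -> : dv (T := T) A (fun=> 0 : 'M[R]_(q, d)) (fun=> 0) g = 0.
      rewrite /dv /ip /hsdot big1; last first.
        move=> o _; rewrite lin0 ?mul0r// => i.
        by rewrite /coef mul0mx mxE; case: ifP.
      rewrite big1 ?subrr// => o _; rewrite big1// => i _.
      by rewrite /coef mul0mx mxE; case: ifP; rewrite mul0r.
    by rewrite normr0.
  rewrite big_ord_recr /= (mulrDr nu) (mulrDl _ _ c).
  have -> : dvu (s n.+1) g = dvu (s n) g + (dvu (s n.+1) g - dvu (s n) g) by rewrite addrC subrK.
  by apply: (le_trans (ler_normD _ _)); apply: lerD => //; exact: step.
(* The shift from [k] to [k.+1] doubles the weight 2^k, hence the 4 beside the 8, and 12 * 38 =
   456. *)
have sumle n : \sum_(k < n) sy k * (e k + e k.+1) <= 500 * (Rr * q0).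
  pose t k := 2 ^+ k * Num.sqrt (L + v + k%:R) * e k.
  have t0 k : 0 <= t k by rewrite !mulr_ge0 ?exprn_ge0 ?sqrtr_ge0.
  apply: (@le_trans _ _ (\sum_(k < n) (8 * t k + 4 * t k.+1))).
    apply: ler_sum => k _; rewrite mulrDr; apply: lerD.
      by apply: le_trans (ler_wpM2r (e0 _) (syE k)) _; rewrite /t !mulrA.
    apply: le_trans (ler_wpM2r (e0 _) (syE k)) _.
    have -> : 4 * t k.+1 = 8 * (2 ^+ k * Num.sqrt (L + v + k.+1%:R)) * e k.+1.
      by rewrite /t exprS; ring.
    rewrite ler_wpM2r// ler_pM2l// ler_wpM2l ?exprn_ge0// ler_wsqrtr//.
    by rewrite lerD2l ler_nat.
  rewrite big_split /= -!mulr_sumr.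
  have h1 := hsum n; have : \sum_(k < n) t k.+1 <= 38 * Rr * q0.
    by apply: le_trans (hsum n.+1); rewrite big_ord_recl /= lerDr; exact: t0.
  have : 0 <= Rr * q0 by rewrite mulr_ge0 ?sqrtr_ge0// ltW.
  rewrite -/(t _) in h1; move: h1; rewrite -[\sum_(k < n) _ * n2 _]/(\sum_(k < n) t k).
  lra.
have bound n : `|dvu (s n) g| <= nu * (500 * (Rr * q0)) * c.
  by apply: le_trans (telescope n) _; rewrite ler_wpM2r// ler_wpM2l.
have -> : 130 * (500 * (nu * Rr * q0) * sT / r ^+ 2) + 18 * (500 * (nu * Rr * q0) / r * N)
   = nu * (500 * (Rr * q0)) * c by rewrite /c; ring.
pose G := Num.sqrt (\sum_i g i ^+ 2).
have GE : G ^+ 2 = \sum_i g i ^+ 2.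
  by rewrite sqr_sqrtr// sumr_ge0// => i _; exact: sqr_ge0.
have opK h : K h -> op_bound (coef (T := T) A (lcomb B h)) (1 / (1 - rho)).
  move=> [_ h1]; apply: coef_op_bound => // l; rewrite expr1n; apply: le_trans h1.
  by rewrite (bigD1 l)//= lerDl sumr_ge0// => ? _; exact: fsq_ge0.
(* crude continuity of the deviation, to pass to the limit along the chain *)
have [Z Z0 crude] : exists2 Z, 0 <= Z & forall b h, K h ->
    `|dv A (lcomb B b) (lcomb B h) g| <= n2 b * Z.
  exists (nu / r * G * (r^-1 * G) + sT / r * Num.sqrt m%:R * nu * (sT / r)).
    have G0 : 0 <= G by exact: sqrtr_ge0.
    have ri : 0 <= r^-1 by rewrite invr_ge0 ltW.
    by rewrite addr_ge0// !mulr_ge0// ?sqrtr_ge0.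
  move=> b h Kh; have nb0 := n2_ge0 b.
  have fb l : fsq (lcomb B b l) <= (nu * n2 b) ^+ 2 by rewrite exprMn n2_sqr.
  have G0 : 0 <= G by exact: sqrtr_ge0.
  have ri : 0 <= r^-1 by rewrite invr_ge0 ltW.
  apply: (le_trans (ler_normB _ _)); rewrite mulrDr; apply: lerD.
    apply: (le_trans (ip_cauchy_schwarz _ _ _ _)).
    have ipb (a : 'I_m -> 'M[R]_(q, d)) al : 0 <= al -> op_bound (coef (T := T) A a) al ->
        Num.sqrt (ip A a a g) <= al * G.
      move=> al0 ha; have aG : 0 <= al * G by rewrite mulr_ge0.
      rewrite -[leRHS](ger0_norm aG) -sqrtr_sqr ler_wsqrtr// exprMn GE.
      apply: le_trans (ha g); rewrite le_eqVlt; apply/orP; left; apply/eqP.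
      by apply: eq_bigr => o _; rewrite expr2.
    have -> : n2 b * (nu / r * G * (r^-1 * G)) = (nu * n2 b / r * G) * (r^-1 * G) by ring.
    apply: ler_pM; rewrite ?sqrtr_ge0//.
      apply: ipb; first by rewrite !mulr_ge0.
      exact: coef_op_bound.
    by apply: ipb => //; rewrite -div1r; exact: opK.
  apply: (le_trans (mean_cauchy_schwarz _ _ _ _)).
  have frob (a : 'I_m -> 'M[R]_(q, d)) z : 0 <= z -> \sum_l fsq (a l) <= z ^+ 2 ->
      Num.sqrt (hsdot (coef (T := T) A a) (coef A a)) <= sT / r * z.
    move=> z0 ha; have tz : 0 <= sT / r * z by rewrite !mulr_ge0.
    rewrite -[leRHS](ger0_norm tz) -sqrtr_sqr ler_wsqrtr// mean_frob.
    apply: (le_trans (coef_frob _ r0 r1 hA _)); rewrite exprMn expr_div_n sqr_sqrtr//.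
    by rewrite ler_wpM2l// divr_ge0 ?sqr_ge0.
  have -> : n2 b * (sT / r * Num.sqrt m%:R * nu * (sT / r))
     = sT / r * (Num.sqrt m%:R * (nu * n2 b)) * (sT / r * 1) by ring.
  apply: ler_pM; rewrite ?sqrtr_ge0//.
    apply: frob; first by rewrite !mulr_ge0 ?sqrtr_ge0.
    rewrite exprMn sqr_sqrtr// mulr_natl -[X in _ *+ X]card_ord -sumr_const.
    exact: ler_sum.
  by apply: frob => //; rewrite expr1n; exact: Kh.2.
have q00 : 0 < q0 by rewrite sqrtr_gt0; lra.
(* A single term of the weighted sum, whose weight is at least 2^n, already shows that the net
   points converge to [u]. *)
have small_e n : e n <= 38 * Rr * q0 / 2 ^+ n.
  rewrite ler_pdivlMr ?exprn_gt0//; apply: le_trans (hsum n.+1).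
  rewrite big_ord_recr /=; apply: (@le_trans _ _ (2 ^+ n * Num.sqrt (L + v + n%:R) * e n)).
    rewrite mulrC ler_wpM2r// ler_peMr ?exprn_ge0//.
    rewrite -[X in X <= _]sqrtr1 ler_wsqrtr//.
    by have := ler0n R n; lra.
  rewrite lerDr; apply: sumr_ge0 => k _.
  by rewrite !mulr_ge0 ?exprn_ge0 ?sqrtr_ge0.
apply/ler_addgt0Pr => eps eps0.
pose M0 := 2 * (38 * Rr * q0 * Z) / eps.
have M00 : 0 <= M0 by rewrite divr_ge0 ?(ltW eps0)// !mulr_ge0// ltW.
have [n hn] : exists n : nat, M0 <= 2 ^+ n.
  exists (Num.truncn M0).+1.
  have /andP[_ h] := truncn_itv M00; apply: (le_trans (ltW h)).
  by rewrite -natrX ler_nat ltnW// ltn_expl.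
have -> : dvu u g = dvu (s n) g + (dvu u g - dvu (s n) g) by rewrite addrC subrK.
apply: (le_trans (ler_normD _ _)); apply: lerD => //.
rewrite /dvu dv_lcomb_sub; apply: (le_trans (ler_normD _ _)).
have h1 := crude (fun x => u x - s n x) _ (Ks n); have h2 := crude (fun x => u x - s n x) _ Ku.
apply: (le_trans (lerD h1 h2)); rewrite -/(e n) -mulr2n -[leLHS]mulr_natl mulrA.
have -> : 2 * e n * Z = 2 * (e n * Z) by rewrite mulrA.
apply: (@le_trans _ _ (2 * (38 * Rr * q0 / 2 ^+ n * Z))).
  by rewrite ler_pM2l// ler_wpM2r.
have -> : 2 * (38 * Rr * q0 / 2 ^+ n * Z) = M0 * eps / 2 ^+ n.
  rewrite /M0; field; by rewrite expf_neq0//= gt_eqF.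
rewrite ler_pdivrMr ?exprn_gt0// mulrC ler_wpM2l//; exact: ltW.
Qed.

End Chain.

Section ChainProbability.
Local Open Scope classical_set_scope.
Variables (R : realType) (d T m : nat) (A : 'I_m -> 'M[R]_d) (q : nat).
Notation J := ('I_m * 'I_T.+1 * 'I_d)%type.
Variables (disp : measure_display) (Omega : measurableType disp).
Variable P : probability Omega R.
Variable X : J -> {RV P >-> R}.

Lemma expRN_le_half (n : nat) (x : R) : n%:R <= x -> expR (- x) <= (2 ^+ n)^-1.
Proof.
move=> nx; rewrite expRN lef_pV2 ?posrE ?expR_gt0 ?exprn_gt0//.
by apply: le_trans (expRX2_ge R n) _; rewrite ler_expR.
Qed.

(** The supremum of ||Q h|| over [K] bounds itself: its square is at most mean plus deviation, and
    by chaining the deviation is at most affine in it. *)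
Theorem chain_whp (rho : R) (V : finType) (v0 : V) (B : V -> 'I_m -> 'M[R]_(q, d))
    (nu Rr L v : R) :
  gaussian_family X -> 0 <= rho -> rho < 1 -> (0 < T)%N ->
  (forall l, mx_op_le (A l) rho) ->
  0 <= nu -> 0 < Rr -> 1 <= L -> 0 <= v -> #|V|%:R <= expR L ->
  (forall u l, fsq (lcomb B u l) <= nu ^+ 2 * \sum_x u x ^+ 2) ->
  2000 * (500 * (nu * Rr * Num.sqrt (L + v))) <= Num.sqrt T%:R * (1 - rho) ^+ 2 ->
  whp P (expR (- v)) (fun w => forall u : V -> R,
    \sum_x `|u x| <= Rr -> \sum_l fsq (lcomb B u l) <= 1 ->
    `|dv (T := T) A (lcomb B u) (lcomb B u) (fun i => X i w)| <= T%:R / 6).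
Proof.
move=> gX r0 r1 T0 hA nu0 Rr0 L1 v_ge0 VL hB small.
set r := 1 - rho in small *; have rp : 0 < r by rewrite subr_gt0.
pose K (u : V -> R) := \sum_x `|u x| <= Rr /\ \sum_l fsq (lcomb B u l) <= 1.
have K0 : K (fun=> 0).
  split; first by rewrite big1 ?(ltW Rr0)// => x _; rewrite normr0.
  by rewrite lcomb0 big1 ?ler01// => l _; rewrite fsq0.
have KR u : K u -> \sum_x `|u x| <= Rr by case.
have [s [s0 sK snet]] := nets_in_set v0 Rr0 L1 v_ge0 VL K0 KR.
pose yk (k : nat) : R := 50 * 4 ^+ k * (L + v + k%:R).
have y0 k : 0 < yk k.
  by rewrite /yk !mulr_gt0 ?exprn_gt0//; have := ler0n R k; lra.
pose link k (p : grid_index V k * grid_index V k.+1) (s1 : V -> R) w :=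
  chain_link A rho B nu (fun x => s k.+1 p.2 x - s k p.1 x) s1 (yk k) (fun i => X i w).
have ev k : whp P (expR (- v) / 2 ^+ k.+1) (fun w =>
    forall p : grid_index V k * grid_index V k.+1,
      link k p (s k p.1) w /\ link k p (s k.+1 p.2) w).
  have one (p : grid_index V k * grid_index V k.+1) (s1 : V -> R) : K s1 ->
      whp P (4 * expR (- yk k)) (link k p s1).
    move=> Ks1; rewrite /link /chain_link; set b := fun x => _.
    apply: (link_event r0 r1 hA gX _ (y0 k) T0 _ Ks1.2).
      by rewrite mulr_ge0// n2_ge0.
    by move=> l; rewrite exprMn n2_sqr.
  have two p := whp_and (one p _ (sK k p.1)) (one p _ (sK k.+1 p.2)).
  apply: whp_sub (whp_forall two) => //.
  rewrite card_prod natrM.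
  have c1 := card_grid_index k L1 VL; have c2 := card_grid_index k.+1 L1 VL.
  have e0 := expR_ge0 (- yk k).
  apply: (@le_trans _ _ (expR (5 * 4 ^+ k * (L + k%:R)) * expR (5 * 4 ^+ k.+1 * (L + k.+1%:R))
     * (4 * expR (- yk k) + 4 * expR (- yk k)))).
    by rewrite ler_wpM2r ?addr_ge0 ?mulr_ge0// ler_pM.
  have kk : 0 <= k%:R :> R by [].
  have p4 : 1 <= 4 ^+ k :> R by rewrite exprn_ege1// ler1n.
  (* The first two terms bound the log-cardinality of the pairs of nets at levels [k] and [k.+1] by
     [4 ^+ k * (25 * L + 25 * k%:R + 20)]. The 50 in [yk] beats this by v + k + 4, which makes the
     failures summable over [k]. *)
  have bnd : 5 * 4 ^+ k * (L + k%:R) + 5 * 4 ^+ k.+1 * (L + k.+1%:R) - yk k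
     <= - v - (k + 4)%:R.
    have -> : k.+1%:R = k%:R + 1 :> R by rewrite natr1.
    rewrite natrD /yk exprS.
    have z1 : 0 <= (4 ^+ k - 1) * (25 * L + 25 * k%:R + 50 * v - 20).
      by apply: mulr_ge0; lra.
    lra.
  have -> : expR (5 * 4 ^+ k * (L + k%:R)) * expR (5 * 4 ^+ k.+1 * (L + k.+1%:R))
     * (4 * expR (- yk k) + 4 * expR (- yk k))
     = 8 * expR (5 * 4 ^+ k * (L + k%:R) + 5 * 4 ^+ k.+1 * (L + k.+1%:R) - yk k).
    by rewrite !expRD; ring.
  apply: (@le_trans _ _ (8 * (expR (- v) * (2 ^+ (k + 4))^-1))).
    rewrite ler_pM2l//; apply: le_trans (_ : expR (- v - (k + 4)%:R) <= _).
      by rewrite ler_expR.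
    by rewrite expRD ler_wpM2l ?expR_ge0// expRN_le_half.
  rewrite mulrCA ler_wpM2l ?expR_ge0// addnC exprD.
  have -> : 2 ^+ 4 = 8 * 2 :> R by rewrite -natrM -natrX.
  have p2 : 2 ^+ k != 0 :> R by rewrite expf_neq0.
  by rewrite exprS le_eqVlt; apply/orP; left; apply/eqP; field.
have evs := whp_nat (expR_ge0 _) ev.
apply: whp_sub evs => // w hw u uR uF; have Ku : K u by split.
have [pi hpi] := snet u Ku.
set g := fun i => X i w.
pose D : set R := [set Num.sqrt (ip (T := T) A (lcomb B h) (lcomb B h) g) | h in [set h | K h]].
(* For a fixed outcome the crude operator bound makes the supremum finite, so that the quadratic
   inequality can be solved for it. *)
have hD : has_sup D.
  split; first by exists (Num.sqrt (ip (T := T) A (lcomb B u) (lcomb B u) g)), u.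
  exists (Num.sqrt ((1 / r) ^+ 2 * \sum_i g i ^+ 2)) => _ [h Kh <-].
  apply: ler_wsqrtr.
  have : op_bound (coef (T := T) A (lcomb B h)) (1 / r).
    apply: coef_op_bound => // l; rewrite expr1n; apply: le_trans Kh.2.
    by rewrite (bigD1 l)//= lerDl sumr_ge0// => ? _; exact: fsq_ge0.
  move=> /(_ g); apply: le_trans; rewrite le_eqVlt; apply/orP; left; apply/eqP.
  by apply: eq_bigr => o _; rewrite expr2.
set N := sup D.
have hN h : K h -> Num.sqrt (ip (T := T) A (lcomb B h) (lcomb B h) g) <= N.
  by move=> Kh; apply: ub_le_sup; [exact: hD.2|exists h].
have N0 : 0 <= N by apply: le_trans (hN u Ku); exact: sqrtr_ge0.
pose gam := 500 * (nu * Rr * Num.sqrt (L + v)).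
have gam0 : 0 <= gam.
  exact: mulr_ge0 (ler0n R 500) (mulr_ge0 (mulr_ge0 nu0 (ltW Rr0)) (sqrtr_ge0 _)).
rewrite -/gam in small.
set sT := Num.sqrt T%:R in small *.
have TE : T%:R = sT ^+ 2 by rewrite sqr_sqrtr.
have sT0 : 0 < sT by rewrite sqrtr_gt0 ltr0n.
have main h : K h -> `|dv (T := T) A (lcomb B h) (lcomb B h) g|
    <= 130 * (gam * sT / r ^+ 2) + 18 * (gam / r * N).
  move=> Kh; have [pi' hpi'] := snet h Kh.
  apply: (chain_bound r0 r1 hA nu0 Rr0 L1 v_ge0 hB (s := fun k => s k (pi' k))).
  - exact: Kh.
  - by move=> k; exact: sK.
  - exact: s0.
  - exact: hN.
  - by move=> k; have [] := hw k (pi' k, pi' k.+1).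
  - by move=> k; have [] := hw k (pi' k, pi' k.+1).
  - exact: hpi'.
have [e e0 e2000] : exists2 e : R, 0 < e & 2000 * e = 1.
  by exists (2000^-1); [rewrite invr_gt0 ltr0n|apply: divff; rewrite pnatr_eq0].
have [a130 a1300 a130E] : exists2 a : R, 0 <= a & a = 130 by exists 130; [exact: ler0n|].
have [a18 a180 a18E] : exists2 a : R, 0 <= a & a = 18 by exists 18; [exact: ler0n|].
rewrite -a130E -a18E in main.
have small' : gam <= sT * r ^+ 2 * e by rewrite -[gam]mul1r -e2000 mulrAC ler_wpM2r// ltW.
clearbody gam; clear small.
have r2 : 0 < r ^+ 2 by rewrite exprn_gt0.
have h1 : gam * sT / r ^+ 2 <= T%:R * e.
  rewrite ler_pdivrMr// TE.
  have -> : sT ^+ 2 * e * r ^+ 2 = sT * r ^+ 2 * e * sT by ring.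
  by rewrite ler_wpM2r// ltW.
have rle1 : r <= 1 by rewrite /r; lra.
pose n := N * r.
have n0 : 0 <= n by rewrite mulr_ge0// ltW.
have h2 : gam / r * N <= sT * n * e.
  have -> : sT * n * e = (sT * r ^+ 2 * e) / r * N.
    by rewrite /n; field; rewrite gt_eqF.
  by rewrite ler_wpM2r// ler_pM2r ?invr_gt0.
pose b := a130 * (T%:R * e) + a18 * (sT * n * e).
have b0 : 0 <= b.
  have [e0' sT0'] := (ltW e0, ltW sT0).
  exact: addr_ge0 (mulr_ge0 a1300 (mulr_ge0 (ler0n R T) e0'))
    (mulr_ge0 a180 (mulr_ge0 (mulr_ge0 sT0' n0) e0')).
have dvle h : K h -> `|dv (T := T) A (lcomb B h) (lcomb B h) g| <= b.
  by move=> Kh; apply: (le_trans (main h Kh)); apply: lerD; rewrite ler_wpM2l.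
have N2 : N ^+ 2 <= T%:R / r ^+ 2 + b.
  set Y := (X in _ <= X).
  have Y0 : 0 <= Y by rewrite /Y addr_ge0 ?divr_ge0 ?(ltW r2).
  suff : N <= Num.sqrt Y.
    by move=> h; rewrite -(sqr_sqrtr Y0) lerXn2r ?nnegrE ?sqrtr_ge0.
  apply: ge_sup; first exact: hD.1.
  move=> _ [h Kh <-]; apply: ler_wsqrtr.
  have := dvle h Kh => /ler_normlP[_]; rewrite /dv.
  have : hsdot (coef (T := T) A (lcomb B h)) (coef A (lcomb B h)) <= T%:R / r ^+ 2.
    rewrite mean_frob; apply: (le_trans (coef_frob _ r0 r1 hA _)).
    by rewrite ler_piMr ?divr_ge0 ?sqr_ge0//; exact: Kh.2.
  rewrite /Y; clear; lra.
have nn : n ^+ 2 <= T%:R + b.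
  rewrite /n exprMn; apply: (le_trans (ler_wpM2r (ltW r2) N2)).
  rewrite mulrDl mulfVK ?gt_eqF// lerD2l ler_piMr//.
  by rewrite expr_le1// ltW.
have n2000 : 2000 != 0 :> R by rewrite pnatr_eq0.
have eE : e = 2000^-1 by apply: (mulfI n2000); rewrite e2000 divff.
(* 130 / 2000 and 18 / 2000. The inequality [nn] then forces [n <= 2 * sT], whence [b] is at most
   (65 + 18) / 1000 of T, below T / 6. *)
have bE : b = 65 / 1000 * sT ^+ 2 + 9 / 1000 * (sT * n).
  by rewrite /b a130E a18E TE eE; field.
have nsT : n <= 2 * sT.
  rewrite leNgt; apply/negP => hgt; rewrite bE TE in nn.
  have a1 : 0 < (n - 2 * sT) * n by rewrite mulr_gt0 ?subr_gt0//; lra.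
  have a2 : 0 < (n - 2 * sT) * sT by rewrite mulr_gt0 ?subr_gt0.
  have a3 : 0 < sT * sT by rewrite mulr_gt0.
  move: a1 a2 a3 nn; rewrite !expr2; clear; lra.
apply: (le_trans (dvle u Ku)); rewrite bE TE.
have := ler_wpM2l (ltW sT0) nsT; have : 0 < sT ^+ 2 by rewrite exprn_gt0.
rewrite !expr2; clear; lra.
Qed.

End ChainProbability.

(** * Probabilistic estimates *)

Section LinearEvents.
Local Open Scope classical_set_scope.
Variables (R : realType) (d T m : nat) (A : 'I_m -> 'M[R]_d).
Notation J := ('I_m * 'I_T.+1 * 'I_d)%type.
Variable rho : R.
Hypotheses (r0 : 0 <= rho) (r1 : rho < 1).
Hypothesis hA : forall l, mx_op_le (A l) rho.
Variables (disp : measure_display) (Omega : measurableType disp).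
Variable P : probability Omega R.
Variable X : J -> {RV P >-> R}.
Hypothesis gX : gaussian_family X.
Let Xw w (i : J) : R := X i w.

(** Picks coordinate [a] of each state with weight [c l]; weighted empirical moments become products
    of such linear forms. *)
Definition hrow (c : 'I_m -> R) (a : 'I_d) (l : 'I_m) : 'M[R]_(1, d) :=
  c l *: delta_mx 0 a.

Lemma hrow_mul c a l (M : 'M[R]_d) i j : (hrow c a l *m M) i j = c l * M a j.
Proof.
rewrite /hrow -scalemxAl mxE; congr (_ * _); rewrite mxE (bigD1 a)//= big1 ?addr0.
  by rewrite mxE ord1 !eqxx mul1r.
by move=> k /negbTE ka; rewrite mxE ka andbF mul0r.
Qed.

Lemma hrow_mulv c a l (x : 'cV[R]_d) i j : (hrow c a l *m x) i j = c l * x a 0.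
Proof.
rewrite /hrow -scalemxAl mxE; congr (_ * _); rewrite mxE (bigD1 a)//= big1 ?addr0.
  by rewrite mxE !ord1 !eqxx mul1r.
by move=> k /negbTE ka; rewrite mxE ka andbF mul0r.
Qed.

Lemma fsq_hrow c a l : fsq (hrow c a l) = c l ^+ 2.
Proof.
rewrite /fsq big_ord1 (bigD1 a)//= big1 ?addr0; first by rewrite !mxE !eqxx mulr1.
by move=> k /negbTE ka; rewrite !mxE ka andbF mulr0 expr0n.
Qed.

(* the noise entering one step after the state it multiplies *)
Definition noise_coef (b : 'I_d) (o : 'I_m * 'I_T * 'I_1) (i : J) : R :=
  (i == (o.1.1, lift ord0 o.1.2, b))%:R.

Lemma lin_noise_coef b o g : lin (noise_coef b o) g = g (o.1.1, lift ord0 o.1.2, b).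
Proof.
rewrite /lin (bigD1 (o.1.1, lift ord0 o.1.2, b))//= /noise_coef eqxx mul1r.
by rewrite big1 ?addr0// => i /negbTE ->; rewrite mul0r.
Qed.

Lemma noise_coef_op b : op_bound (noise_coef b) 1.
Proof.
move=> g; rewrite expr1n mul1r sum_triple [leRHS]sum_triple; apply: ler_sum => l _.
rewrite [leRHS]big_ord_recl; apply: ler_wpDl.
  by apply: sumr_ge0 => j _; exact: sqr_ge0.
apply: ler_sum => t _; rewrite big_ord1 lin_noise_coef /= (bigD1 b)//= lerDl.
by apply: sumr_ge0 => j _; exact: sqr_ge0.
Qed.

(** Causality: the noise index t + 1 exceeds every index that enters the state of row t. *)
Lemma noise_coef_mean b (H : 'I_m -> 'M[R]_(1, d)) :
  hsdot (noise_coef b) (coef (T := T) A H) = 0.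
Proof.
apply: big1 => -[[l t] z] _; apply: big1 => i _; rewrite /noise_coef /=.
have [->|_] := eqVneq i; last by rewrite mul0r.
by rewrite /coef /= /bump add1n ltnn andbF mulr0.
Qed.

Lemma le_mul_sqrt (y : R) : 1 <= y -> Num.sqrt y <= y.
Proof.
move=> y1; have y0 : 0 <= y by apply: le_trans y1.
rewrite -[leRHS](sqr_sqrtr y0) expr2 ler_peMr ?sqrtr_ge0//.
by rewrite -[X in X <= _]sqrtr1 ler_wsqrtr.
Qed.

(** [1 <= y] and [1 <= Num.sqrt T%:R] merge the two terms of Hanson-Wright, whence 64 = 32 + 32. *)
Lemma noise_event (c : 'I_m -> R) (s : R) (a b : 'I_d) (y : R) :
  (0 < T)%N -> 0 <= s -> \sum_l c l ^+ 2 <= s ^+ 2 -> 1 <= y ->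
  whp P (2 * expR (- y)) (fun w =>
    `|\sum_l c l * \sum_(t < T) Xw w (l, lift ord0 t, b) * state A (Xw w) l t.+1 a 0|
    <= 64 * (s * Num.sqrt T%:R / (1 - rho) * y)).
Proof.
move=> T0 s0 hc y1; have y0 : 0 < y by apply: lt_le_trans y1.
have rp : 0 < 1 - rho by rewrite subr_gt0.
have sT1 : 1 <= Num.sqrt T%:R :> R.
  by rewrite -[X in X <= _]sqrtr1 ler_wsqrtr// ler1n.
have sr0 : 0 <= s / (1 - rho) by rewrite divr_ge0// ltW.
have opc : op_bound (coef (T := T) A (hrow c a)) (s / (1 - rho)).
  apply: coef_op_bound => // l; rewrite fsq_hrow; apply: le_trans hc.
  by rewrite (bigD1 l)//= lerDl sumr_ge0// => ? _; exact: sqr_ge0.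
have F0 : 0 <= s * Num.sqrt T%:R / (1 - rho).
  by rewrite divr_ge0 ?mulr_ge0 ?sqrtr_ge0// ltW.
have frc : \sum_o \sum_i coef (T := T) A (hrow c a) o i ^+ 2
    <= (s * Num.sqrt T%:R / (1 - rho)) ^+ 2.
  apply: (le_trans (coef_frob _ r0 r1 hA _)).
  rewrite expr_div_n exprMn sqr_sqrtr// mulrAC ler_pM2r ?invr_gt0 ?exprn_gt0//.
  rewrite mulrC ler_wpM2r//.
  by under eq_bigr => l _ do rewrite fsq_hrow.
have := hanson_wright gX ler01 sr0 F0 y0 (noise_coef_op b) opc frc.
apply: whp_sub => // w; rewrite noise_coef_mean subr0.
rewrite (_ : \sum_o _ = \sum_l c l * \sum_(t < T)
    Xw w (l, lift ord0 t, b) * state A (Xw w) l t.+1 a 0); last first.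
  rewrite sum_triple; apply: eq_bigr => l _; rewrite mulr_sumr; apply: eq_bigr => t _.
  by rewrite big_ord1 lin_noise_coef lin_coef hrow_mulv /Xw /=; ring.
move=> h; apply: (le_trans h); rewrite !mul1r.
have h1 : s * Num.sqrt T%:R / (1 - rho) * Num.sqrt y <= s * Num.sqrt T%:R / (1 - rho) * y.
  by rewrite ler_wpM2l// le_mul_sqrt.
have h2 : s / (1 - rho) * y <= s * Num.sqrt T%:R / (1 - rho) * y.
  rewrite ler_wpM2r ?(ltW y0)// ler_pM2r ?invr_gt0// ler_peMr//.
by lra.
Qed.

Definition second_moment (g : J -> R) l (a b : 'I_d) : R :=
  \sum_(t < T) state A g l t.+1 a 0 * state A g l t.+1 b 0.

Lemma gramian_mean (c : 'I_m -> R) a b :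
  hsdot (coef (T := T) A (hrow (fun=> 1) a)) (coef A (hrow c b))
  = \sum_l c l * gramian T (A l) a b.
Proof.
rewrite hsdot_coef; apply: eq_bigr => l _.
rewrite /gramian summxE big_add1 /= big_mkord mulr_sumr; apply: eq_bigr => t _.
rewrite /Gamma summxE big_mkord mulr_sumr; apply: eq_bigr => k _.
rewrite /fdot big_ord1 mxE mulr_sumr; apply: eq_bigr => j _.
by rewrite !hrow_mul mxE mul1r; ring.
Qed.

Lemma second_moment_event (c : 'I_m -> R) (s : R) (a b : 'I_d) (y : R) :
  (0 < T)%N -> 0 <= s -> \sum_l c l ^+ 2 <= s ^+ 2 -> 1 <= y ->
  whp P (2 * expR (- y)) (fun w =>
    `|\sum_l c l * second_moment (Xw w) l a b - \sum_l c l * gramian T (A l) a b|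
    <= 64 * (s * Num.sqrt T%:R / (1 - rho) ^+ 2 * y)).
Proof.
move=> T0 s0 hc y1; have y0 : 0 < y by apply: lt_le_trans y1.
have rp : 0 < 1 - rho by rewrite subr_gt0.
have sT1 : 1 <= Num.sqrt T%:R :> R.
  by rewrite -[X in X <= _]sqrtr1 ler_wsqrtr// ler1n.
have sr0 : 0 <= s / (1 - rho) by rewrite divr_ge0// ltW.
have ir0 : 0 <= 1 / (1 - rho) by rewrite divr_ge0// ltW.
have opc : op_bound (coef (T := T) A (hrow c b)) (s / (1 - rho)).
  apply: coef_op_bound => // l; rewrite fsq_hrow; apply: le_trans hc.
  by rewrite (bigD1 l)//= lerDl sumr_ge0// => ? _; exact: sqr_ge0.
have op1 : op_bound (coef (T := T) A (hrow (fun=> 1) a)) (1 / (1 - rho)).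
  by apply: coef_op_bound => // l; rewrite fsq_hrow.
have F0 : 0 <= s * Num.sqrt T%:R / (1 - rho).
  by rewrite divr_ge0 ?mulr_ge0 ?sqrtr_ge0// ltW.
have frc : \sum_o \sum_i coef (T := T) A (hrow c b) o i ^+ 2
    <= (s * Num.sqrt T%:R / (1 - rho)) ^+ 2.
  apply: (le_trans (coef_frob _ r0 r1 hA _)).
  rewrite expr_div_n exprMn sqr_sqrtr// mulrAC ler_pM2r ?invr_gt0 ?exprn_gt0//.
  rewrite mulrC ler_wpM2r//.
  by under eq_bigr => l _ do rewrite fsq_hrow.
have := hanson_wright gX ir0 sr0 F0 y0 op1 opc frc.
apply: whp_sub => // w; rewrite gramian_mean.
rewrite (_ : \sum_o _ = \sum_l c l * second_moment (Xw w) l a b); last first.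
  rewrite sum_triple; apply: eq_bigr => l _; rewrite mulr_sumr; apply: eq_bigr => t _.
  by rewrite big_ord1 !lin_coef !hrow_mulv /Xw /=; ring.
move=> h; apply: (le_trans h).
set i := 1 / (1 - rho) in ir0 *.
have -> : s * Num.sqrt T%:R / (1 - rho) ^+ 2 * y = i * (s * Num.sqrt T%:R / (1 - rho)) * y.
  by rewrite /i; field; rewrite gt_eqF.
have h1 : i * (s * Num.sqrt T%:R / (1 - rho)) * Num.sqrt y
    <= i * (s * Num.sqrt T%:R / (1 - rho)) * y.
  by apply: ler_wpM2l; [exact: mulr_ge0|exact: le_mul_sqrt].
have h2 : i * (s / (1 - rho)) * y <= i * (s * Num.sqrt T%:R / (1 - rho)) * y.
  rewrite ler_wpM2r ?(ltW y0)// ler_wpM2l// ler_pM2r ?invr_gt0// ler_peMr//.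
by lra.
Qed.

End LinearEvents.

Section RowsAndScaling.
Variables (R : realType) (d T m : nat) (A : 'I_m -> 'M[R]_d).
Notation J := ('I_m * 'I_T.+1 * 'I_d)%type.

Lemma dv_scale q (H : 'I_m -> 'M[R]_(q, d)) c (g : J -> R) :
  dv A (fun l => c *: H l) (fun l => c *: H l) g = c ^+ 2 * dv A H H g.
Proof. by rewrite dvZ dvC dvZ mulrA expr2. Qed.

(** The design tensors the data with an identity, so the rows of a block never mix and a
    d^2-dimensional problem becomes [d] problems of dimension [d]. *)
Lemma dv_rows q (H : 'I_m -> 'M[R]_(q, d)) (g : J -> R) :
  dv A H H g = \sum_b dv A (fun l => row b (H l)) (fun l => row b (H l)) g.
Proof.
have cE l t b (i : J) : coef A H (l, t, b) i = coef A (fun l => row b (H l)) (l, t, ord0) i.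
  by rewrite /coef /=; case: ifP => // _; rewrite -row_mul [RHS]mxE.
have reorder (F : 'I_m * 'I_T * 'I_q -> R) (G : 'I_q -> 'I_m * 'I_T * 'I_1 -> R) :
    (forall l t b, F (l, t, b) = G b (l, t, ord0)) -> \sum_o F o = \sum_b \sum_o G b o.
  move=> FG; under [RHS]eq_bigr => b _ do rewrite sum_triple.
  rewrite sum_triple [RHS]exchange_big /=; apply: eq_bigr => l _.
  rewrite [RHS]exchange_big /=; apply: eq_bigr => t _; apply: eq_bigr => b _.
  by rewrite big_ord1 FG.
rewrite /dv sumrB /ip /hsdot; congr (_ - _).
  apply: (reorder _ (fun b o => lin (coef A (fun l => row b (H l)) o) g
      * lin (coef A (fun l => row b (H l)) o) g)) => l t b.
  by rewrite /lin; congr (_ * _); apply: eq_bigr => i _; rewrite cE.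
apply: (reorder _ (fun b o => \sum_i coef (T := T) A (fun l => row b (H l)) o i
    * coef A (fun l => row b (H l)) o i)) => l t b.
by apply: eq_bigr => i _; rewrite cE.
Qed.

Lemma dv0 q (g : J -> R) : dv A (fun=> 0 : 'M[R]_(q, d)) (fun=> 0) g = 0.
Proof.
rewrite [X in dv A X X](_ : _ = fun l => 0 *: (0 : 'M[R]_(q, d))); last first.
  by apply/funext => l; rewrite scale0r.
by rewrite dv_scale expr0n mul0r.
Qed.

Lemma lcombZ (V : finType) q (B : V -> 'I_m -> 'M[R]_(q, d)) c u :
  lcomb B (fun x => c * u x) = fun l => c *: lcomb B u l.
Proof.
apply/funext => l; rewrite /lcomb scaler_sumr.
by apply: eq_bigr => x _; rewrite scalerA.
Qed.

Lemma fsqZ p q c (M : 'M[R]_(p, q)) : fsq (c *: M) = c ^+ 2 * fsq M.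
Proof.
rewrite /fsq mulr_sumr; apply: eq_bigr => i _; rewrite mulr_sumr.
by apply: eq_bigr => j _; rewrite mxE exprMn.
Qed.

Lemma chain_scaled (V : finType) q (B : V -> 'I_m -> 'M[R]_(q, d)) Rr (C : R) (g : J -> R) :
  (forall u : V -> R, \sum_x `|u x| <= Rr -> \sum_l fsq (lcomb B u l) <= 1 ->
    `|dv A (lcomb B u) (lcomb B u) g| <= C) ->
  forall u h, 0 <= h -> \sum_x `|u x| <= Rr * h -> \sum_l fsq (lcomb B u l) <= h ^+ 2 ->
    `|dv A (lcomb B u) (lcomb B u) g| <= C * h ^+ 2.
Proof.
move=> hK u h h0 hu hF.
have [h_0|hn0] := eqVneq h 0.
  have u0 : u = fun=> 0.
    apply/funext => x; apply/eqP; rewrite -normr_eq0 eq_le normr_ge0 andbT.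
    move: hu; rewrite h_0 mulr0; apply: le_trans.
    by rewrite (bigD1 x)//= lerDl sumr_ge0.
  by rewrite u0 lcomb0 dv0 normr0 h_0 expr0n mulr0.
have hp : 0 < h by rewrite lt_neqAle eq_sym hn0.
pose u' x := h^-1 * u x.
have uE : u = fun x => h * u' x.
  by apply/funext => x; rewrite /u' mulrA divff// mul1r.
rewrite {1 2}uE lcombZ dv_scale normrM ger0_norm ?sqr_ge0// mulrC ler_pM2r ?exprn_gt0//.
apply: hK.
  under eq_bigr => x _ do rewrite /u' normrM gtr0_norm ?invr_gt0//.
  by rewrite -mulr_sumr ler_pdivrMl// mulrC.
rewrite /u' lcombZ; under eq_bigr => l _ do rewrite fsqZ.
by rewrite -mulr_sumr exprVn ler_pdivrMl ?exprn_gt0// mulr1.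
Qed.

End RowsAndScaling.

Section ChainApplications.
Local Open Scope classical_set_scope.
Variables (R : realType) (d T m : nat) (A : 'I_m -> 'M[R]_d).
Notation J := ('I_m * 'I_T.+1 * 'I_d)%type.
Variable rho : R.
Variables (disp : measure_display) (Omega : measurableType disp).
Variable P : probability Omega R.
Variable X : J -> {RV P >-> R}.

(** A row repeated over all systems with weight m^(-1/2) has total Frobenius norm |u|_2, while each
    system sees only the share m^(-1/2): this [nu] is where averaging over systems enters. The
    Euclidean unit ball lies in the l1 ball of radius sqrt d, and one row has only [d] coordinates,
    hence [d + v] with [L = d]. *)
Lemma common_event (v : R) : gaussian_family X -> 0 <= rho -> rho < 1 ->
  (forall l, mx_op_le (A l) rho) -> (0 < T)%N -> (0 < d)%N -> (0 < m)%N -> 0 <= v ->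
  2000 * (500 * ((Num.sqrt m%:R)^-1 * Num.sqrt d%:R * Num.sqrt (d%:R + v)))
    <= Num.sqrt T%:R * (1 - rho) ^+ 2 ->
  whp P (expR (- v)) (fun w => forall M : 'M[R]_d,
    `|dv (T := T) A (fun=> M) (fun=> M) (fun i => X i w)| <= T%:R / 6 * (m%:R * fsq M)).
Proof.
move=> gX r0 r1 hA T0 d0 m0 v_ge0 small.
have smp : 0 < Num.sqrt m%:R :> R by rewrite sqrtr_gt0 ltr0n.
pose B (x : 'I_d) (l : 'I_m) : 'M[R]_(1, d) := (Num.sqrt m%:R)^-1 *: delta_mx 0 x.
have lE u l : lcomb B u l = (Num.sqrt m%:R)^-1 *: \row_x u x.
  apply/matrixP => i x; rewrite /lcomb summxE (bigD1 x)//= big1 ?addr0.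
    by rewrite !mxE ord1 !eqxx /=; ring.
  by move=> y /negbTE yx; rewrite !mxE [x == y]eq_sym yx andbF !mulr0.
have fE u l : fsq (lcomb B u l) = (Num.sqrt m%:R)^-1 ^+ 2 * \sum_x u x ^+ 2.
  by rewrite lE fsqZ /fsq big_ord1; congr (_ * _); apply: eq_bigr => x _; rewrite mxE.
have nu0 : 0 <= (Num.sqrt m%:R)^-1 :> R by rewrite invr_ge0 ltW.
have Rr0 : 0 < Num.sqrt d%:R :> R by rewrite sqrtr_gt0 ltr0n.
have d1 : 1 <= d%:R :> R by rewrite ler1n.
have VL : #|'I_d|%:R <= expR d%:R :> R.
  by rewrite card_ord; apply: le_trans (expR_ge1Dx _); rewrite lerDr.
have hB u l : fsq (lcomb B u l) <= (Num.sqrt m%:R)^-1 ^+ 2 * \sum_x u x ^+ 2 by rewrite fE.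
have := chain_whp (Ordinal d0) gX r0 r1 T0 hA nu0 Rr0 d1 v_ge0 VL hB small.
apply: whp_sub => // w hw M; rewrite dv_rows /fsq mulr_sumr mulr_sumr.
apply: (le_trans (ler_norm_sum _ _ _)); apply: ler_sum => b _.
pose u x := M b x; set S := \sum_j M b j ^+ 2.
have S0 : 0 <= S by apply: sumr_ge0 => x _; exact: sqr_ge0.
have rE : row b M = Num.sqrt m%:R *: lcomb B u (Ordinal m0).
  by rewrite lE scalerA divff ?gt_eqF// scale1r; apply/rowP => x; rewrite !mxE.
have lconst l : lcomb B u l = lcomb B u (Ordinal m0) by rewrite !lE.
have -> : (fun=> row b M) = (fun l : 'I_m => Num.sqrt m%:R *: lcomb B u l).
  by apply/funext => l; rewrite rE lconst.
rewrite dv_scale normrM ger0_norm ?sqr_ge0// sqr_sqrtr// mulrCA ler_pM2l ?ltr0n//.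
have SE : S = Num.sqrt S ^+ 2 by rewrite sqr_sqrtr.
rewrite SE; apply: (chain_scaled hw); first exact: sqrtr_ge0.
  rewrite -sqrtrM// -[leLHS]ger0_norm ?sumr_ge0// -sqrtr_sqr ler_wsqrtr//.
  have := cauchy_schwarz_sum (fun=> 1) (fun x => `|u x|).
  under eq_bigr do rewrite mul1r.
  under [X in _ <= X * _]eq_bigr do rewrite expr1n.
  under [X in _ <= _ * X]eq_bigr do rewrite real_normK ?num_real//.
  by rewrite sumr_const card_ord.
rewrite -SE; under eq_bigr => l _ do rewrite fE.
rewrite sumr_const card_ord -[_ *+ m]mulr_natl mulrA exprVn sqr_sqrtr//.
by rewrite divff ?mul1r// pnatr_eq0 -lt0n.
Qed.

(** Column [e] of the pseudoinverse placed in entry [(b, c)] of the blocks, so that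
    [lcomb (edge_mx Dp) u] is D^+ tensor I applied to [u]. *)
Definition edge_mx n (Dp : 'M[R]_(m, n)) (p : 'I_n * 'I_d * 'I_d) (l : 'I_m) : 'M[R]_d :=
  Dp l p.1.1 *: delta_mx p.1.2 p.2.

Lemma edge_mxE n (Dp : 'M[R]_(m, n)) u l b c :
  lcomb (edge_mx Dp) u l b c = \sum_e Dp l e * u (e, b, c).
Proof.
rewrite /lcomb summxE sum_triple; apply: eq_bigr => e _.
rewrite (bigD1 b)//= (bigD1 c)//= !mxE /= !eqxx mulr1 mulrC.
rewrite big1 ?addr0; last first.
  by move=> j /negbTE jc; rewrite !mxE /= eqxx [c == j]eq_sym jc !mulr0.
rewrite big1 ?addr0// => i /negbTE ib; apply: big1 => j _.
by rewrite !mxE /= [b == i]eq_sym ib !mulr0.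
Qed.

(** A block of the image involves a single row of [Dp], which is why [nu] bounds the row norms. *)
Lemma edge_event n (Dp : 'M[R]_(m, n)) (nu Rr L v : R) : gaussian_family X ->
  0 <= rho -> rho < 1 -> (forall l, mx_op_le (A l) rho) -> (0 < T)%N -> (0 < d)%N ->
  (0 < n)%N -> 0 <= nu -> (forall l, \sum_e Dp l e ^+ 2 <= nu ^+ 2) ->
  0 < Rr -> 1 <= L -> 0 <= v -> (n * d * d)%:R <= expR L ->
  2000 * (500 * (nu * Rr * Num.sqrt (L + v))) <= Num.sqrt T%:R * (1 - rho) ^+ 2 ->
  whp P (expR (- v)) (fun w => forall u h, 0 <= h -> \sum_x `|u x| <= Rr * h ->
    \sum_l fsq (lcomb (edge_mx Dp) u l) <= h ^+ 2 ->
    `|dv (T := T) A (lcomb (edge_mx Dp) u) (lcomb (edge_mx Dp) u) (fun i => X i w)|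
      <= T%:R / 6 * h ^+ 2).
Proof.
move=> gX r0 r1 hA T0 d0 n0 nu0 hnu Rr0 L1 v_ge0 VL small.
have cV : #|{: 'I_n * 'I_d * 'I_d}|%:R <= expR L.
  by rewrite !card_prod !card_ord.
have hB u l : fsq (lcomb (edge_mx Dp) u l) <= nu ^+ 2 * \sum_x u x ^+ 2.
  apply: (@le_trans _ _ (\sum_b \sum_c nu ^+ 2 * \sum_e u (e, b, c) ^+ 2)).
    apply: ler_sum => b _; apply: ler_sum => c _; rewrite edge_mxE.
    apply: (le_trans (cauchy_schwarz_sum _ _)); rewrite ler_wpM2r//.
    by apply: sumr_ge0 => e _; exact: sqr_ge0.
  rewrite [X in _ <= _ * X]sum_triple [X in _ <= _ * X]exchange_big /= mulr_sumr.
  apply: ler_sum => b _.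
  by rewrite [X in _ <= _ * X]exchange_big /= mulr_sumr.
have := chain_whp (Ordinal n0, Ordinal d0, Ordinal d0) gX r0 r1 T0 hA nu0 Rr0 L1 v_ge0 cV hB small.
by apply: whp_sub => // w hw; exact: chain_scaled hw.
Qed.

End ChainApplications.

(** * The deterministic argument *)

Section GraphDecomposition.
Variables (R : realType) (m : nat) (E : {set {set 'I_m}}) (src tgt : 'I_#|E| -> 'I_m).
Variable Dp : 'M[R]_(m, #|E|).
Hypotheses (cE : connected_graph E) (oE : orientation src tgt).
Notation D := (incidence R src tgt).
Hypothesis mpD : is_moore_penrose D Dp.

Lemma incidence_mul (x : 'cV[R]_m) k : (D *m x) k 0 = x (src k) 0 - x (tgt k) 0.
Proof.
rewrite mxE; under eq_bigr => i _ do rewrite mxE mulrBl.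
rewrite sumrB; congr (_ - _).
  rewrite (bigD1 (src k))//= eqxx mul1r big1 ?addr0// => i /negbTE ->.
  by rewrite mul0r.
rewrite (bigD1 (tgt k))//= eqxx mul1r big1 ?addr0// => i /negbTE ->.
by rewrite mul0r.
Qed.

Lemma incidence_ker (x : 'cV[R]_m) : D *m x = 0 -> forall i j, x i 0 = x j 0.
Proof.
move=> Dx0 i j.
have edge a b : [set a; b]%SET \in E -> x a 0 = x b 0.
  move=> abE; move: oE => /setP /(_ [set a; b]%SET); rewrite abE => /imsetP[k _ ekab].
  have xk : x (src k) 0 = x (tgt k) 0.
    by apply/eqP; rewrite -subr_eq0 -incidence_mul Dx0 mxE.
  have : a \in [set src k; tgt k]%SET by rewrite -ekab !inE eqxx.
  have : b \in [set src k; tgt k]%SET by rewrite -ekab !inE eqxx orbT.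
  have : src k \in [set a; b]%SET by rewrite ekab !inE eqxx.
  have : tgt k \in [set a; b]%SET by rewrite ekab !inE eqxx orbT.
  rewrite !inE => /orP[] /eqP t1 /orP[] /eqP t2 /orP[] /eqP t3 /orP[] /eqP t4;
  congruence.
have /connectP[p] := cE i j.
elim: p i => [|y p IH] i /=; first by move=> _ ->.
by move=> /andP[iy py] jE; rewrite (edge _ _ iy); exact: IH.
Qed.

(** D kills the constants; by symmetry of D^+ D the row of ones kills D^+ D, hence also D^+ = D^+ D
    D^+. *)
Lemma pinv_col_sum e : \sum_l Dp l e = 0.
Proof.
case: mpD => _ BAB _ symBA.
have D1 : D *m const_mx 1 = 0 :> 'cV_#|E|.
  by apply/colP => k; rewrite incidence_mul !mxE subrr.
have oneP : (const_mx 1 : 'rV[R]_m) *m (Dp *m D) = 0.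
  by apply: trmx_inj; rewrite trmx_mul symBA trmx_const -mulmxA D1 mulmx0 trmx0.
have : (const_mx 1 : 'rV[R]_m) *m Dp = 0 by rewrite -BAB mulmxA oneP mul0mx.
move=> /rowP /(_ e); rewrite [X in X = _ -> _]mxE [X in _ = X -> _]mxE => e0.
by rewrite -[RHS]e0; apply: eq_bigr => l _; rewrite mxE mul1r.
Qed.

(** x - D^+ D x lies in the kernel of D, which consists of the constants because the graph is
    connected. *)
Lemma graph_split (x : 'I_m -> R) : exists c, forall l,
  x l = c + \sum_e Dp l e * (x (src e) - x (tgt e)).
Proof.
pose X : 'cV[R]_m := \col_l x l.
case: mpD => ABA _ _ _.
have Dy : D *m (X - Dp *m D *m X) = 0 by rewrite mulmxBr !mulmxA ABA subrr.
have cst := incidence_ker Dy.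
case: (posnP m) => [m0|m0].
  by exists 0 => l; have : (0 < m)%N := leq_ltn_trans (leq0n l) (ltn_ord l); lia.
exists ((X - Dp *m D *m X) (Ordinal m0) 0) => l.
have -> : (X - Dp *m D *m X) (Ordinal m0) 0 = x l - \sum_e Dp l e * (x (src e) - x (tgt e)).
  rewrite -(cst l) mxE [X l 0]mxE [X in _ + X]mxE -mulmxA mxE; congr (_ - _).
  by apply: eq_bigr => e _; rewrite incidence_mul !mxE.
by rewrite subrK.
Qed.

Lemma graph_split_mx d (H : 'I_m -> 'M[R]_d) : exists M : 'M[R]_d,
  forall l, H l = M + lcomb (edge_mx Dp) (fun p =>
    H (src p.1.1) p.1.2 p.2 - H (tgt p.1.1) p.1.2 p.2) l.
Proof.
have hc b c := cid (graph_split (fun l => H l b c)).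
exists (\matrix_(b, c) sval (hc b c)) => l; apply/matrixP => b c.
by rewrite !mxE edge_mxE {1}(svalP (hc b c) l).
Qed.

Lemma sum_edge_lcomb d u : \sum_l lcomb (edge_mx (d := d) Dp) u l = 0.
Proof.
apply/matrixP => b c; rewrite summxE mxE.
under eq_bigr => l _ do rewrite edge_mxE.
rewrite exchange_big /=; apply: big1 => e _.
by rewrite -mulr_suml pinv_col_sum mul0r.
Qed.

Lemma fsq_split d (M : 'M[R]_d) (U : 'I_m -> 'M[R]_d) : \sum_l U l = 0 ->
  \sum_l fsq (M + U l) = m%:R * fsq M + \sum_l fsq (U l).
Proof.
move=> U0; have Ubc b c : \sum_l U l b c = 0 by rewrite -summxE U0 mxE.
have e l : fsq (M + U l) = fsq M + fsq (U l) + 2 * \sum_b \sum_c M b c * U l b c.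
  rewrite /fsq mulr_sumr -!big_split /=; apply: eq_bigr => b _.
  rewrite mulr_sumr -!big_split /=; apply: eq_bigr => c _.
  by rewrite mxE; ring.
under eq_bigr => l _ do rewrite e.
rewrite !big_split /= sumr_const card_ord -[_ *+ m]mulr_natl.
rewrite -mulr_sumr.
have -> : \sum_l \sum_b \sum_c M b c * U l b c = 0; last by rewrite mulr0 addr0.
rewrite exchange_big; apply: big1 => b _; rewrite exchange_big; apply: big1 => c _.
by rewrite /= -mulr_sumr Ubc mulr0.
Qed.

End GraphDecomposition.

(** * Coordinates of stacked vectors *)

Section IndexConversions.
Variable R : realType.

Lemma sum_mxtens m n (F : 'I_(m * n) -> R) :
  \sum_k F k = \sum_(i < m) \sum_(j < n) F (mxtens_index (i, j)).
Proof.
rewrite pair_bigA /= (reindex (@mxtens_index m n)) /=; last first.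
  by exists (@mxtens_unindex m n) => k _; rewrite ?mxtens_indexK ?mxtens_unindexK.
by apply: eq_bigr => -[].
Qed.

(** Inverse of [stack] after [vec]; columns are stacked, so the column index comes first. *)
Definition unstack m d (h : 'cV[R]_(m * (d * d))) (l : 'I_m) : 'M[R]_d :=
  \matrix_(i, j) h (mxtens_index (l, mxtens_index (j, i))) 0.

Lemma norm2_sqr n (u : 'cV[R]_n) : norm2 u ^+ 2 = \sum_i u i 0 ^+ 2.
Proof. by rewrite sqr_sqrtr// sumr_ge0// => i _; exact: sqr_ge0. Qed.

Lemma norm2_unstack m d (h : 'cV[R]_(m * (d * d))) :
  norm2 h ^+ 2 = \sum_l fsq (unstack h l).
Proof.
rewrite norm2_sqr sum_mxtens; apply: eq_bigr => l _.
rewrite sum_mxtens exchange_big /=; apply: eq_bigr => i _; apply: eq_bigr => j _.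
by rewrite /unstack mxE.
Qed.

Lemma unstack_stack m d (A : 'I_m -> 'M[R]_d) l :
  unstack (stack (fun l => vec (A l))) l = A l.
Proof. by apply/matrixP => i j; rewrite !mxE !mxtens_indexK. Qed.

Lemma unstackB m d (a b : 'cV[R]_(m * (d * d))) l :
  unstack (a - b) l = unstack a l - unstack b l.
Proof. by apply/matrixP => i j; rewrite !mxE. Qed.

Lemma tens1_mul m d n (D : 'M[R]_(n, m)) (h : 'cV[R]_(m * (d * d))) e j i :
  (tensmx D (1%:M : 'M[R]_(d * d)) *m h) (mxtens_index (e, mxtens_index (j, i))) 0
  = \sum_l D e l * unstack h l i j.
Proof.
rewrite mxE sum_mxtens; apply: eq_bigr => l _.
rewrite (bigD1 (mxtens_index (j, i)))//= big1 ?addr0.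
  by rewrite tensmxE !mxE eqxx mulr1.
move=> k kn; rewrite tensmxE mxE eq_sym (negbTE kn) mulr0 mul0r//.
Qed.

Lemma residual_sqr m d T (x : 'I_m -> nat -> 'cV[R]_d) (a : 'cV[R]_(m * (d * d))) :
  norm2 (response T x - design T x *m a) ^+ 2
  = \sum_l \sum_(t < T) vsq (x l t.+2 - unstack a l *m x l t.+1).
Proof.
rewrite norm2_sqr sum_mxtens; apply: eq_bigr => l _; rewrite sum_mxtens.
apply: eq_bigr => t _; apply: eq_bigr => i _; congr (_ ^+ 2).
rewrite !mxE !mxtens_indexK /=; congr (_ - _).
rewrite sum_mxtens (bigD1 l)//= [X in _ + X]big1 ?addr0; last first.
  move=> l' l'l; apply: big1 => k _; rewrite !mxE !mxtens_indexK /= eq_sym (negbTE l'l).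
  by rewrite mul0r.
rewrite sum_mxtens; apply: eq_bigr => j _; rewrite (bigD1 i)//= big1 ?addr0.
  by rewrite !mxE !mxtens_indexK /= eqxx eqxx mulr1 mulrC.
move=> i' i'i; rewrite !mxE !mxtens_indexK /= eqxx eq_sym (negbTE i'i).
by rewrite mulr0 mul0r.
Qed.

End IndexConversions.

Section Deterministic.
Variables (R : realType) (d T m : nat) (A : 'I_m -> 'M[R]_d).
Notation J := ('I_m * 'I_T.+1 * 'I_d)%type.

(** [lift ord0 t] is index t + 1, the noise of time t + 2, which drives the step out of the state at
    time t + 1. *)
Definition noise_moment (g : J -> R) l (b a : 'I_d) : R :=
  \sum_(t < T) g (l, lift ord0 t, b) * state A g l t.+1 a 0.

Lemma norm_sum_le (I : finType) (x y : I -> R) K :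
  (forall i, `|y i| <= K) -> `|\sum_i x i * y i| <= K * \sum_i `|x i|.
Proof.
move=> hy; rewrite mulr_sumr (le_trans (ler_norm_sum _ _ _))// ler_sum// => i _.
by rewrite normrM mulrC ler_wpM2r.
Qed.

Lemma sum_abs_le_fsq p (M : 'M[R]_p) :
  \sum_i \sum_j `|M i j| <= p%:R * Num.sqrt (fsq M).
Proof.
have S0 : 0 <= \sum_i \sum_j `|M i j|.
  by apply: sumr_ge0 => i _; apply: sumr_ge0 => j _; exact: normr_ge0.
rewrite -[leLHS]ger0_norm// -sqrtr_sqr -[p%:R]ger0_norm// -sqrtr_sqr -sqrtrM ?sqr_ge0//.
apply: ler_wsqrtr; rewrite pair_bigA /=.
have := cauchy_schwarz_sum (fun=> 1) (fun k : 'I_p * 'I_p => `|M k.1 k.2|).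
rewrite /= expr1n sumr_const card_prod card_ord natrM -expr2.
under eq_bigr => k _ do rewrite mul1r.
move=> /le_trans; apply; rewrite /fsq pair_bigA /= ler_wpM2l ?sqr_ge0// ler_sum// => k _.
by rewrite real_normK ?num_real.
Qed.

Lemma ip_second_moment (H H' : 'I_m -> 'M[R]_d) (g : J -> R) :
  ip A H H' g
  = \sum_l \sum_b \sum_a \sum_c H l b a * H' l b c * second_moment A g l a c.
Proof.
rewrite /ip sum_triple; apply: eq_bigr => l _; rewrite exchange_big /=.
apply: eq_bigr => b _; under eq_bigr => t _ do rewrite !lin_coef [X in X * _]mxE [X in _ * X]mxE big_distrlr /=.
rewrite exchange_big /=; apply: eq_bigr => a _.
rewrite exchange_big /=; apply: eq_bigr => c _.
by rewrite /second_moment mulr_sumr; apply: eq_bigr => t _; ring.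
Qed.

Lemma ip_vsq (H : 'I_m -> 'M[R]_d) (g : J -> R) :
  ip A H H g = \sum_l \sum_(t < T) vsq (H l *m state A g l t.+1).
Proof.
rewrite /ip sum_triple; apply: eq_bigr => l _; apply: eq_bigr => t _.
by apply: eq_bigr => b _; rewrite lin_coef expr2.
Qed.

Definition noise_ip (H : 'I_m -> 'M[R]_d) (g : J -> R) : R :=
  \sum_l \sum_b \sum_a H l b a * noise_moment g l b a.

Lemma noise_ipE (H : 'I_m -> 'M[R]_d) (g : J -> R) :
  noise_ip H g = \sum_l \sum_(t < T) \sum_b
    g (l, lift ord0 t, b) * (H l *m state A g l t.+1) b 0.
Proof.
apply: eq_bigr => l _; rewrite [RHS]exchange_big /=; apply: eq_bigr => b _.
under [RHS]eq_bigr => t _ do rewrite mxE mulr_sumr.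
rewrite [RHS]exchange_big /=; apply: eq_bigr => a _.
by rewrite /noise_moment mulr_sumr; apply: eq_bigr => t _; ring.
Qed.

Lemma noise_ipD (H H' : 'I_m -> 'M[R]_d) (g : J -> R) :
  noise_ip (fun l => H l + H' l) g = noise_ip H g + noise_ip H' g.
Proof.
rewrite /noise_ip -big_split /=; apply: eq_bigr => l _.
rewrite -big_split /=; apply: eq_bigr => b _; rewrite -big_split /=.
by apply: eq_bigr => a _; rewrite mxE mulrDl.
Qed.

Lemma noise_ip_lcomb (V : finType) (B : V -> 'I_m -> 'M[R]_d) u (g : J -> R) :
  noise_ip (lcomb B u) g = \sum_x u x * noise_ip (B x) g.
Proof.
under [RHS]eq_bigr => x _ do rewrite mulr_sumr.
rewrite [RHS]exchange_big /=; apply: eq_bigr => l _.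
under [RHS]eq_bigr => x _ do rewrite mulr_sumr.
rewrite [RHS]exchange_big /=; apply: eq_bigr => b _.
under [RHS]eq_bigr => x _ do rewrite mulr_sumr.
rewrite [RHS]exchange_big /=; apply: eq_bigr => a _.
rewrite /lcomb summxE mulr_suml; apply: eq_bigr => x _.
by rewrite mxE mulrA.
Qed.

Lemma ip_lcomb (V : finType) H (B : V -> 'I_m -> 'M[R]_d) u (g : J -> R) :
  ip A H (lcomb B u) g = \sum_x u x * ip A H (B x) g.
Proof.
under [RHS]eq_bigr => x _ do rewrite mulr_sumr.
rewrite [RHS]exchange_big /=; apply: eq_bigr => -[[l t] b] _.
rewrite !lin_coef /lcomb mulmx_suml summxE mulr_sumr; apply: eq_bigr => x _.
by rewrite lin_coef -scalemxAl [X in _ * X = _]mxE; ring.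
Qed.

Section Edges.
Variables (n : nat) (Dp : 'M[R]_(m, n)) (g : J -> R).

Lemma sum_edge_mx p l (F : 'I_d -> 'I_d -> R) :
  \sum_b \sum_c edge_mx Dp p l b c * F b c = Dp l p.1.1 * F p.1.2 p.2.
Proof.
rewrite (bigD1 p.1.2)//= (bigD1 p.2)//= !mxE !eqxx mulr1 big1 ?addr0; last first.
  by move=> c /negbTE cp; rewrite !mxE cp andbF mulr0 mul0r.
rewrite big1 ?addr0// => b /negbTE bp; apply: big1 => c _.
by rewrite !mxE bp mulr0 mul0r.
Qed.

(** Duality of l1 and sup norms in [u]: the coefficient at [(e, b, c)] pairs row [b] of [M] with the
    second moments weighted by column [e] of [Dp]. *)
Lemma ip_cross_le (M : 'M[R]_d) (u : 'I_n * 'I_d * 'I_d -> R) K :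
  (forall e a c, `|\sum_l Dp l e * second_moment A g l a c| <= K) ->
  `|ip A (fun=> M) (lcomb (edge_mx Dp) u) g|
    <= K * (d%:R * Num.sqrt (fsq M)) * \sum_p `|u p|.
Proof.
move=> hK; rewrite ip_lcomb; apply: norm_sum_le => -[[e b] c].
have -> : ip A (fun=> M) (edge_mx Dp (e, b, c)) g
    = \sum_a M b a * \sum_l Dp l e * second_moment A g l a c.
  rewrite ipC ip_second_moment.
  under [RHS]eq_bigr => a _ do rewrite mulr_sumr.
  rewrite [RHS]exchange_big /=; apply: eq_bigr => l _.
  under eq_bigr => b' _ do under eq_bigr => a' _ do
    (under eq_bigr => c' _ do rewrite -mulrA; rewrite -mulr_sumr).
  rewrite (sum_edge_mx _ _ (fun b' a' => \sum_c' M b' c' * second_moment A g l a' c')) /= mulr_sumr; apply: eq_bigr => a _.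
  have -> : second_moment A g l c a = second_moment A g l a c.
    by apply: eq_bigr => t _; rewrite mulrC.
  by ring.
have := norm_sum_le (fun a => M b a) (fun a => hK e a c).
move=> /le_trans; apply; apply: ler_wpM2l.
  exact: le_trans (normr_ge0 _) (hK e b c).
apply: le_trans (sum_abs_le_fsq M); rewrite [leRHS](bigD1 b)//= lerDl.
by apply: sumr_ge0 => i _; apply: sumr_ge0 => j _; exact: normr_ge0.
Qed.

Lemma noise_ip_le (M : 'M[R]_d) (u : 'I_n * 'I_d * 'I_d -> R) N1 N2 :
  (forall b a, `|\sum_l noise_moment g l b a| <= N1) ->
  (forall e b a, `|\sum_l Dp l e * noise_moment g l b a| <= N2) ->
  `|noise_ip (fun l => M + lcomb (edge_mx Dp) u l) g|
    <= N1 * \sum_b \sum_a `|M b a| + N2 * \sum_p `|u p|.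
Proof.
move=> h1 h2; rewrite noise_ipD noise_ip_lcomb; apply: le_trans (ler_normD _ _) _.
apply: lerD; last first.
  by apply: norm_sum_le => -[[e b] c]; rewrite /noise_ip;
    under eq_bigr => l _ do rewrite (sum_edge_mx _ _ (noise_moment g l)).
rewrite /noise_ip exchange_big /=.
under eq_bigr => b _ do (rewrite exchange_big /=; under eq_bigr => a _ do rewrite -mulr_sumr).
rewrite pair_bigA [X in _ * X]pair_bigA /=.
by apply: (norm_sum_le (fun k => M k.1 k.2)) => k.
Qed.

End Edges.
End Deterministic.

(** * Decomposability and compatibility *)

Section L1Analysis.
Variable R : realType.

Lemma norm1_split p (S : {set 'I_p}) (h : 'cV[R]_p) :
  norm1 h = norm1_on S h + norm1_on (~: S)%SET h.
Proof.
rewrite /norm1 (bigID (mem S)) /=; congr (_ + _).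
by apply: eq_bigl => i; rewrite inE.
Qed.

Lemma norm1_on_ge0 p (S : {set 'I_p}) (h : 'cV[R]_p) : 0 <= norm1_on S h.
Proof. by apply: sumr_ge0 => i _; exact: normr_ge0. Qed.

Lemma norm1_decomposable p (S : {set 'I_p}) (a h : 'cV[R]_p) :
  norm1 a - norm1 (a + h)
  <= norm1_on S h - norm1_on (~: S)%SET h + 2 * norm1_on (~: S)%SET a.
Proof.
rewrite !(norm1_split S).
have h1 : norm1_on S a <= norm1_on S (a + h) + norm1_on S h.
  rewrite -big_split /= ler_sum// => i _; rewrite mxE.
  by have := ler_normB (a i 0 + h i 0) (h i 0); rewrite addrK.
have h2 : norm1_on (~: S)%SET h <= norm1_on (~: S)%SET (a + h) + norm1_on (~: S)%SET a.
  rewrite -big_split /= ler_sum// => i _; rewrite mxE.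
  by have := ler_normB (a i 0 + h i 0) (a i 0); rewrite addrAC subrr add0r.
lra.
Qed.

Lemma norm2_ge0 n (u : 'cV[R]_n) : 0 <= norm2 u.
Proof. exact: sqrtr_ge0. Qed.

Lemma ler_norm2 n (u : 'cV[R]_n) i : `|u i 0| <= norm2 u.
Proof.
rewrite -sqrtr_sqr; apply: ler_wsqrtr; rewrite (bigD1 i)//= lerDl.
by apply: sumr_ge0 => j _; exact: sqr_ge0.
Qed.

(* [c] is any bound on the coordinates of [W u]; it only serves to show that the
   infimum defining the compatibility factor is positive. *)
Lemma compatibility_le p n (W : 'M[R]_(p, n)) (S : {set 'I_p}) c u : 0 < c ->
  (forall u k, `|(W *m u) k 0| <= c * norm2 u) ->
  norm1_on S (W *m u) <= Num.sqrt #|S|%:R / compatibility W S * norm2 u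
  /\ 0 <= Num.sqrt #|S|%:R / compatibility W S.
Proof.
move=> c0 hc; rewrite /compatibility; case: ifPn => [/eqP -> | S0].
  by rewrite /norm1_on big_set0 cards0 sqrtr0 !mul0r.
set X := [set _ | _ in _]%classic.
have lb : lbound X 0.
  move=> _ [w _ <-]; apply: mulr_ge0; first by apply: mulr_ge0; rewrite ?sqrtr_ge0 ?norm2_ge0.
  by rewrite invr_ge0 norm1_on_ge0.
have X0 : 0 <= inf X.
  have [Xe|Xn] := pselect (X !=set0)%classic; first exact: lb_le_inf.
  (* The infimum of the empty set is 0 by convention. *)
  by rewrite inf_out// => -[].
split; last by rewrite divr_ge0// sqrtr_ge0.
have [z|nz] := eqVneq (norm1_on S (W *m u)) 0.
  by rewrite z mulr_ge0 ?divr_ge0 ?sqrtr_ge0 ?norm2_ge0.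
have np : 0 < norm1_on S (W *m u) by rewrite lt_neqAle eq_sym nz norm1_on_ge0.
have cS : 0 < #|S|%:R :> R by rewrite ltr0n card_gt0.
have sS : 0 < Num.sqrt #|S|%:R :> R by rewrite sqrtr_gt0.
have bound w : norm1_on S (W *m w) <= #|S|%:R * c * norm2 w.
  rewrite -mulrA mulr_natl -sumr_const; apply: ler_sum => k _; exact: hc.
have Xp : 0 < inf X.
  apply: (@lt_le_trans _ _ (Num.sqrt #|S|%:R / (#|S|%:R * c))).
    by rewrite divr_gt0// mulr_gt0.
  apply: lb_le_inf; first by exists (Num.sqrt #|S|%:R * norm2 u / norm1_on S (W *m u)), u.
  move=> _ [w wn <-].
  have wp : 0 < norm1_on S (W *m w) by rewrite lt_neqAle eq_sym wn norm1_on_ge0.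
  rewrite ler_pdivlMr// mulrAC ler_pdivrMr; last by rewrite mulr_gt0.
  by rewrite -mulrA ler_pM2l// mulrC; exact: bound.
have : inf X <= Num.sqrt #|S|%:R * norm2 u / norm1_on S (W *m u).
  by apply: ge_inf; [exists 0 | exists u].
by rewrite ler_pdivlMr// => h; rewrite mulrAC ler_pdivlMr// mulrC.
Qed.

End L1Analysis.

Section RestrictedEigenvalue.
Variables (R : realType) (d T m n : nat) (A : 'I_m -> 'M[R]_d) (Dp : 'M[R]_(m, n)).
Notation J := ('I_m * 'I_T.+1 * 'I_d)%type.
Hypothesis m0 : (0 < m)%N.

(** In the expanded square the means give at least T |h|^2, while the two quadratic deviations and
    twice the cross term cost at most T / 6 each. *)
Lemma restricted_eigenvalue (g : J -> R) (M : 'M[R]_d) u hh Rr K :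
  let U := lcomb (edge_mx Dp) u in
  0 <= hh -> 0 <= K -> m%:R * fsq M + \sum_l fsq (U l) = hh ^+ 2 ->
  \sum_p `|u p| <= Rr * hh ->
  `|dv A (fun=> M) (fun=> M) g| <= T%:R / 6 * (m%:R * fsq M) ->
  `|dv A U U g| <= T%:R / 6 * hh ^+ 2 ->
  (forall e a c, `|\sum_l Dp l e * second_moment A g l a c| <= K) ->
  12 * (K * d%:R * Rr) <= T%:R * Num.sqrt m%:R ->
  T%:R / 2 * hh ^+ 2 <= ip A (fun l => M + U l) (fun l => M + U l) g.
Proof.
move=> U hh0 K0 split hu dM dU hK small.
have mp : 0 < m%:R :> R by rewrite ltr0n.
have T0 : 0 <= T%:R :> R := ler0n R T.
have UU0 : 0 <= \sum_l fsq (U l) by apply: sumr_ge0 => l _; exact: fsq_ge0.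
have MM0 : 0 <= m%:R * fsq M by rewrite mulr_ge0 ?fsq_ge0// ltW.
have sf : Num.sqrt m%:R * Num.sqrt (fsq M) <= hh.
  rewrite -sqrtrM ?ler0n// -[hh]ger0_norm// -sqrtr_sqr; apply: ler_wsqrtr; lra.
have cross : `|ip A (fun=> M) U g| <= T%:R / 12 * hh ^+ 2.
  apply: le_trans (ip_cross_le M u hK) _.
  set f := Num.sqrt (fsq M) in sf *; have f0 : 0 <= f := sqrtr_ge0 _.
  apply: (@le_trans _ _ (K * (d%:R * f) * (Rr * hh))).
    by apply: ler_wpM2l => //; rewrite mulr_ge0// mulr_ge0.
  have h1 : 12 * (K * d%:R * Rr) * (f * hh) <= T%:R * Num.sqrt m%:R * (f * hh).
    by apply: ler_wpM2r => //; exact: mulr_ge0.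
  have h2 : T%:R * hh * (Num.sqrt m%:R * f) <= T%:R * hh * hh.
    by apply: ler_wpM2l => //; exact: mulr_ge0.
  rewrite expr2; lra.
have iM : T%:R * (m%:R * fsq M) - T%:R / 6 * (m%:R * fsq M) <= ip A (fun=> M) (fun=> M) g.
  have := coef_mean_ge T A (fun=> M); rewrite sumr_const card_ord -[_ *+ m]mulr_natl => h.
  move: dM; rewrite /dv ler_norml => /andP[]; lra.
have iU : T%:R * \sum_l fsq (U l) - T%:R / 6 * hh ^+ 2 <= ip A U U g.
  have h := coef_mean_ge T A U.
  move: dU; rewrite /dv ler_norml => /andP[]; lra.
rewrite ipD [ip _ _ _ _ in leRHS]ipC ipD [X in _ <= _ + X]ipC ipD.
rewrite [ip A U (fun=> M) g]ipC.
move: cross; rewrite ler_norml => /andP[c1 _].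
have : T%:R * (m%:R * fsq M) + T%:R * \sum_l fsq (U l) = T%:R * hh ^+ 2 by rewrite -mulrDr split.
have : T%:R * (m%:R * fsq M) <= T%:R * hh ^+ 2 by apply: ler_wpM2l => //; lra.
lra.
Qed.

End RestrictedEigenvalue.

Section BasicInequality.
Variables (R : realType) (d T m : nat) (A : 'I_m -> 'M[R]_d).
Notation J := ('I_m * 'I_T.+1 * 'I_d)%type.
Variables (g : J -> R) (x : 'I_m -> nat -> 'cV[R]_d).
Hypothesis xE : forall l t, (t <= T.+1)%N -> x l t = state A g l t.

Lemma vsqB k (e u : 'cV[R]_k) :
  vsq (e - u) = vsq e - 2 * (\sum_i e i 0 * u i 0) + vsq u.
Proof.
rewrite /vsq mulr_sumr -sumrB -big_split /=; apply: eq_bigr => i _.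
by rewrite !mxE; ring.
Qed.

Lemma stateS l (t : 'I_T) :
  state A g l t.+2 - A l *m state A g l t.+1 = \col_j g (l, lift ord0 t, j).
Proof.
rewrite {1}/state /= addrAC subrr add0r; apply/colP => j; rewrite !mxE.
by congr (g (_, _, _)); apply: val_inj; rewrite /= inordK// ltnS.
Qed.

Lemma basic_inequality p (W : 'M[R]_(p, m * (d * d))) (lambda : R) (a : 'cV[R]_(m * (d * d))) :
  (0 < m)%N ->
  let astar := stack (fun l => vec (A l)) in
  let H := unstack (a - astar) in
  objective T W lambda x a <= objective T W lambda x astar ->
  ip A H H g <= 2 * noise_ip A H g
    + 2 * m%:R * (lambda * (norm1 (W *m astar) - norm1 (W *m a))).
Proof.
move=> m0 astar H; have mp : 0 < m%:R :> R by rewrite ltr0n.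
(* The squared noise occurs in both objectives and cancels. *)
pose V := \sum_l \sum_(t < T) vsq (\col_j g (l, lift ord0 t, j) : 'cV[R]_d).
have -> : objective T W lambda x astar = (2 * m%:R)^-1 * V + lambda * norm1 (W *m astar).
  rewrite /objective residual_sqr; congr (_ * _ + _).
  apply: eq_bigr => l _; apply: eq_bigr => t _.
  by rewrite unstack_stack !xE ?stateS// ?ltnS// ltnW.
have -> : objective T W lambda x a = (2 * m%:R)^-1 * (V - 2 * noise_ip A H g + ip A H H g)
    + lambda * norm1 (W *m a).
  rewrite /objective residual_sqr; congr (_ * _ + _).
  rewrite ip_vsq noise_ipE mulr_sumr -sumrB -big_split /=; apply: eq_bigr => l _.
  rewrite mulr_sumr -sumrB -big_split /=; apply: eq_bigr => t _.
  rewrite !xE ?ltnS// 1?ltnW//.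
  have -> : unstack a l = A l + H l by rewrite /H unstackB unstack_stack addrC subrK.
  rewrite mulmxDl opprD addrA stateS vsqB; congr (_ - 2 * _ + _).
  by apply: eq_bigr => i _; rewrite mxE.
set N := noise_ip _ _ _; set I := ip _ _ _ _; set n1 := norm1 _; set n2 := norm1 _.
move=> h; have : 2 * m%:R * ((2 * m%:R)^-1 * (V - 2 * N + I) + lambda * n1)
    <= 2 * m%:R * ((2 * m%:R)^-1 * V + lambda * n2).
  by apply: ler_wpM2l; [rewrite mulr_ge0// ltW | exact: h].
have k0 : 2 * m%:R != 0 :> R by rewrite mulf_neq0// ?lt0r_neq0.
by rewrite !mulrDr !mulrA mulfV// !mul1r; lra.
Qed.

End BasicInequality.

Section DeterministicBound.
Variables (R : realType) (d T m : nat) (E : {set {set 'I_m}}) (src tgt : 'I_#|E| -> 'I_m).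
Variables (Dp : 'M[R]_(m, #|E|)) (A : 'I_m -> 'M[R]_d).
Notation J := ('I_m * 'I_T.+1 * 'I_d)%type.
Notation Dt := (tensmx (incidence R src tgt) (1%:M : 'M[R]_(d * d))).

Definition edge_diff (h : 'cV[R]_(m * (d * d))) (p : 'I_#|E| * 'I_d * 'I_d) : R :=
  unstack h (src p.1.1) p.1.2 p.2 - unstack h (tgt p.1.1) p.1.2 p.2.

Lemma incidence_tens (h : 'cV[R]_(m * (d * d))) e i j :
  (Dt *m h) (mxtens_index (e, mxtens_index (j, i))) 0 = edge_diff h (e, i, j).
Proof.
transitivity ((incidence R src tgt *m \col_l unstack h l i j) e 0).
  by rewrite tens1_mul [RHS]mxE; apply: eq_bigr => l _; congr (_ * _); rewrite [RHS]mxE.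
by rewrite incidence_mul; congr (_ - _); rewrite [LHS]mxE.
Qed.

Lemma norm1_incidence (h : 'cV[R]_(m * (d * d))) :
  norm1 (Dt *m h) = \sum_p `|edge_diff h p|.
Proof.
rewrite sum_triple /norm1 sum_mxtens; apply: eq_bigr => e _.
rewrite sum_mxtens exchange_big /=; apply: eq_bigr => i _; apply: eq_bigr => j _.
by rewrite incidence_tens.
Qed.

Lemma incidence_coord_le (h : 'cV[R]_(m * (d * d))) k : `|(Dt *m h) k 0| <= 2 * norm2 h.
Proof.
rewrite -(mxtens_unindexK k); case: (mxtens_unindex k) => e q.
rewrite -(mxtens_unindexK q); case: (mxtens_unindex q) => j i.
rewrite incidence_tens /edge_diff /unstack !mxE (le_trans (ler_normB _ _))//.
by rewrite mulr_natl mulr2n lerD// ler_norm2.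
Qed.

Lemma le_of_quadratic (h p q : R) : 0 <= p -> 0 <= q -> h ^+ 2 <= p * h + q ->
  h <= p + Num.sqrt q.
Proof.
move=> p0 q0 le; rewrite leNgt; apply/negP => lt.
have s0 := sqrtr_ge0 q; have sq := sqr_sqrtr q0.
by rewrite -sq in le; nra.
Qed.

Hypotheses (cE : connected_graph E) (oE : orientation src tgt).
Hypothesis mpD : is_moore_penrose (incidence R src tgt) Dp.
Variables (g : J -> R) (x : 'I_m -> nat -> 'cV[R]_d).
Hypothesis xE : forall l t, (t <= T.+1)%N -> x l t = state A g l t.
Hypotheses (m0 : (0 < m)%N) (T0 : (0 < T)%N).

Lemma deterministic_bound (S : {set 'I_(#|E| * (d * d))}) (lambda N1 N2 K : R) a :
  let astar := stack (fun l => vec (A l)) in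
  let s := Num.sqrt #|S|%:R / compatibility Dt S in
  let bias := norm1_on (~: S)%SET (Dt *m astar) in
  let Phi := 1 + s + Num.sqrt T%:R * bias in
  0 < lambda -> 0 <= N1 -> 0 <= K ->
  (forall M : 'M[R]_d, `|dv A (fun=> M) (fun=> M) g| <= T%:R / 6 * (m%:R * fsq M)) ->
  (forall u h, 0 <= h -> \sum_p `|u p| <= 4 * Phi * h ->
    \sum_l fsq (lcomb (edge_mx Dp) u l) <= h ^+ 2 ->
    `|dv A (lcomb (edge_mx Dp) u) (lcomb (edge_mx Dp) u) g| <= T%:R / 6 * h ^+ 2) ->
  (forall e b c, `|\sum_l Dp l e * second_moment A g l b c| <= K) ->
  12 * (K * d%:R * (4 * Phi)) <= T%:R * Num.sqrt m%:R ->
  (forall b c, `|\sum_l noise_moment A g l b c| <= N1) ->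
  (forall e b c, `|\sum_l Dp l e * noise_moment A g l b c| <= N2) ->
  2 * (N1 * d%:R) <= m%:R * lambda * Num.sqrt m%:R ->
  2 * N2 <= m%:R * lambda ->
  objective T Dt lambda x a <= objective T Dt lambda x astar ->
  norm2 (a - astar)
    <= 2 * m%:R * lambda / T%:R * (1 + 3 * s)
       + Num.sqrt (8 * (m%:R * lambda / T%:R) * bias) + (Num.sqrt T%:R)^-1.
Proof.
move=> astar s bias Phi l0 N10 K0 dvM dvU hK smallK hN1 hN2 sm1 sm2 opt.
set h := a - astar; set hh := norm2 h; set u := edge_diff h.
have hh0 : 0 <= hh := norm2_ge0 h.
have mp : 0 < m%:R :> R by rewrite ltr0n.
have Tp : 0 < T%:R :> R by rewrite ltr0n.
have sTp : 0 < Num.sqrt T%:R :> R by rewrite sqrtr_gt0.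
have b0 : 0 <= bias by exact: norm1_on_ge0.
have [cS s0] := @compatibility_le _ _ _ Dt S 2 h (ltr0Sn R 1) (fun u k => incidence_coord_le u k).
rewrite -/s -/hh in cS s0.
have ml0 : 0 < m%:R * lambda / T%:R by rewrite divr_gt0// mulr_gt0.
set k := m%:R * lambda / T%:R in ml0 *.
have -> : 2 * m%:R * lambda / T%:R = 2 * k by rewrite /k; ring.
have p0 : 0 <= 2 * k * (1 + 3 * s) by rewrite mulr_ge0 ?mulr_ge0// ?ltW//; lra.
have q0 : 0 <= 8 * k * bias by rewrite mulr_ge0// mulr_ge0// ltW.
have [small|large] := lerP hh (Num.sqrt T%:R)^-1.
  by apply: le_trans small _; rewrite lerDr addr_ge0// sqrtr_ge0.
rewrite -[leLHS]addr0 lerD ?invr_ge0 ?sqrtr_ge0//; apply: le_of_quadratic => //.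
have [M HM] := graph_split_mx cE oE mpD (unstack h).
set U := lcomb (edge_mx Dp) u.
have HM' l : unstack h l = M + U l by exact: HM.
have split : m%:R * fsq M + \sum_l fsq (U l) = hh ^+ 2.
  rewrite /hh norm2_unstack; under [RHS]eq_bigr => l _ do rewrite HM'.
  by rewrite fsq_split// /U (sum_edge_lcomb mpD).
have UU0 : 0 <= \sum_l fsq (U l) by apply: sumr_ge0 => l _; exact: fsq_ge0.
have MM0 : 0 <= m%:R * fsq M by rewrite mulr_ge0 ?fsq_ge0// ltW.
have sf : Num.sqrt m%:R * Num.sqrt (fsq M) <= hh.
  rewrite -sqrtrM ?ler0n// -[hh]ger0_norm// -sqrtr_sqr; apply: ler_wsqrtr; lra.
have hu1 : \sum_p `|u p| = norm1_on S (Dt *m h) + norm1_on (~: S)%SET (Dt *m h).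
  by rewrite -norm1_incidence (norm1_split S).
set aS := norm1_on S _ in cS hu1; set aC := norm1_on _ _ in hu1.
have aS0 : 0 <= aS by exact: norm1_on_ge0.
have aC0 : 0 <= aC by exact: norm1_on_ge0.
(* Half of the penalty pays for the noise: twice the noise term is at most m lambda (hh + aS + aC),
   which turns the coefficients 2 and -2 of [aS] and [aC] into 3 and -1. *)
have energy : ip A (unstack h) (unstack h) g
    <= m%:R * lambda * (hh + 3 * aS - aC + 4 * bias).
  have bi := basic_inequality xE m0 opt.
  apply: le_trans bi _.
  have dec : norm1 (Dt *m astar) - norm1 (Dt *m a) <= aS - aC + 2 * bias.
    have -> : Dt *m a = Dt *m astar + Dt *m h by rewrite -mulmxDr /h addrC subrK.
    exact: norm1_decomposable.
  have nz : `|noise_ip A (unstack h) g| <= N1 * (d%:R * Num.sqrt (fsq M)) + N2 * (aS + aC).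
    have -> : unstack h = fun l => M + lcomb (edge_mx Dp) u l by apply/funext => l; exact: HM.
    apply: le_trans (noise_ip_le M u hN1 hN2) _; rewrite hu1 lerD2r.
    by apply: ler_wpM2l => //; exact: sum_abs_le_fsq.
  have n1 : 2 * (N1 * d%:R) * Num.sqrt (fsq M) <= m%:R * lambda * hh.
    apply: (@le_trans _ _ (m%:R * lambda * Num.sqrt m%:R * Num.sqrt (fsq M))).
      by apply: ler_wpM2r => //; exact: sqrtr_ge0.
    by rewrite -mulrA ler_wpM2l// mulr_ge0// ltW.
  have n2 : 2 * N2 * (aS + aC) <= m%:R * lambda * (aS + aC) by rewrite ler_wpM2r// addr_ge0.
  have n3 : 2 * m%:R * (lambda * (norm1 (Dt *m astar) - norm1 (Dt *m a)))
      <= 2 * m%:R * (lambda * (aS - aC + 2 * bias)).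
    by apply: ler_wpM2l; [rewrite mulr_ge0// ltW | apply: ler_wpM2l => //; exact: ltW].
  have := ler_norm (noise_ip A (unstack h) g).
  rewrite -/h => n4; lra.
have ip0 := ip_ge0 A (unstack h) g.
have mlp : 0 < m%:R * lambda by rewrite mulr_gt0.
have cone : aC <= hh + 3 * aS + 4 * bias.
  have := le_trans ip0 energy; rewrite pmulr_rge0//; lra.
(* In this range the additive bias converts into a multiple of [hh]; this is the origin of the
   factor sqrt T in [Phi]. *)
have hT : 1 <= Num.sqrt T%:R * hh.
  by rewrite -[leLHS](mulfV (lt0r_neq0 sTp)) ler_wpM2l ?sqrtr_ge0// ltW.
have bT : bias <= bias * (Num.sqrt T%:R * hh) by rewrite ler_peMr.
have hu : \sum_p `|u p| <= 4 * Phi * hh.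
  rewrite hu1 (_ : 4 * Phi * hh = 4 * hh + 4 * (s * hh) + 4 * (bias * (Num.sqrt T%:R * hh))).
    lra.
  by rewrite /Phi; ring.
have RE : T%:R / 2 * hh ^+ 2 <= ip A (unstack h) (unstack h) g.
  have -> : unstack h = fun l => M + U l by apply/funext => l; exact: HM.
  apply: (restricted_eigenvalue m0 hh0 K0 split hu) => //.
  apply: dvU => //; rewrite -split lerDr//.
have : T%:R / 2 * hh ^+ 2 <= m%:R * lambda * (hh + 3 * (s * hh) + 4 * bias).
  apply: le_trans RE (le_trans energy _); rewrite ler_pM2l//; lra.
have -> : m%:R * lambda = T%:R * k by rewrite /k [RHS]mulrC divfK// lt0r_neq0.
by rewrite -(ler_pM2l Tp (hh ^+ 2)) => fin; clear -fin; lra.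
Qed.

End DeterministicBound.

Section Assembly.
Variable R : realType.

Lemma le_sqrt_mul (a b T : R) : 0 <= T -> 0 <= b -> a ^+ 2 <= T * b ^+ 2 ->
  a <= Num.sqrt T * b.
Proof.
move=> T0 b0 le; apply: le_trans (ler_norm a) _; rewrite -sqrtr_sqr.
rewrite -[b in leRHS]ger0_norm// -sqrtr_sqr -sqrtrM//; exact: ler_wsqrtr.
Qed.

Lemma ln_ge_half (x : R) : 2 <= x -> 2^-1 <= ln x.
Proof.
move=> x2; have x0 : 0 < x by apply: lt_le_trans x2.
have := expR_ge1Dx (- ln x); rewrite expRN lnK ?posrE//.
have : x^-1 <= 2^-1 by rewrite lef_pV2 ?posrE.
lra.
Qed.

(** Level four times the logarithm gives N (delta / q)^4, which absorbs N <= q^4; [delta < 2^-1]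
    then yields 2 delta^4 <= delta / 4, and keeps the logarithm above 1/2. *)
Lemma log_tail (q delta N : R) : 0 < delta -> delta < 2^-1 -> 1 <= q -> N <= q ^+ 4 ->
  2^-1 <= ln (q / delta) /\
  N * (2 * expR (- (4 * ln (q / delta)))) <= delta / 4.
Proof.
move=> d0 d1 q1 Nq; have q0 : 0 < q by apply: lt_le_trans q1.
split.
  apply: ln_ge_half; rewrite ler_pdivlMr//; lra.
rewrite -mulrN (expRM_natl 4) expRN lnK ?posrE ?divr_gt0// invf_div.
apply: (@le_trans _ _ (q ^+ 4 * (2 * (delta / q) ^+ 4))).
  apply: ler_wpM2r => //; apply: mulr_ge0 => //; apply: exprn_ge0.
  by rewrite divr_ge0// ltW.
have -> : q ^+ 4 * (2 * (delta / q) ^+ 4) = 2 * delta ^+ 4.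
  by field; rewrite lt0r_neq0.
have d3 : delta ^+ 3 <= 2^-1 ^+ 3 by apply: lerXn2r; rewrite ?nnegrE ltW.
have -> : 2 * delta ^+ 4 = 2 * (delta ^+ 3 * delta) by rewrite -exprSr.
have : delta ^+ 3 * delta <= 2^-1 ^+ 3 * delta by apply: ler_wpM2r => //; exact: ltW.
lra.
Qed.

(** A supremum dominates its set only if the set is bounded above, which the Frobenius norm ensures;
    [u = 0] gives [0 <= rho]. *)
Lemma spectral_norm_le d (A : 'M[R]_d) rho : spectral_norm A <= rho ->
  0 <= rho /\ mx_op_le A rho.
Proof.
rewrite /spectral_norm; set X := [set _ | _ in _]%classic => hX.
have n2E k (u : 'cV[R]_k) : norm2 u ^+ 2 = vsq u := norm2_sqr u.
have ubX : has_ubound X.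
  exists (Num.sqrt (fsq A)) => _ [u u1 <-]; apply: ler_wsqrtr.
  apply: le_trans (vsq_mulmx_le A u) _; rewrite ler_piMr ?fsq_ge0//.
  by rewrite -n2E expr_le1// norm2_ge0.
have XP u : norm2 u <= 1 -> norm2 (A *m u) <= rho.
  by move=> u1; apply: le_trans hX; apply: ub_le_sup => //; exists u.
split.
  apply: le_trans (norm2_ge0 _) (XP 0 _).
  by rewrite /norm2 big1 ?sqrtr0// => i _; rewrite mxE expr0n.
move=> u; have [u0|un] := eqVneq (vsq u) 0.
  by have := vsq_mulmx_le A u; rewrite u0 !mulr0.
have up : 0 < vsq u by rewrite lt_neqAle eq_sym un vsq_ge0.
have np : 0 < norm2 u by rewrite sqrtr_gt0.
have vZ k (c : R) (w : 'cV[R]_k) : vsq (c *: w) = c ^+ 2 * vsq w.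
  by rewrite /vsq mulr_sumr; apply: eq_bigr => i _; rewrite mxE exprMn.
have h1 : norm2 ((norm2 u)^-1 *: u) <= 1.
  rewrite -(@ler_pXn2r _ 2) ?nnegrE ?norm2_ge0//.
  by rewrite n2E vZ expr1n exprVn n2E mulVf.
have := XP _ h1; rewrite -scalemxAr => h2.
have : norm2 ((norm2 u)^-1 *: (A *m u)) ^+ 2 <= rho ^+ 2.
  by rewrite ler_pXn2r ?nnegrE ?norm2_ge0// (le_trans _ h2) ?norm2_ge0.
by rewrite n2E vZ exprVn n2E mulrC ler_pdivrMr.
Qed.

Lemma col_norm_le p q (B : 'M[R]_(p, q)) j :
  \sum_i B i j ^+ 2 <= max_col_norm B ^+ 2.
Proof.
have h : norm2 (col j B) <= max_col_norm B by apply: le_bigmax.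
have -> : \sum_i B i j ^+ 2 = norm2 (col j B) ^+ 2.
  by rewrite norm2_sqr; apply: eq_bigr => i _; rewrite mxE.
by rewrite ler_pXn2r ?nnegrE ?norm2_ge0// (le_trans _ h) ?norm2_ge0.
Qed.

Lemma row_norm_le p q (B : 'M[R]_(p, q)) i :
  \sum_j B i j ^+ 2 <= max_row_norm B ^+ 2.
Proof.
have h : norm2 (row i B)^T <= max_row_norm B by apply: (le_bigmax _ (fun i => norm2 (row i B)^T)).
have -> : \sum_j B i j ^+ 2 = norm2 (row i B)^T ^+ 2.
  by rewrite norm2_sqr; apply: eq_bigr => j _; rewrite !mxE.
by rewrite ler_pXn2r ?nnegrE ?norm2_ge0// (le_trans _ h) ?norm2_ge0.
Qed.

Lemma max_col_norm_ge0 p q (B : 'M[R]_(p, q)) : 0 <= max_col_norm B.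
Proof. exact: bigmax_ge_id. Qed.

Lemma max_row_norm_ge0 p q (B : 'M[R]_(p, q)) : 0 <= max_row_norm B.
Proof. exact: bigmax_ge_id. Qed.

Lemma edges_gt0 m (E : {set {set 'I_m}}) : (1 < m)%N -> connected_graph E -> (0 < #|E|)%N.
Proof.
case: m E => [//|[//|m]] E _ cE; have /connectP[[|y p]] := cE ord0 ord_max.
  by move=> _ /(congr1 val).
by move=> /= /andP[yE _] _; apply/card_gt0P; exists [set ord0; y]%SET.
Qed.

Lemma traj_ext d (A : 'M[R]_d) (eta eta' : nat -> 'cV[R]_d) t :
  (forall s, (s < t)%N -> eta s.+1 = eta' s.+1) -> traj A eta t = traj A eta' t.
Proof.
elim: t => [//|t IH] h; rewrite /= h// IH// => s st.
by apply: h; apply: ltnW.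
Qed.

Lemma traj_state d T m (A : 'I_m -> 'M[R]_d) (eta : 'I_m -> nat -> 'cV[R]_d) l t :
  (t <= T.+1)%N -> traj (A l) (eta l) t
  = state A (fun i : 'I_m * 'I_T.+1 * 'I_d => eta i.1.1 i.1.2.+1 i.2 0) l t.
Proof.
move=> tT; apply: traj_ext => s st; apply/colP => j; rewrite mxE succnK inordK//.
exact: leq_trans st tT.
Qed.

(** Weights of zero sum allow the mean Gramian to be subtracted before Cauchy-Schwarz. *)
Lemma gramian_spread_le d T m (A : 'I_m -> 'M[R]_d) (c : 'I_m -> R) (s : R) a b :
  0 <= s -> \sum_l c l ^+ 2 <= s ^+ 2 -> \sum_l c l = 0 ->
  `|\sum_l c l * gramian T (A l) b a| <= s * gramian_spread T A.
Proof.
move=> s0 cs c0; set Gm := mean_gramian T A b a.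
have -> : \sum_l c l * gramian T (A l) b a = \sum_l c l * (gramian T (A l) b a - Gm).
  under [RHS]eq_bigr => l _ do rewrite mulrBr.
  by rewrite sumrB -mulr_suml c0 mul0r subr0.
have h : Num.sqrt (\sum_l (gramian T (A l) b a - Gm) ^+ 2) <= gramian_spread T A.
  apply: le_trans (le_bigmax _ (fun a => \big[Num.max/0]_(b < d)
    Num.sqrt (\sum_(l < m) (gramian T (A l) b a - mean_gramian T A b a) ^+ 2)) a).
  exact: (le_bigmax _ (fun b => Num.sqrt (\sum_(l < m) (gramian T (A l) b a - mean_gramian T A b a) ^+ 2)) b).
apply: (@le_trans _ _ (s * Num.sqrt (\sum_l (gramian T (A l) b a - Gm) ^+ 2))); last first.
  exact: ler_wpM2l.
rewrite -sqrtr_sqr -[s]ger0_norm// -[`|s|]sqrtr_sqr -sqrtrM ?sqr_ge0//.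
apply: ler_wsqrtr; apply: le_trans (cauchy_schwarz_sum _ _) _.
by apply: ler_wpM2r => //; apply: sumr_ge0 => l _; exact: sqr_ge0.
Qed.

End Assembly.

Section GoodEvent.
Variables (R : realType) (d T m n : nat) (A : 'I_m -> 'M[R]_d) (Dp : 'M[R]_(m, n)).
Notation J := ('I_m * 'I_T.+1 * 'I_d)%type.
Variables (disp : measure_display) (Omega : measurableType disp).
Variables (P : probability Omega R) (X : J -> {RV P >-> R}).

Lemma good_event (rho mu nu Rr L y1 y2 v delta : R) :
  gaussian_family X -> 0 <= rho -> rho < 1 -> (forall l, mx_op_le (A l) rho) ->
  (0 < T)%N -> (0 < d)%N -> (0 < m)%N -> (0 < n)%N ->
  0 <= mu -> (forall e, \sum_l Dp l e ^+ 2 <= mu ^+ 2) -> (forall e, \sum_l Dp l e = 0) ->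
  0 <= nu -> (forall l, \sum_e Dp l e ^+ 2 <= nu ^+ 2) ->
  0 < Rr -> 1 <= L -> 1 <= v -> (n * d * d)%:R <= expR L -> 1 <= y1 -> 1 <= y2 ->
  0 <= delta ->
  (d * d)%:R * (2 * expR (- y1)) <= delta / 4 ->
  (n * d * d)%:R * (2 * expR (- y2)) <= delta / 4 ->
  2000 * (500 * ((Num.sqrt m%:R)^-1 * Num.sqrt d%:R * Num.sqrt (d%:R + v)))
    <= Num.sqrt T%:R * (1 - rho) ^+ 2 ->
  2000 * (500 * (nu * Rr * Num.sqrt (L + v))) <= Num.sqrt T%:R * (1 - rho) ^+ 2 ->
  whp P (delta + 4 * expR (- Num.sqrt v)) (fun w => let g i := X i w in
    [/\ forall M : 'M[R]_d, `|dv (T := T) A (fun=> M) (fun=> M) g| <= T%:R / 6 * (m%:R * fsq M),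
        forall u h, 0 <= h -> \sum_p `|u p| <= Rr * h ->
          \sum_l fsq (lcomb (edge_mx Dp) u l) <= h ^+ 2 ->
          `|dv (T := T) A (lcomb (edge_mx Dp) u) (lcomb (edge_mx Dp) u) g| <= T%:R / 6 * h ^+ 2,
        forall e b c, `|\sum_l Dp l e * second_moment A g l b c|
          <= 64 * (mu * Num.sqrt T%:R / (1 - rho) ^+ 2 * y2) + mu * gramian_spread T A,
        forall b c, `|\sum_l noise_moment A g l b c|
          <= 64 * (Num.sqrt m%:R * Num.sqrt T%:R / (1 - rho) * y1)
      & forall e b c, `|\sum_l Dp l e * noise_moment A g l b c|
          <= 64 * (mu * Num.sqrt T%:R / (1 - rho) * y2)]).
Proof.
move=> gX r0 r1 hA T0 d0 m0 n0 mu0 hmu Dp0 nu0 hnu Rr0 L1 v1 VL y11 y21 dl0 t1 t2 s1 s2.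
have v0 : 0 <= v by apply: le_trans v1.
have E1 := common_event gX r0 r1 hA T0 d0 m0 v0 s1.
have E2 := edge_event gX r0 r1 hA T0 d0 n0 nu0 hnu Rr0 L1 v0 VL s2.
have E3 := whp_forall (fun p : 'I_n * 'I_d * 'I_d =>
  second_moment_event r0 r1 hA gX p.1.2 p.2 T0 mu0 (hmu p.1.1) y21).
have E4 := whp_forall (fun p : 'I_n * 'I_d * 'I_d =>
  noise_event r0 r1 hA gX p.2 p.1.2 T0 mu0 (hmu p.1.1) y21).
have sm1 : \sum_(l < m) (1 : R) ^+ 2 <= Num.sqrt m%:R ^+ 2.
  by rewrite sqr_sqrtr// expr1n sumr_const card_ord.
have E5 := whp_forall (fun p : 'I_d * 'I_d =>
  noise_event r0 r1 hA gX p.2 p.1 T0 (sqrtr_ge0 m%:R) sm1 y11).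
(* The two chaining events fail with probability [expR (- v)] each; each of the three families of
   moments costs delta / 4 by a union bound over its indices. *)
apply: whp_sub (whp_and E1 (whp_and E2 (whp_and E3 (whp_and E4 E5)))).
  rewrite !card_prod !card_ord.
  have : expR (- v) <= expR (- Num.sqrt v) by rewrite ler_expR lerN2 le_mul_sqrt.
  have := expR_ge0 (- Num.sqrt v).
  move: t1 t2; clear -dl0; set a := _%:R * _; set b := _%:R * _; lra.
move=> w [h1 [h2 [h3 [h4 h5]]]] g; split => //.
- move=> e b c; have := h3 (e, b, c) => /= h.
  have := gramian_spread_le T A c b mu0 (hmu e) (Dp0 e) => h'.
  rewrite -[X in `|X|](subrK (\sum_l Dp l e * gramian T (A l) b c)).
  by apply: le_trans (ler_normD _ _) (lerD h h').
- move=> b c; have := h5 (b, c) => /=; under eq_bigr => l _ do rewrite mul1r; exact.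
- by move=> e b c; exact: (h4 (e, b, c)).
Qed.

End GoodEvent.

(** * Constants *)

Section SampleSize.
Variable R : realType.

Lemma sample_size_common (k d m T q v : R) : 0 <= k -> 0 <= d -> 0 < m -> 0 < q -> 0 <= v -> 0 <= T ->
  k ^+ 2 * ((d + v) ^+ 2 / (m * q ^+ 2)) <= T ->
  k * ((Num.sqrt m)^-1 * Num.sqrt d * Num.sqrt (d + v)) <= Num.sqrt T * q.
Proof.
move=> k0 d0 m0 q0 v0 T0 h.
have sm0 : 0 < Num.sqrt m by rewrite sqrtr_gt0.
have sdv : Num.sqrt d * Num.sqrt (d + v) <= d + v.
  have : Num.sqrt d <= Num.sqrt (d + v) by apply: ler_wsqrtr; lra.
  move=> /(ler_wpM2r (sqrtr_ge0 (d + v))) /le_trans; apply.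
  by rewrite -expr2 sqr_sqrtr// addr_ge0.
have : k * (d + v) <= Num.sqrt T * (Num.sqrt m * q).
  apply: le_sqrt_mul => //; first by rewrite (mulr_ge0 (ltW sm0))// ltW.
  rewrite !exprMn (sqr_sqrtr (ltW m0)) -ler_pdivrMr; last by rewrite mulr_gt0// exprn_gt0.
  by rewrite -mulrA.
have -> : k * ((Num.sqrt m)^-1 * Num.sqrt d * Num.sqrt (d + v))
    = k * (Num.sqrt d * Num.sqrt (d + v)) / Num.sqrt m by ring.
rewrite ler_pdivrMr// => h2; apply: le_trans (ler_wpM2l k0 sdv) _.
by apply: le_trans h2 _; rewrite le_eqVlt; apply/orP; left; apply/eqP; ring.
Qed.

Lemma sample_size_edge (k nu Phi L T q v : R) : 0 <= k -> 0 <= nu -> 0 <= Phi -> 2^-1 <= L ->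
  0 < q -> 1 <= v -> 0 <= T ->
  (8 * k) ^+ 2 * (v / q ^+ 2) * (1 + nu * Phi * Num.sqrt L) ^+ 2 <= T ->
  k * (nu * (4 * Phi) * Num.sqrt (2 * L + v)) <= Num.sqrt T * q.
Proof.
move=> k0 nu0 Phi0 L0 q0 v1 T0 h.
have v0 : 0 <= v by apply: le_trans v1.
have L0' : 0 <= L by lra.
(* [2 * L + v <= 4 * v * L], by [2^-1 <= L] and [1 <= v]. *)
have sLv : Num.sqrt (2 * L + v) <= 2 * (Num.sqrt v * Num.sqrt L).
  rewrite -[leRHS]ger0_norm; last by rewrite mulr_ge0// mulr_ge0// sqrtr_ge0.
  rewrite -sqrtr_sqr; apply: ler_wsqrtr; rewrite !exprMn !sqr_sqrtr//.
  by clear -L0 v1; nra.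
have sv0 := sqrtr_ge0 v; have sL0 := sqrtr_ge0 L.
apply: (@le_trans _ _ (8 * k * Num.sqrt v * (1 + nu * Phi * Num.sqrt L))).
  have npk : 0 <= k * (nu * Phi) by rewrite !mulr_ge0.
  have := ler_wpM2l npk sLv.
  have : 0 <= k * Num.sqrt v by rewrite mulr_ge0.
  clear; set a := Num.sqrt (2 * L + v); lra.
apply: le_sqrt_mul => //; first by rewrite ltW.
rewrite !exprMn sqr_sqrtr// -ler_pdivrMr; last by rewrite exprn_gt0.
by move: h; rewrite exprMn => /(le_trans _); apply; rewrite le_eqVlt; apply/orP; left;
  apply/eqP; ring.
Qed.

Lemma sample_size_cross (k mu Phi L d m T q sp : R) : 300 <= k -> 0 <= mu -> 0 <= Phi ->
  0 <= L -> 0 <= d -> 0 < m -> 0 < q -> 0 <= T -> 0 <= sp ->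
  (100 * k) ^+ 2 * (mu ^+ 2 * Phi ^+ 2 * L ^+ 2 * d ^+ 2 / (m * q ^+ 2)) <= T ->
  (100 * k) ^+ 2 * (mu / Num.sqrt m) * Phi * d * sp <= T ->
  12 * ((64 * (mu * Num.sqrt T / q * (4 * L)) + mu * sp) * d * (4 * Phi)) <= T * Num.sqrt m.
Proof.
move=> k0 mu0 Phi0 L0 d0 m0 q0 T0 sp0 h1 h2.
have sm0 : 0 < Num.sqrt m by rewrite sqrtr_gt0.
have a1 : 100 * k * (mu * Phi * L * d) <= Num.sqrt T * (Num.sqrt m * q).
  apply: le_sqrt_mul => //; first by rewrite (mulr_ge0 (ltW sm0))// ltW.
  rewrite [in leRHS]exprMn (sqr_sqrtr (ltW m0)) -ler_pdivrMr; last by rewrite mulr_gt0// exprn_gt0.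
  by apply: le_trans h1; rewrite le_eqVlt; apply/orP; left; apply/eqP; ring.
(* Each summand is granted half of the right-hand side: 96 = 2 * 12 * 4 here, and 96 * 256 = 2 * 12
   * 64 * 4 * 4 in [a3]. *)
have a2 : 96 * (mu * Phi * d * sp) <= T * Num.sqrt m.
  rewrite -ler_pdivrMr//; apply: le_trans h2.
  have X0 : 0 <= mu * Phi * d * sp / Num.sqrt m by rewrite divr_ge0 ?sqrtr_ge0// !mulr_ge0.
  have : 96 * (mu * Phi * d * sp / Num.sqrt m) <= (100 * k) ^+ 2 * (mu * Phi * d * sp / Num.sqrt m).
    apply: ler_wpM2r => //; clear -k0; nra.
  rewrite mulrA => /le_trans; apply.
  by rewrite le_eqVlt; apply/orP; left; apply/eqP; ring.
have X1 : 0 <= mu * Phi * L * d by rewrite !mulr_ge0.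
have a3 : 96 * 256 * (mu * Phi * L * d) <= Num.sqrt T * (Num.sqrt m * q).
  apply: le_trans a1; apply: ler_wpM2r => //; lra.
have : 96 * 256 * (mu * Phi * L * d) * (Num.sqrt T / q) <= T * Num.sqrt m.
  apply: (@le_trans _ _ (Num.sqrt T * (Num.sqrt m * q) * (Num.sqrt T / q))).
    by apply: ler_wpM2r => //; rewrite divr_ge0 ?sqrtr_ge0// ltW.
  rewrite -[T in leRHS]sqr_sqrtr// le_eqVlt; apply/orP; left; apply/eqP.
  by field; rewrite lt0r_neq0.
move: a2; clear; set iq := q^-1; lra.
Qed.

End SampleSize.

Lemma sqrt_div_sqr (R : realType) (T r : R) : 0 <= T -> 0 < r ->
  Num.sqrt (T / r ^+ 2) = Num.sqrt T / r.
Proof.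
by move=> T0 r0; rewrite sqrtrM// sqrtrV ?exprn_ge0 ?ltW// sqrtr_sqr ger0_norm// ltW.
Qed.

(** K / 8 is the constant of [chain_whp]; 8 = 4 * 2 combines the radius 4 Phi with sqrt(2 L + v) <=
    2 sqrt(v L). The existential keeps only the two relations that matter. *)
Lemma sample_constant (R : realType) : exists K : R,
  300 <= K / 100 /\ forall z, 2000 * (500 * z) = K / 8 * z.
Proof.
exists (8 * (2000 * 500)); split; first by lra.
by move=> z; rewrite [8 * _]mulrC mulfK ?mulrA// pnatr_eq0.
Qed.

(** 2 from the half of the penalty that pays for the noise, 64 from the moment events, 4 from the
    levels [4 * L1] and [4 * L2]. *)
Lemma penalty_constant (R : realType) : exists c : R,
  0 < c /\ forall z, 2 * (64 * (4 * z)) = c * z.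
Proof.
exists (2 * (64 * 4)); split; last by move=> z; ring.
by rewrite !mulr_gt0 ?ltr0n.
Qed.
Theorem corollary1 (R : realType) :
  exists c1 C c' c2 : R,
  [/\ 0 < c1, 0 < C, 0 < c' & 0 < c2 < 1] /\
  forall (d T m : nat) (E : {set {set 'I_m}}) (src tgt : 'I_#|E| -> 'I_m)
    (Dp : 'M[R]_(m, #|E|)) (A : 'I_m -> 'M[R]_d)
    (disp : measure_display) (Omega : measurableType disp)
    (P : probability Omega R) (eta : 'I_m -> nat -> 'I_d -> {RV P >-> R})
    (rho delta v : R) (S : {set 'I_(#|E| * (d * d))}),
  (1 <= d)%N -> (1 <= T)%N -> (2 <= m)%N ->
  simple_graph E -> connected_graph E -> orientation src tgt ->
  let D : 'M[R]_(#|E|, m) := incidence R src tgt in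
  is_moore_penrose D Dp ->
  iid_std_gaussian
    (fun lt : 'I_m * 'I_T.+1 => eta lt.1 (nat_of_ord lt.2).+1) ->
  (forall l, spectral_norm (A l) <= rho) -> rho < 1 ->
  0 < delta < c2 -> 1 <= v ->
  let x (w : Omega) (l : 'I_m) : nat -> 'cV[R]_d :=
    traj (A l) (fun t => \col_i eta l t i w) in
  let Dt := tensmx D (1%:M : 'M[R]_(d * d)) in
  let astar := stack (fun l => vec (A l)) in
  let mu := max_col_norm Dp in
  let mu' := max_row_norm Dp in
  let kappa := compatibility Dt S in
  let bias := norm1_on (~: S)%SET (Dt *m astar) in
  let Delta := (1 - rho) ^+ 2 in
  let L1 := ln (d%:R * T%:R / (delta * Delta)) in
  let L2 := ln (d%:R * #|E|%:R / delta) in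
  let Phi := 1 + Num.sqrt #|S|%:R / kappa + Num.sqrt T%:R * bias in
  let lambda := c1 / m%:R * Num.sqrt (T%:R / Delta)
    * Num.max (d%:R `^ (3 / 2) * L1) (mu * L2) in
  T%:R >= C * (v / Delta ^+ 2) * (1 + mu' * Phi * Num.sqrt L2) ^+ 2 ->
  T%:R >= C * ((d%:R + v) ^+ 2 / (m%:R * Delta ^+ 2)) ->
  T%:R >= C * (mu ^+ 2 * Phi ^+ 2 * L2 ^+ 2 * d%:R ^+ 2
               / (m%:R * Delta ^+ 2)) ->
  T%:R >= C * (mu / Num.sqrt m%:R) * Phi * d%:R * gramian_spread T A ->
  forall ahat : Omega -> 'cV[R]_(m * (d * d)),
  (forall w, is_estimator T Dt lambda (x w) (ahat w)) ->
  (* the set on which the bound holds need not be measurable when ahat is not *)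
  exists B : set Omega,
  [/\ measurable B,
      ((1 - 4 * expR (- (c' * Num.sqrt v)) - delta)%:E <= P B)%E
    & forall w, B w ->
      norm2 (ahat w - astar)
      <= 2 * m%:R * lambda / T%:R * (1 + 3 * (Num.sqrt #|S|%:R / kappa))
         + Num.sqrt (8 * (m%:R * lambda / T%:R) * bias)
         + (Num.sqrt T%:R)^-1].
Proof.
have [K [K300 hK]] := sample_constant R.
have [c1 [c10 hc1]] := penalty_constant R.
have K0 : 0 < K by lra.
have K100 : 100 * (K / 100) = K by lra.
have K8 : 8 * (K / 8) = K by lra.
have half4 (z : R) : 2^-1 <= z -> 1 <= 4 * z by lra.
have half2 (z : R) : 2^-1 <= z -> 1 <= 2 * z by lra.
(* Three of the four sample-size conditions are used after a square root, whence [K ^+ 2].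
   [delta < 2^-1] makes both logarithms at least 1/2, so the levels [4 * L1], [4 * L2] and the net
   parameter [2 * L2] are at least 1. *)
exists c1, (K ^+ 2), 1, 2^-1; split.
  split; [exact: c10 | exact: exprn_gt0 | exact: ltr01 |].
  by rewrite invr_gt0 ltr0n/= invf_lt1 ?ltr1n ?ltr0n.
move=> d T m E src tgt Dp A disp Omega P eta rho delta v S d1 T1 m2 _ cE oE D mpD iid
  specA rho1 /andP[dl0 dl1] v1 x Dt astar mu mu' kappa bias Delta L1 L2 Phi lambda
  H1 H2 H3 H4 ahat est.
have m0 : (0 < m)%N by apply: leq_trans m2.
have n0 := edges_gt0 m2 cE.
have [r0 _] := spectral_norm_le (specA (Ordinal m0)).
have hA l : mx_op_le (A l) rho by have [] := spectral_norm_le (specA l).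
have rp : 0 < 1 - rho by rewrite subr_gt0.
have Dl0 : 0 < Delta by rewrite exprn_gt0.
have Dl1 : Delta <= 1 by rewrite /Delta exprn_ile1 ?(ltW rp)// gerBl.
have dR : 1 <= d%:R :> R by rewrite ler1n.
have d0 : 0 <= d%:R :> R by exact: ler0n.
have TR : 1 <= T%:R :> R by rewrite ler1n.
have nR : 1 <= #|E|%:R :> R by rewrite ler1n.
have mR : 0 < m%:R :> R by rewrite ltr0n.
have T0 : 0 <= T%:R :> R := ler0n R T.
have v0 : 0 <= v by apply: le_trans v1.
pose X (p : 'I_m * 'I_T.+1 * 'I_d) : {RV P >-> R} := eta p.1.1 p.1.2.+1 p.2.
have gX : gaussian_family X := iid_std_gaussian_family iid.
have q1d : d%:R <= d%:R * T%:R / Delta.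
  by rewrite ler_pdivlMr// ler_wpM2l// (le_trans Dl1).
have q1n : 1 <= d%:R * T%:R / Delta by apply: le_trans q1d.
have q10 : 0 <= d%:R * T%:R / Delta by apply: le_trans q1n.
have N1 : (d * d)%:R <= (d%:R * T%:R / Delta) ^+ 4.
  apply: (@le_trans _ _ (d%:R ^+ 4)); last by apply: lerXn2r; rewrite ?nnegrE.
  by rewrite natrM -expr2 ler_weXn2l.
have [L1half tail1] := log_tail dl0 dl1 q1n N1.
have L1E : ln (d%:R * T%:R / Delta / delta) = L1.
  by rewrite /L1 -mulrA -invfM [delta * _]mulrC.
have q2n : 1 <= d%:R * #|E|%:R :> R by rewrite -natrM ler1n muln_gt0 d1.
have q20 : 0 <= d%:R * #|E|%:R :> R by apply: le_trans q2n.
have N22 : (#|E| * d * d)%:R <= (d%:R * #|E|%:R) ^+ 2 :> R.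
  have -> : (d%:R * #|E|%:R) ^+ 2 = (#|E| * d * d)%:R * #|E|%:R :> R by rewrite !natrM; ring.
  by rewrite ler_peMr.
have N2 : (#|E| * d * d)%:R <= (d%:R * #|E|%:R) ^+ 4 :> R.
  by apply: le_trans N22 _; rewrite ler_weXn2l.
have [L2half tail2] := log_tail dl0 dl1 q2n N2.
rewrite L1E in L1half tail1; rewrite -/L2 in L2half tail2.
have dl1' : delta <= 1.
  by apply: le_trans (ltW dl1) _; rewrite invf_le1 ?ltr0n// ler1n.
(* There are at most (d #|E| / delta)^2 edge entries, so [2 * L2] serves as their
   log-cardinality. *)
have VL : (#|E| * d * d)%:R <= expR (2 * L2).
  rewrite (expRM_natl 2) lnK ?posrE ?divr_gt0 ?(lt_le_trans _ q2n)//.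
  apply: le_trans N22 _; apply: lerXn2r; rewrite ?nnegrE ?divr_ge0 ?(ltW dl0)//.
  by rewrite ler_pdivlMr// ler_piMr.
have mu0 : 0 <= mu := max_col_norm_ge0 Dp.
have mu'0 : 0 <= mu' := max_row_norm_ge0 Dp.
have [_ s0] := compatibility_le S 0 (ltr0Sn R 1)
  (fun u k => @incidence_coord_le R d m E src tgt u k).
have b0 : 0 <= bias := norm1_on_ge0 _ _.
have Phi1 : 1 <= Phi by rewrite /Phi -addrA lerDl addr_ge0// mulr_ge0 ?sqrtr_ge0.
have Phi0 : 0 <= Phi by apply: le_trans Phi1.
have Rr0 : 0 < 4 * Phi by rewrite mulr_gt0// (lt_le_trans _ Phi1).
have h0 : 0 < 2^-1 :> R by rewrite invr_gt0 ltr0n.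
have L20 : 0 <= L2 by apply: le_trans (ltW h0) L2half.
have L10 : 0 < L1 by apply: lt_le_trans h0 L1half.
have sp0 : 0 <= gramian_spread T A := bigmax_ge_id _ _ _ _.
have sc : 2000 * (500 * ((Num.sqrt m%:R)^-1 * Num.sqrt d%:R * Num.sqrt (d%:R + v)))
    <= Num.sqrt T%:R * (1 - rho) ^+ 2.
  rewrite hK; apply: le_trans (sample_size_common (ltW K0) d0 mR Dl0 v0 T0 H2).
  apply: ler_wpM2r; first by rewrite !mulr_ge0 ?invr_ge0 ?sqrtr_ge0.
  by rewrite ler_pdivrMr ?ltr0n// ler_peMr ?(ltW K0)// ler1n.
have se : 2000 * (500 * (mu' * (4 * Phi) * Num.sqrt (2 * L2 + v)))
    <= Num.sqrt T%:R * (1 - rho) ^+ 2.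
  rewrite hK; apply: sample_size_edge => //; last by rewrite K8.
  by rewrite divr_ge0 ?(ltW K0).
have sx : 12 * ((64 * (mu * Num.sqrt T%:R / (1 - rho) ^+ 2 * (4 * L2))
    + mu * gramian_spread T A) * d%:R * (4 * Phi)) <= T%:R * Num.sqrt m%:R.
  by apply: (@sample_size_cross R (K / 100)) => //; rewrite K100.
have [B [mB PB good]] := good_event gX r0 rho1 hA T1 d1 m0 n0 mu0
  (fun e => col_norm_le Dp e) (fun e => pinv_col_sum mpD e) mu'0 (fun l => row_norm_le Dp l)
  Rr0 (half2 _ L2half) v1 VL (half4 _ L1half) (half4 _ L2half) (ltW dl0) tail1 tail2 sc se.
exists (~` B)%classic; split; first exact: measurableC.
  rewrite probability_setC// mul1r.
  apply: le_trans (leeB (lexx 1%E) PB).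
  by rewrite -EFinB lee_fin opprD addrA addrAC.
move=> w /good [hM hu hS hN1 hN2].
(* The common part asks for [d%:R * L1] in the penalty, the factor [d] being the price of comparing
   the l1 and Frobenius norms of a block; d^(3/2) dominates it. *)
have dpow : d%:R <= d%:R `^ (3 / 2) :> R.
  rewrite -[leLHS]powRr1; last by [].
  by apply: ler_powR => //; rewrite ler_pdivlMr ?ltr0n// mul1r ler_nat.
have sqE : Num.sqrt (T%:R / Delta) = Num.sqrt T%:R / (1 - rho) by rewrite sqrt_div_sqr.
set mx := Num.max (d%:R `^ (3 / 2) * L1) (mu * L2).
have mx1 : d%:R * L1 <= mx by rewrite /mx le_max ler_pM2r// dpow.
have mx2 : mu * L2 <= mx by rewrite /mx le_max lexx orbT.
have f0 : 0 < Num.sqrt T%:R / (1 - rho).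
  by rewrite divr_gt0// sqrtr_gt0 (lt_le_trans _ TR).
have mlE : m%:R * lambda = c1 * (Num.sqrt T%:R / (1 - rho)) * mx.
  rewrite /lambda sqE -/mx; set F := Num.sqrt T%:R / _.
  by rewrite !mulrA [m%:R * c1]mulrC mulfK// lt0r_neq0.
have mx0 : 0 < mx by apply: lt_le_trans mx1; rewrite mulr_gt0// (lt_le_trans _ dR).
have cf0 : 0 <= c1 * (Num.sqrt T%:R / (1 - rho)) by rewrite mulr_ge0 ?ltW.
have l0 : 0 < lambda.
  by rewrite -(pmulr_rgt0 _ mR) mlE; apply: mulr_gt0 => //; apply: mulr_gt0.
have xE l t : (t <= T.+1)%N -> x w l t = state A (fun i => X i w) l t.
  move=> tT; rewrite [LHS](traj_state A (fun l t => \col_i eta l t i w) l tT).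
  congr (state A _ l t).
  by apply/funext => i; rewrite mxE.
apply: (deterministic_bound cE oE mpD xE m0 T1 l0 _ _ hM hu hS sx hN1 hN2) => //.
- by rewrite mulr_ge0// mulr_ge0 ?(mulr_ge0 _ (ltW L10))// divr_ge0 ?(ltW rp)// mulr_ge0 ?sqrtr_ge0.
- rewrite addr_ge0 ?(mulr_ge0 mu0)// mulr_ge0// mulr_ge0 ?(mulr_ge0 _ L20)//.
  by rewrite divr_ge0 ?(ltW Dl0)// mulr_ge0 ?sqrtr_ge0.
- rewrite mlE.
  have -> : 2 * (64 * (Num.sqrt m%:R * Num.sqrt T%:R / (1 - rho) * (4 * L1)) * d%:R)
      = c1 * (Num.sqrt T%:R / (1 - rho)) * (d%:R * L1) * Num.sqrt m%:R.
    by rewrite -!mulrA -hc1; ring.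
  by apply: ler_wpM2r; [exact: sqrtr_ge0 | exact: ler_wpM2l].
- rewrite mlE.
  have -> : 2 * (64 * (mu * Num.sqrt T%:R / (1 - rho) * (4 * L2)))
      = c1 * (Num.sqrt T%:R / (1 - rho)) * (mu * L2).
    by rewrite -!mulrA -hc1; ring.
  exact: ler_wpM2l.
- exact: est.
Qed.
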